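(* Let $(G_n)_{n\ge1}$ be a sequence of finite connected graphs such that $|V(G_n)|\to\infty$ and such that the maximum degrees of the $G_n$ are bounded above by some constant $D$. Consider the disordered monomer-dimer model on each $G_n$, with edge weight and vertex weight distributions not depending on $n$. Assume that the vertex weights and the edge weights have finite fourth moment and that the edge weight distribution is non-degenerate (not a point mass). Writing $F_n=\log Z_{G_n}$ for the free energy associated with $\mu_{G_n}$, one has $$\frac{F_n-\mathbf{E}F_n}{\sqrt{\mathrm{Var}(F_n)}}\stackrel{d}{\to}N(0,1)\quad\text{as }n\to\infty,$$ where $\stackrel{d}{\to}$ denotes convergence in distribution.
   Context: Let $G=(V(G),E(G))$ be a finite graph. A (partial) matching of $G$ is a set of edges of $G$ no two of which share a vertex; $\mathcal{M}_G$ is the set of all matchings of $G$ (including the empty one). For $x\in V(G)$ and $M\in\mathcal{M}_G$, $x\notin M$ means that $x$ is not an endpoint of any edge of $M$ (it is unmatched). The edges carry i.i.d. real weights $(w_e)_{e\in E(G)}$ and the vertices carry i.i.d. real weights $(\nu_x)_{x\in V(G)}$; the edge weights are independent of the vertex weights, and the two distributions may differ. The disordered monomer-dimer model on $G$ (with inverse temperature normalized to $1$, absorbed in the weights) is the random Gibbs measure $\mu_G(M)=Z_G^{-1}\exp(\sum_{e\in M}w_e+\sum_{x\notin M}\nu_x)$, $M\in\mathcal{M}_G$, with partition function $Z_G=\sum_{M\in\mathcal{M}_G}\exp(\sum_{e\in M}w_e+\sum_{x\notin M}\nu_x)$. The free energy is $F=\log Z_G$. $\mathbf{E},\mathrm{Var}$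 refer to the randomness of the weights. *)

(* Defs.v *)
From HB Require Import structures.
From mathcomp Require Import all_boot all_order all_algebra.
From mathcomp Require Import all_classical all_reals all_analysis.
From mathcomp Require Import measurable_realfun.

Set Implicit Arguments.
Unset Strict Implicit.
Unset Printing Implicit Defensive.

Import Order.TTheory GRing.Theory Num.Theory.
Import numFieldNormedType.Exports.

Local Open Scope classical_set_scope.
Local Open Scope ring_scope.

(** * Finite simple graphs and matchings *)

Record sgraph : Type := SGraph {
  vertex :> finType;
  adj : rel vertex;
  adj_sym : symmetric adj;
  adj_irrefl : irreflexive adj }.

Definition is_edge (G : sgraph) (e : {set G}) : bool :=
  [exists x : G, exists y : G, adj x y && (e == [set x; y]%SET)].

Definition edge (G : sgraph) : finType := {e : {set G} | is_edge e}.

Definition graph_connected (G : sgraph) : bool :=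
  (0 < #|G|)%N && [forall x : G, forall y : G, connect (@adj G) x y].

Definition max_degree (G : sgraph) : nat :=
  (\max_(x : G) #|[set y : G | adj x y]%SET|)%N.

Definition is_matching (G : sgraph) (M : {set edge G}) : bool :=
  [forall e in M, forall f in M,
     (e != f) ==> [disjoint (val e : {set G}) & (val f : {set G})]].

Definition matched (G : sgraph) (M : {set edge G}) (x : G) : bool :=
  [exists e in M, x \in (val e : {set G})].

(** * The monomer-dimer model with fixed weights *)

Section model.
Context {R : realType} (G : sgraph).
Variables (w : edge G -> R) (nu : G -> R).

Definition boltzmann (M : {set edge G}) : R :=
  expR (\sum_(e in M) w e + \sum_(x : G | ~~ matched M x) nu x).

Definition partition_function : R :=
  \sum_(M : {set edge G} | is_matching M) boltzmann M.

Definition gibbs (M : {set edge G}) : R :=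
  if is_matching M then boltzmann M / partition_function else 0.

Definition free_energy : R := ln partition_function.

End model.

(** * Laws, independence, convergence in distribution *)

Section laws.
Context {R : realType}.
Local Open Scope ereal_scope.

(* Measures are functions on all sets, with no meaning outside the sigma-algebra;
   hence the restriction to measurable sets. *)
Definition same_law (mu1 mu2 : set R -> \bar R) : Prop :=
  forall B, measurable B -> mu1 B = mu2 B.

Definition non_degenerate (mu : set R -> \bar R) : Prop :=
  forall c : R, ~ same_law mu \d_c.

Definition finite_fourth_moment (mu : probability R R) : Prop :=
  \int[mu]_x (x ^+ 4)%:E < +oo.

Definition mutually_independent d (T : measurableType d) (P : probability T R)
    (I : finType) (X : I -> {RV P >-> R}) : Prop :=
  forall (J : {set I}) (B : I -> set R),
    (forall i, i \in J -> measurable (B i)) ->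
    P (\bigcap_(i in [set` J]) (X i @^-1` B i)) =
    \prod_(i in J) P (X i @^-1` B i).

Definition cvg_in_distribution (d : nat -> measure_display)
    (T : forall n, measurableType (d n)) (P : forall n, probability (T n) R)
    (X : forall n, {RV (P n) >-> R})
    (mu : set R -> \bar R) : Prop :=
  forall x : R, {for x, continuous (fun r : R => mu `]-oo, r]%classic)} ->
    cdf (X n) x @[n --> \oo] --> mu `]-oo, x]%classic.

End laws.

Arguments mutually_independent {R d T} P {I} X.
Arguments cvg_in_distribution {R d T} P X mu.

(** * The disordered model *)

Section disordered.
Context {R : realType} d (T : measurableType d) (P : probability T R).

Definition standardize (X : {RV P >-> R}) (t : T) :
    R :=
  (X t - fine 'E_P[X]) / Num.sqrt (fine 'V_P[X]).

Lemma measurable_standardize (X : {RV P >-> R}) : measurable_fun setT (standardize X).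
Proof.
by apply: measurable_funM => //; apply: measurable_funB.
Qed.

HB.instance Definition _ (X : {RV P >-> R}) :=
  isMeasurableFun.Build _ _ _ _ (standardize X) (measurable_standardize X).

Variables (G : sgraph) (w : edge G -> {RV P >-> R})
  (nu : G -> {RV P >-> R}).

Definition random_free_energy (t : T) : R :=
  free_energy (fun e => w e t) (fun x => nu x t).

Lemma measurable_random_free_energy : measurable_fun setT random_free_energy.
Proof.
apply: measurableT_comp; first exact: measurable_ln.
rewrite /partition_function.
under eq_fun do rewrite -big_filter.
apply: measurable_sum => M; apply: measurableT_comp => //.
apply: measurable_funD; under eq_fun do rewrite -big_filter;
  exact: measurable_sum.
Qed.

HB.instance Definition _ :=
  isMeasurableFun.Build _ _ _ _ random_free_energy measurable_random_free_energy.

Definition all_weights (i : edge G + G) : {RV P >-> R} :=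
  match i with inl e => w e | inr x => nu x end.

Definition disordered_weights (lawE lawV : probability R R) :
    Prop :=
  [/\ forall e, same_law (distribution P (w e)) lawE,
      forall x, same_law (distribution P (nu x)) lawV
    & mutually_independent P all_weights].

End disordered.

Arguments standardize {R d T} P X.
Arguments random_free_energy {R d T} P {G} w nu.
Arguments disordered_weights {R d T} P {G} w nu lawE lawV.

(* Main.v *)
Require Import Defs.
From HB Require Import structures.
From mathcomp Require Import all_boot all_order all_algebra.
From mathcomp Require Import all_classical all_reals all_analysis.
From mathcomp Require Import measurable_realfun ring lra zify.

(** The proof combines Stein's method, in the form based on resampling single
weights, with the decay of correlations of the monomer-dimer model.

Call edges and vertices items; each carries one weight, and the free energy F is
a 1-Lipschitz function of all n weights for the l^1 distance. Resample item i,
and let Delta_i be the resulting change of F, and Delta'_i the change when the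
items that precede i in a fixed order have been resampled already. Exchangeability of a weight and its
copy gives an integration by parts formula ([stein_id]), whence
Var F = E T for T = 1/2 sum_i Delta_i Delta'_i, and, for the normalized F and
the solution f of a Stein equation, |E (f'(F) - F f(F))| is at most a constant
times E |T - Var F| / Var F plus the sum of the third moments of the weight
changes divided by (Var F)^(3/2) ([stein_bound]). As each |Delta_i| is at most the change of the
weight, third moments are bounded and the central limit theorem follows from two
facts: Var F is at least of order n, and E |T - Var F| is o(n).

Locality of Delta_i. If item i is the vertex x or an edge at x, the partition
function of G - x does not involve i; so Delta_i is the change of U_x = log (Z_G / Z_(G - x))
([lnZ_diff_root]). The ratio satisfies the recursion
exp U_x = exp nu_x + sum_(z ~ x) exp (w_xz - U_z), with U_z taken in G - x
([logratio_rec]), which contracts errors by the factor l_x / (1 + l_x), where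
l_x is a function of the weights near x ([err_step]). Stopping the recursion
after k steps gives a local function. Since the weights are unbounded, the
contraction is not uniform and there may be D^k paths. Errors are therefore
capped and raised to a large power: steps through vertices with moderate weights
then gain an arbitrarily small factor s, while exceptional vertices are paid for
by a penalty of bounded mean ([capped_err_step], [mean_path_bound_alive]). The
result is [decay]: the truncation error tends to 0 in mean as k grows, uniformly
over all graphs of degree at most D. Consequently T is close to a sum of bounded
variables, each of which depends on a bounded number of others, and such a sum
has a variance O(n) ([stein_T_concentration], [mean_tau_close]). Fourth moments
of the weights control the part of Delta_i Delta'_i lost by truncation.

Lower bound for the variance. The law of the edge weights charges two separated
half-lines ([nondeg_gap]). When the weights around an edge are moderate, moving
its weight across the gap changes F by a definite amount ([lnZ_edge_gap]), so F
has a covariance bounded below with a bounded function of each edge weight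
([edge_effect_lower]). Bessel's inequality adds up these contributions
([variance_ge_covariance]), and a connected graph has sufficiently many edges
([variance_lower_bound]).

The Stein equation is solved for a smoothed indicator of a half-line with a
transition window [a, b]; Mills' bounds on the Gaussian tails make the solution
and its derivatives bounded ([stein_solution]). The bounds hold uniformly over
large graphs ([uniform_bound]), and the windows [x - h, x] and [x, x + h]
enclose the distribution function at x. *)

Import Order.TTheory GRing.Theory Num.Theory.
Import numFieldNormedType.Exports.

Set Implicit Arguments.
Unset Strict Implicit.
Unset Printing Implicit Defensive.

Local Open Scope classical_set_scope.
Local Open Scope ring_scope.

(** * Laws of finite families of independent weights *)
Section product_laws.
Context {R : realType}.

Definition rectangles (J : finType) : set (set (J -> R)) :=
  [set S | exists2 B : J -> set R, (forall j, measurable (B j)) &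
           S = [set y | forall j, B j (y j)]].
Arguments rectangles : clear implicits.

(** Weight configurations remain plain functions, so that the combinatorics needs
no projections; the rectangles are a pi-system on which independence is
literally a product formula. *)
Definition weights (J : finType) := g_sigma_algebraType (rectangles J).

Definition rectangle (J : finType) (B : J -> set R) : set (weights J) :=
  [set y | forall j, B j (y j)].

Lemma measurable_rectangle (J : finType) (B : J -> set R) :
  (forall j, measurable (B j)) -> measurable (rectangle B).
Proof. by move=> mB; apply: sub_sigma_algebra; exists B. Qed.

Lemma measurable_coord (J : finType) (j : J) :
  measurable_fun [set: weights J] (fun y : weights J => y j : R).
Proof.
move=> _ B mB; rewrite setTI.
rewrite (_ : _ @^-1` _ = rectangle (fun k => if k == j then B else setT)).
  by apply: measurable_rectangle => k; case: ifP.
apply/seteqP; split => y /= h.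
  by move=> k; case: eqP => // ->.
by have := h j; rewrite eqxx.
Qed.

Lemma measurable_to_weights d (T : measurableType d) (J : finType) (phi : T -> weights J) :
  (forall j, measurable_fun [set: T] (fun t => phi t j : R)) -> measurable_fun [set: T] phi.
Proof.
move=> h; apply: (@measurability _ _ T (weights J) setT phi (rectangles J)) => //.
move=> _ [_ [B mB ->] <-]; rewrite setTI.
rewrite (_ : _ @^-1` _ = \bigcap_(j in [set: J]) ((fun t => phi t j : R) @^-1` B j)).
  apply: fin_bigcap_measurable; first exact: finite_finset.
  move=> j _.
  rewrite -[X in measurable X]setTI; exact: h.
apply/seteqP; split => [t ht j _|t ht j]; first exact: ht.
exact: (ht j I).
Qed.

Definition rintegrable d (T : measurableType d) (P : {measure set T -> \bar R}) (f : T -> R) :=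
  P.-integrable setT (EFin \o f).
Definition mean d (T : measurableType d) (P : {measure set T -> \bar R}) (f : T -> R) : R :=
  Rintegral P setT f.

Section uniqueness.
Context d (T : measurableType d) (P : probability T R) (J : finType).
Variables (phi : T -> weights J) (Q : probability (weights J) R).
Hypothesis mphi : forall j, measurable_fun [set: T] (fun t => phi t j : R).
Hypothesis PQ : forall B : J -> set R, (forall j, measurable (B j)) ->
  P (phi @^-1` rectangle B) = Q (rectangle B).

(** Rectangles are stable under intersection, so a law on configurations is
determined by its values on them. Every change of variables below (permuting
coordinates, merging two independent copies, forgetting the copy) reduces to a
computation on rectangles through this fact. *)
Lemma law_unique (A : set (weights J)) : measurable A -> P (phi @^-1` A) = Q A.
Proof.
have mp : measurable_fun [set: T] phi by exact: measurable_to_weights.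
pose X : {mfun T >-> weights J} := HB.pack phi (isMeasurableFun.Build _ _ _ _ _ mp).
move=> mA; change (distribution P X A = Q A).
apply: (@measure_unique _ R (weights J) (rectangles J) (fun=> setT) _ _ _ _ (distribution P X) Q _ _ A mA) => //.
- move=> _ _ [B mB ->] [C mC ->]; exists (fun j => B j `&` C j).
    by move=> j; exact: measurableI.
  apply/seteqP; split => y /=; first by move=> [hB hC] j; split.
  by move=> h; split => j; have [] := h j.
- by move=> _; exists (fun=> setT) => //; apply/seteqP; split.
- by apply/seteqP; split => // y _; exists 0%N.
- by move=> _ [B mB ->]; exact: PQ.
- move=> k; apply: (le_lt_trans (probability_le1 (distribution P X) _) (ltry _)).
  exact: measurableT.
Qed.

Let mphiT : measurable_fun [set: T] phi.
Proof. exact: measurable_to_weights. Qed.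

Let X : {RV P >-> weights J} := HB.pack phi (isMeasurableFun.Build _ _ _ _ _ mphiT).

Let int_dist (g : weights J -> \bar R) :
  (\int[distribution P X]_x g x = \int[Q]_x g x)%E.
Proof. by apply: eq_measure_integral => A mA _; exact: law_unique. Qed.

Lemma rintegrable_law (f : weights J -> R) :
  rintegrable Q f -> rintegrable P (f \o phi) /\ mean P (f \o phi) = mean Q f.
Proof.
move=> /integrableP[mf ifoo].
have mf' := mf; move/measurable_EFinP : mf' => mf'.
have If' : rintegrable P (f \o phi).
  apply/integrableP; split; first by apply/measurable_EFinP; exact: measurableT_comp.
  have mg : measurable_fun setT (fun y => `|(EFin \o f) y|%E) by exact: measurableT_comp.
  have := @ge0_integral_distribution _ _ _ _ _ P X _ mg (fun=> abse_ge0 _).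
  by rewrite int_dist => /= <-.
split => //; congr fine; rewrite -int_dist.
exact/esym/(@integral_distribution _ _ _ _ _ P X (EFin \o f)).
Qed.

End uniqueness.

Definition product_law (J : finType) (Q : probability (weights J) R) (mu : J -> probability R R) :=
  forall B : J -> set R, (forall j, measurable (B j)) ->
    Q (rectangle B) = (\prod_j mu j (B j))%E.

Definition depends (J : finType) (U : Type) (f : weights J -> U) (S : {set J}) :=
  forall y z : weights J, (forall j, j \in S -> y j = z j) -> f y = f z.

Section product.
Context (J : finType) (Q : probability (weights J) R) (mu : J -> probability R R).
Hypothesis Qmu : product_law Q mu.

(** Swapping a weight with its independent copy is an instance: this is the
exchangeability that drives the resampling identities. *)
Lemma mean_perm (s : J -> J) (f : weights J -> R) : involutive s ->
  (forall j, mu (s j) = mu j) ->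
  rintegrable Q f -> rintegrable Q (fun y => f (fun j => y (s j))) /\
              mean Q (fun y => f (fun j => y (s j))) = mean Q f.
Proof.
move=> sK mus If.
apply: (@rintegrable_law _ _ Q J (fun y : weights J => (fun j => y (s j)) : weights J)) => //.
  by move=> j; exact: measurable_coord.
move=> B mB.
have -> : (fun y : weights J => (fun j => y (s j)) : weights J) @^-1` rectangle B = rectangle (fun j => B (s j)).
  apply/seteqP; split => y /= h j; last by have := h (s j); rewrite sK.
  by have := h (s j); rewrite sK.
rewrite !Qmu // [LHS](reindex s) /=; last by exists s => j _; exact: sK.
by apply: eq_bigr => j _; rewrite sK mus.
Qed.

(** Draw the coordinates in S from one sample and the others from a second,
independent one: the merged sample has the same product law, while for it the
product f * g splits by Fubini. *)
Lemma mean_indep (S : {set J}) (f g : weights J -> R) :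
  depends f S -> depends g (~: S)%SET -> rintegrable Q f -> rintegrable Q g ->
  rintegrable Q (fun y => f y * g y) ->
  mean Q (fun y => f y * g y) = mean Q f * mean Q g.
Proof.
move=> df dg If Ig Ifg.
pose phi (t : weights J * weights J) : weights J := fun j => if j \in S then t.1 j else t.2 j.
have [] := @rintegrable_law _ _ (Q \x Q)%E J phi Q _ _ _ Ifg.
- move=> j; rewrite /phi; case: (j \in S).
    by apply: (measurableT_comp (measurable_coord j)).
  by apply: (measurableT_comp (measurable_coord j)).
- move=> B mB.
  have -> : phi @^-1` rectangle B = rectangle (fun j => if j \in S then B j else setT) `*`
                               rectangle (fun j => if j \in S then setT else B j).
    apply/seteqP; split => [[y z]|[y z]]; rewrite /phi /rectangle /=.
      by move=> h; split => j; have := h j; case: (j \in S).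
    by move=> [h1 h2] j; have := h1 j; have := h2 j; case: ifP.
  rewrite [LHS]product_measure1E; [|by apply: measurable_rectangle => j; case: (j \in S)..].
  rewrite Qmu //; transitivity ((\prod_j mu j (if j \in S then B j else setT)) *
     (\prod_j mu j (if j \in S then setT else B j)))%E.
    by congr (_ * _)%E; apply: Qmu => j; case: (j \in S).
  rewrite -big_split /=; apply: eq_bigr => j _.
  by case: (j \in S); rewrite probability_setT ?mule1 ?mul1e.
have E1 : (fun y => f y * g y) \o phi = (fun t => f t.1 * g t.2).
  apply/funext => t /=; congr (_ * _).
    by apply: df => j jS; rewrite /phi jS.
  by apply: dg => j; rewrite inE /phi => /negbTE ->.
rewrite E1 => I2 <-.
rewrite /mean /Rintegral.
rewrite -(@integral12_prod_meas1 _ _ _ _ _ Q Q (fun t => (f t.1 * g t.2)%:E)) //=.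
have -> : (fun x : weights J => \int[Q]_y (f x * g y)%:E)%E =
          (fun x => (fine (\int[Q]_y (g y)%:E))%:E * (f x)%:E)%E.
  apply/funext => x.
  have gfin : (\int[Q]_y (g y)%:E)%E \is a fin_num by exact: integrable_fin_num.
  under eq_integral do rewrite EFinM.
  by rewrite integralZl // fineK // muleC.
by rewrite integralZl //= fineM ?integrable_fin_num // mulrC.
Qed.

Lemma marginal (j : J) (B : set R) : measurable B -> Q ((fun y : weights J => y j) @^-1` B) = mu j B.
Proof.
move=> mB.
rewrite (_ : _ @^-1` _ = rectangle (fun k => if k == j then B else setT)).
  rewrite Qmu; last by move=> k; case: ifP.
  rewrite (bigD1 j) //= eqxx big1 ?mule1 // => k /negbTE ->.
  by rewrite probability_setT.
apply/seteqP; split => y /= h.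
  by move=> k; case: eqP => // ->.
by have := h j; rewrite eqxx.
Qed.

End product.

Lemma marginal_int (J : finType) (Q : probability (weights J) R) (mu : J -> probability R R)
   (Qmu : product_law Q mu) (j : J) (h : R -> R) :
  rintegrable (mu j) h -> rintegrable Q (fun y => h (y j)) /\ mean Q (fun y => h (y j)) = mean (mu j) h.
Proof.
move=> Ih.
pose X : {RV Q >-> R} := HB.pack (fun y : weights J => y j : R)
  (isMeasurableFun.Build _ _ _ _ _ (measurable_coord j)).
have E (g : R -> \bar R) : (\int[distribution Q X]_x g x = \int[mu j]_x g x)%E.
  by apply: eq_measure_integral => A mA _; exact: (marginal Qmu).
have /integrableP[mh hoo] := Ih.
have Iq : rintegrable Q (fun y => h (y j)).
  apply/integrableP; split.
    apply/measurable_EFinP; apply: (measurableT_comp (f := h)); last exact: measurable_coord.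
    exact/measurable_EFinP.
  have mg : measurable_fun setT (fun y => `|(EFin \o h) y|%E) by exact: measurableT_comp.
  have := @ge0_integral_distribution _ _ _ _ _ Q X _ mg (fun=> abse_ge0 _).
  by rewrite E => /= <-.
split => //; congr fine; rewrite -E.
exact/esym/(@integral_distribution _ _ _ _ _ Q X (EFin \o h)).
Qed.

Section pairlaw.
Context d (T : measurableType d) (P : probability T R) (I : finType).
Variables (X : I -> {RV P >-> R}) (lam : I -> probability R R).
Hypothesis indX : mutually_independent P X.
Hypothesis lawX : forall i, same_law (distribution P (X i)) (lam i).

Definition joint_map (t : T) : weights I := fun i => X i t.
Definition pair_map (t : T * T) : weights (I + I)%type :=
  fun j => match j with inl i => X i t.1 | inr i => X i t.2 end.

Lemma measurable_joint_map : measurable_fun setT joint_map.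
Proof. by apply: measurable_to_weights => i; exact: measurable_funP. Qed.

Lemma measurable_pair_map : measurable_fun setT pair_map.
Proof.
apply: measurable_to_weights => -[i|i] /=.
  by apply: (measurableT_comp (f := X i)).
by apply: (measurableT_comp (f := X i)).
Qed.

Definition joint_RV : {RV P >-> weights I} :=
  HB.pack joint_map (isMeasurableFun.Build _ _ _ _ _ measurable_joint_map).
Definition pair_RV : {RV (P \x P)%E >-> weights (I + I)%type} :=
  HB.pack pair_map (isMeasurableFun.Build _ _ _ _ _ measurable_pair_map).

Definition joint_law : probability (weights I) R := distribution P joint_RV.
Definition pair_law : probability (weights (I + I)%type) R := distribution (P \x P)%E pair_RV.

Lemma joint_law_product : product_law joint_law lam.
Proof.
move=> B mB; change (P (joint_map @^-1` rectangle B) = (\prod_j lam j (B j))%E).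
have -> : joint_map @^-1` rectangle B = \bigcap_(i in [set` [set: I]%SET]) (X i @^-1` B i).
  apply/seteqP; split => t h i; first by move=> _; exact: h.
  by apply: h; rewrite /= finset.in_setT.
rewrite indX // big_mkcond /=; apply: eq_bigr => i _.
by rewrite finset.in_setT -lawX.
Qed.

(** The resampling argument lives on I + I: [inl i] carries the weight of item i
and [inr i] its independent copy. *)
Definition doubled (j : I + I) := match j with inl i => lam i | inr i => lam i end.

Lemma pair_law_product : product_law pair_law doubled.
Proof.
move=> B mB; change ((P \x P)%E (pair_map @^-1` rectangle B) = (\prod_j doubled j (B j))%E).
have -> : pair_map @^-1` rectangle B =
    (joint_map @^-1` rectangle (B \o inl)) `*` (joint_map @^-1` rectangle (B \o inr)).
  apply/seteqP; split => [t h|t [h1 h2]].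
    by split => i /=; [exact: (h (inl i))|exact: (h (inr i))].
  by move=> [i|i]; [exact: h1|exact: h2].
have m1 (C : I -> set R) : (forall i, measurable (C i)) -> measurable (joint_map @^-1` rectangle C).
  by move=> mC; rewrite -[X in measurable X]setTI; apply: measurable_joint_map => //; exact: measurable_rectangle.
rewrite [LHS]product_measure1E; [|by apply: m1 => i; exact: mB..].
have E (C : I -> set R) : (forall i, measurable (C i)) ->
   P (joint_map @^-1` rectangle C) = (\prod_i lam i (C i))%E by exact: joint_law_product.
rewrite big_sumType /=.
by congr (_ * _)%E; apply: E => i; exact: mB.
Qed.

Lemma mean_joint_law (f : weights I -> R) : rintegrable joint_law f ->
  rintegrable P (fun t => f (joint_map t)) /\ mean P (fun t => f (joint_map t)) = mean joint_law f.
Proof.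
move=> If; apply: (@rintegrable_law _ _ P I joint_map joint_law) => //.
Qed.

End pairlaw.

End product_laws.

(** * Functions of polynomial growth *)
Section growth_section.
Context {R : realType} (J : finType) (Q : probability (weights (R:=R) J) R).

(** The floor at 1 makes growth of degree k imply growth of every larger degree. *)
Definition envelope (y : weights (R:=R) J) : R := \big[Num.max/1]_(j : J) `|y j|.

Lemma envelope_ge1 y : 1 <= envelope y.
Proof. by rewrite /envelope; elim/big_rec: _ => // i x _ h; rewrite le_max h orbT. Qed.

Lemma envelope_ge0 y : 0 <= envelope y.
Proof. exact: le_trans (envelope_ge1 y). Qed.

Lemma coord_le_envelope y j : `|y j| <= envelope y.
Proof. by rewrite /envelope (bigD1 j) //= le_max lexx. Qed.

Lemma envelope_case y : envelope y = 1 \/ exists j, envelope y = `|y j|.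
Proof.
rewrite /envelope; elim/big_rec: _ => [|j x _ h]; first by left.
by rewrite maxEle; case: ifP => _ //; right; exists j.
Qed.

Lemma envelope4 y : envelope y ^+ 4 <= 1 + \sum_j y j ^+ 4.
Proof.
have p4 j : 0 <= y j ^+ 4 by rewrite (exprM _ 2 2) sqr_ge0.
case: (envelope_case y) => [->|[j ->]].
  by rewrite expr1n lerDl sumr_ge0.
rewrite (bigD1 j) //= addrCA -[_ ^+ 4]addr0.
have -> : `|y j| ^+ 4 = y j ^+ 4 by rewrite -normrX ger0_norm.
by apply: lerD => //; rewrite addr_ge0 // sumr_ge0.
Qed.

(** Growth of degree at most 4 is the form in which the moment assumption
provides integrability; the closure lemmas then reduce each integrability
question to counting degrees. *)
Definition growth (k : nat) (f : weights (R:=R) J -> R) :=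
  measurable_fun setT f /\ exists C : R, forall y, `|f y| <= C * envelope y ^+ k.

Implicit Types f g : weights (R:=R) J -> R.

Lemma growth_coord j : growth 1 (fun y => y j).
Proof.
split; first exact: measurable_coord.
by exists 1 => y; rewrite mul1r expr1 coord_le_envelope.
Qed.

Lemma growth_bd f (C : R) : measurable_fun setT f -> (forall y, `|f y| <= C) -> growth 0 f.
Proof. by move=> mf h; split => //; exists C => y; rewrite expr0 mulr1. Qed.

Lemma growth_cst c : growth 0 (fun=> c).
Proof. by apply: (growth_bd (C := `|c|)) => //. Qed.

Lemma growth_le k l f : (k <= l)%N -> growth k f -> growth l f.
Proof.
move=> kl [mf [C hC]]; split => //; exists `|C| => y.
apply: (le_trans (hC y)); apply: (@le_trans _ _ (`|C| * envelope y ^+ k)).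
  by rewrite ler_wpM2r ?ler_norm // exprn_ge0 // envelope_ge0.
by rewrite ler_wpM2l // ler_weXn2l // envelope_ge1.
Qed.

Lemma growthM k l f g : growth k f -> growth l g -> growth (k + l) (fun y => f y * g y).
Proof.
move=> [mf [C hC]] [mg [D hD]]; split; first exact: measurable_funM.
exists (`|C| * `|D|) => y; rewrite normrM exprD mulrACA.
apply: ler_pM => //.
  by apply: (le_trans (hC y)); rewrite ler_wpM2r ?ler_norm // exprn_ge0 // envelope_ge0.
by apply: (le_trans (hD y)); rewrite ler_wpM2r ?ler_norm // exprn_ge0 // envelope_ge0.
Qed.

Lemma growthD k f g : growth k f -> growth k g -> growth k (fun y => f y + g y).
Proof.
move=> [mf [C hC]] [mg [D hD]]; split; first exact: measurable_funD.
by exists (C + D) => y; rewrite (le_trans (ler_normD _ _)) // mulrDl lerD.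
Qed.

Lemma growthN k f : growth k f -> growth k (fun y => - f y).
Proof.
move=> [mf [C hC]]; split; first exact: measurableT_comp.
by exists C => y; rewrite normrN.
Qed.

Lemma growthB k f g : growth k f -> growth k g -> growth k (fun y => f y - g y).
Proof. by move=> hf hg; apply: growthD => //; exact: growthN. Qed.

Lemma growthZ k c f : growth k f -> growth k (fun y => c * f y).
Proof. by move=> hf; have := growthM (growth_cst c) hf; rewrite add0n. Qed.

Lemma growth_abs k f : growth k f -> growth k (fun y => `|f y|).
Proof.
move=> [mf [C hC]]; split; first exact: measurableT_comp.
by exists C => y; rewrite normr_id.
Qed.

Lemma growth_sum k (T : Type) (r : seq T) (p : pred T) (f : T -> weights J -> R) :
  (forall i, growth k (f i)) -> growth k (fun y => \sum_(i <- r | p i) f i y).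
Proof.
move=> h; elim: r => [|a r IH].
  by under eq_fun do rewrite big_nil; apply: (growth_le (k := 0)) => //; exact: growth_cst.
under eq_fun do rewrite big_cons.
by case: (p a) => //; apply: growthD.
Qed.

Lemma growth_lip f : measurable_fun setT f ->
  (forall y z : weights J, `|f y - f z| <= \sum_j `|y j - z j|) -> growth 1 f.
Proof.
move=> mf lipf; split => //.
exists (`|f (fun=> 0)| + #|J|%:R) => y.
have -> : f y = f (fun=> 0) + (f y - f (fun=> 0)) by rewrite addrCA subrr addr0.
rewrite expr1 mulrDl (le_trans (ler_normD _ _)) //; apply: lerD.
  by rewrite -[leLHS]mulr1 ler_wpM2l // envelope_ge1.
apply: (le_trans (lipf _ _)); rewrite mulr_natl -[X in _ <= X *+ _]addr0 -sumr_const.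
by apply: ler_sum => i _; rewrite subr0 addr0 coord_le_envelope.
Qed.

Lemma rintegrable_cst c : rintegrable Q (fun=> c).
Proof. exact: finite_measure_integrable_cst. Qed.

Lemma rintegrableD f g : rintegrable Q f -> rintegrable Q g -> rintegrable Q (fun y => f y + g y).
Proof. by move=> If Ig; exact: (integrableD measurableT If Ig). Qed.

Lemma rintegrableZ c f : rintegrable Q f -> rintegrable Q (fun y => c * f y).
Proof. by move=> If; exact: (integrableZl measurableT c If). Qed.

Lemma rintegrable_sum (T : Type) (r : seq T) (p : pred T) (f : T -> weights J -> R) :
  (forall i, rintegrable Q (f i)) -> rintegrable Q (fun y => \sum_(i <- r | p i) f i y).
Proof.
move=> h; elim: r => [|a r IH].
  rewrite (_ : (fun _ => _) = fun=> 0); first exact: rintegrable_cst.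
  by apply/funext => y; rewrite big_nil.
rewrite (_ : (fun _ => _) = fun y => (if p a then f a y else 0) + \sum_(i <- r | p i) f i y).
  by apply: rintegrableD => //; case: (p a) => //; exact: rintegrable_cst.
by apply/funext => y; rewrite big_cons; case: (p a) => //; rewrite add0r.
Qed.

Hypothesis Q4 : forall j, rintegrable Q (fun y => y j ^+ 4).

(** The fourth power of a maximum is at most the sum of the fourth powers. *)
Lemma growth_rintegrable k f : (k <= 4)%N -> growth k f -> rintegrable Q f.
Proof.
move=> k4 /(growth_le k4) [mf [C hC]].
pose g (y : weights (R:=R) J) : R := `|C| * (1 + \sum_j y j ^+ 4).
have Ig : rintegrable Q g.
  apply: rintegrableZ; apply: rintegrableD; first exact: rintegrable_cst.
  exact: rintegrable_sum.
apply: (le_integrable _ _ _ Ig) => //; first exact/measurable_EFinP.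
move=> y _ /=; rewrite lee_fin (le_trans (hC y)) // /g (le_trans _ (ler_norm _)) //.
apply: (@le_trans _ _ (`|C| * envelope y ^+ 4)).
  by rewrite ler_wpM2r ?ler_norm // exprn_ge0 // envelope_ge0.
by rewrite ler_wpM2l // envelope4.
Qed.

Lemma mean_cst c : mean Q (fun=> c) = c.
Proof.
transitivity (c * fine (Q setT)); first exact: (Rintegral_cst _ measurableT).
by rewrite probability_setT mulr1.
Qed.

Lemma meanD f g : rintegrable Q f -> rintegrable Q g -> mean Q (fun y => f y + g y) = mean Q f + mean Q g.
Proof. by move=> *; exact: RintegralD. Qed.

Lemma meanB f g : rintegrable Q f -> rintegrable Q g -> mean Q (fun y => f y - g y) = mean Q f - mean Q g.
Proof. by move=> *; exact: RintegralB. Qed.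

Lemma meanZ c f : rintegrable Q f -> mean Q (fun y => c * f y) = c * mean Q f.
Proof. by move=> *; exact: RintegralZl. Qed.

Lemma mean_le f g : rintegrable Q f -> rintegrable Q g -> (forall y, f y <= g y) -> mean Q f <= mean Q g.
Proof. by move=> *; exact: le_Rintegral. Qed.

Lemma mean_ge0 f : (forall y, 0 <= f y) -> 0 <= mean Q f.
Proof. by move=> *; exact: Rintegral_ge0. Qed.

Lemma mean_abs f : rintegrable Q f -> `|mean Q f| <= mean Q (fun y => `|f y|).
Proof. by move=> *; exact: le_normr_Rintegral. Qed.

Lemma mean_sum (T : Type) (r : seq T) (p : pred T) (f : T -> weights J -> R) :
  (forall i, rintegrable Q (f i)) ->
  mean Q (fun y => \sum_(i <- r | p i) f i y) = \sum_(i <- r | p i) mean Q (f i).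
Proof.
move=> h; elim: r => [|a r IH].
  rewrite big_nil -[RHS]mean_cst; congr mean.
  by apply/funext => y; rewrite big_nil.
rewrite big_cons -IH (_ : (fun _ => _) =
  fun y => (if p a then f a y else 0) + \sum_(i <- r | p i) f i y).
  rewrite meanD; last exact: rintegrable_sum.
    by case: (p a) => //; rewrite mean_cst add0r.
  by case: (p a) => //; exact: rintegrable_cst.
by apply/funext => y; rewrite big_cons; case: (p a) => //; rewrite add0r.
Qed.

End growth_section.

(** * The Gaussian density and its tails *)
Section normal.
Context {R : realType}.
Implicit Types x y : R.

(** Piecewise polynomial functions are differentiated below without splitting at
their knots, since a quadratic remainder can be checked by cases. *)
Lemma is_derive_quad (f : R -> R) x d C :
  (forall y, `|f y - f x - d * (y - x)| <= C * (y - x) ^+ 2) -> is_derive x (1 : R) f d.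
Proof.
move=> h.
have H : (fun t : R => t^-1 *: (f (t *: (1:R) + x) - f x)) @ 0^' --> d.
  apply/cvgrPdist_le => /= e e0.
  near=> t.
  have t0 : t != 0 by near: t; exact: nbhs_dnbhs_neq.
  rewrite /= distrC.
  have -> : t^-1 *: (f (t *: (1:R) + x) - f x) - d = t^-1 * (f (t + x) - f x - d * (t + x - x)).
    by rewrite /GRing.scale /= mulr1; field.
  rewrite normrM; apply: (@le_trans _ _ (`|t^-1| * (`|C| * t ^+ 2))).
    rewrite ler_wpM2l // (le_trans (h _)) // addrK ler_wpM2r ?sqr_ge0 //.
    exact: ler_norm.
  have -> : `|t^-1| * (`|C| * t ^+ 2) = `|C| * `|t|.
    by rewrite normfV -[t ^+ 2]ger0_norm ?sqr_ge0 // normrX; field; rewrite normr_eq0.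
  have : `|t| <= e / (`|C| + 1).
    near: t; apply: dnbhs0_le; apply: divr_gt0 => //; exact: ltr_wpDl.
  rewrite ler_pdivlMr; last exact: ltr_wpDl.
  by apply: le_trans; rewrite mulrDr mulr1 mulrC lerDl.
split; last by apply/cvg_lim => //; exact: H.
by apply/cvg_ex; exists d; exact: H.
Unshelve. all: by end_near. Qed.

Definition pospart x : R := Num.max x 0.

Lemma is_derive_pospart2 x : is_derive x (1 : R) (fun t => pospart t ^+ 2) (2 * pospart x).
Proof.
apply: (@is_derive_quad _ _ _ 1) => y; rewrite /pospart mul1r ler_norml.
have s0 := sqr_ge0 (y - x).
by case: (leP x 0) => hx; case: (leP y 0) => hy; apply/andP; split; nra.
Qed.

Lemma is_derive_pospart3 x : is_derive x (1 : R) (fun t => pospart t ^+ 3) (3 * pospart x ^+ 2).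
Proof.
have -> : (fun t => pospart t ^+ 3) = (fun t => pospart t ^+ 2 * t).
  by apply/funext => t; rewrite /pospart; case: (leP t 0) => ht; rewrite ?expr0n /= ?mul0r // exprSr.
have D := @is_deriveM _ _ (fun t => pospart t ^+ 2) id x 1 _ _ (is_derive_pospart2 x) (is_derive_id x 1).
apply: is_derive_eq D _.
by rewrite /GRing.scale /= /pospart; case: (leP x 0) => ht; nra.
Qed.

Lemma taylor2 (f k k2 : R -> R) (C : R) :
  (forall x, is_derive x (1 : R) f (k x)) -> (forall x, is_derive x (1 : R) k (k2 x)) ->
  (forall x, `|k2 x| <= C) ->
  forall x y, `|f y - f x - k x * (y - x)| <= C * (y - x) ^+ 2.
Proof.
move=> Df Dk bk.
have cont (g dg : R -> R) : (forall x, is_derive x (1 : R) g (dg x)) -> continuous g.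
  by move=> Dg x; apply/differentiable_continuous/derivable1_diffP; have [] := Dg x.
have mvt (g dg : R -> R) : (forall x, is_derive x (1 : R) g (dg x)) ->
    forall x y, exists c, `|c - x| <= `|y - x| /\ g y - g x = dg c * (y - x).
  move=> Dg x y; case: (leP x y) => xy.
    have [c + E] : exists2 c, c \in `[x, y]%R & g y - g x = dg c * (y - x).
      apply: MVT_segment => //.
      by apply: continuous_subspaceT; exact: (cont _ _ Dg).
    rewrite in_itv /= => /andP[xc cy]; exists c; split => //.
    by rewrite !ger0_norm ?subr_ge0 // lerB.
  have [c + E] : exists2 c, c \in `[y, x]%R & g x - g y = dg c * (x - y).
    apply: MVT_segment => //; first exact: ltW.
    by apply: continuous_subspaceT; exact: (cont _ _ Dg).
  rewrite in_itv /= => /andP[xc cy]; exists c; split => //.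
    rewrite -[`|c - x|]normrN -[`|y - x|]normrN !opprB !ger0_norm ?subr_ge0 ?(ltW xy) //.
    by rewrite lerB.
  by rewrite -opprB E -mulrN opprB.
move=> x y; have [c [hc Ec]] := mvt _ _ Df x y.
have [c' [hc' Ec']] := mvt _ _ Dk x c.
rewrite Ec -mulrBl Ec' !normrM -mulrA ler_pM ?mulr_ge0 //.
by rewrite -[(y - x) ^+ 2]ger0_norm ?sqr_ge0 // normrX expr2 ler_wpM2r.
Qed.

Definition phi x : R := normal_pdf 0 1 x.
Definition Phi x : R := \int[lebesgue_measure]_(t in `]-oo, x]) phi t.

Lemma phiE x : phi x = normal_peak 1 * expR (- x ^+ 2 / 2).
Proof.
by rewrite /phi normal_pdfE ?oner_eq0 // /normal_fun subr0 expr1n.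
Qed.

Lemma phi_gt0 x : 0 < phi x.
Proof. by rewrite phiE mulr_gt0 ?expR_gt0 // normal_peak_gt0 ?oner_eq0. Qed.

Lemma phi_sym x : phi (- x) = phi x.
Proof. by rewrite !phiE sqrrN. Qed.

Lemma phi_le x y : `|x| <= `|y| -> phi y <= phi x.
Proof.
move=> xy; rewrite !phiE ler_wpM2l ?normal_peak_ge0 // ler_expR.
rewrite ler_wpM2r ?invr_ge0 ?ler0n // lerN2.
by rewrite -[x ^+ 2]ger0_norm ?sqr_ge0 // -[y ^+ 2]ger0_norm ?sqr_ge0 // !normrX lerXn2r ?nnegrE.
Qed.

Lemma is_derive_phi x : is_derive x (1 : R) phi (- x * phi x).
Proof.
have -> : phi = (fun x => normal_peak 1 * expR (- x ^+ 2 / 2)).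
  by apply/funext => y; rewrite phiE.
apply: is_derive_eq.
by rewrite /GRing.scale /=; field.
Qed.

Lemma Phi_prob x : (Phi x)%:E = normal_prob (0 : R) 1 `]-oo, x]%classic.
Proof.
rewrite /Phi /Rintegral fineK //.
apply: integrable_fin_num => //.
apply: (integrableS measurableT) => //; exact: integrable_normal_pdf.
Qed.

Lemma is_derive_Phi x : is_derive x (1 : R) Phi (phi x).
Proof.
have x1 : x < x + 1 by rewrite ltrDl.
have If : (@lebesgue_measure R).-integrable `]-oo, x + 1] (EFin \o phi).
  by apply: (integrableS measurableT) => //; exact: integrable_normal_pdf.
have [D E] := continuous_FTC1 x1 If (ltNyr _) (@continuous_normal_pdf R 0 1 (oner_neq0 _) x).
split; first exact: D.
by rewrite -derive1E; exact: E.
Qed.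

Lemma Phi_ge0 x : 0 <= Phi x.
Proof. by rewrite /Phi Rintegral_ge0 // => y _; exact/ltW/phi_gt0. Qed.

Lemma Phi_le1 x : Phi x <= 1.
Proof. by rewrite -lee_fin Phi_prob probability_le1. Qed.

Lemma Phi_lt x y : x < y -> Phi x < Phi y.
Proof.
move=> xy.
have c : {within `[x, y], continuous Phi}.
  apply: continuous_subspaceT => z.
  by apply/differentiable_continuous/derivable1_diffP; have [] := is_derive_Phi z.
have [z _ E] := MVT xy (fun z _ => is_derive_Phi z) c.
by rewrite -subr_gt0 E mulr_gt0 ?phi_gt0 ?subr_gt0.
Qed.

Definition normalP : probability (measurableTypeR R) R :=
  [the probability _ _ of normal_prob (0 : R) 1].
Let idTR : measurableTypeR R -> R := idfun.
#[local] HB.instance Definition _ :=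
  @isMeasurableFun.Build _ _ _ _ idTR (@measurable_id _ _ setT).
Definition idN : {RV normalP >-> R} := idTR.

Lemma Phi_cvgy : Phi x @[x --> +oo] --> (1 : R).
Proof.
have := cvg_cdfy1 idN.
have -> : cdf idN = (fun x => (Phi x)%:E).
  by apply/funext => x; rewrite Phi_prob.
by move/fine_cvgP => [_].
Qed.

Lemma Phi_cvgNy : Phi x @[x --> -oo] --> (0 : R).
Proof.
have := cvg_cdfNy0 idN.
have -> : cdf idN = (fun x => (Phi x)%:E).
  by apply/funext => x; rewrite Phi_prob.
by move/fine_cvgP => [_].
Qed.

(** A weak form of convergence to 0 at infinity; against a monotone comparison
function it is as good as convergence. *)
Definition frequently_small (u : R -> R) := forall e, 0 < e -> forall x, exists2 y, x <= y & u y < e.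

Lemma derive_decr (u du : R -> R) (x0 : R) :
  (forall x, is_derive x (1 : R) u (du x)) -> (forall x, x0 <= x -> du x <= 0) ->
  forall x y, x0 <= x -> x <= y -> u y <= u x.
Proof.
move=> Du dn x y x0x xy.
have [c + E] : exists2 c, c \in `[x, y]%R & u y - u x = du c * (y - x).
  apply: MVT_segment => //; apply: continuous_subspaceT => z.
  by apply/differentiable_continuous/derivable1_diffP; have [] := Du z.
rewrite in_itv /= => /andP[xc cy].
by rewrite -subr_le0 E mulr_le0_ge0 ?subr_ge0 // dn // (le_trans x0x).
Qed.

(** The hypotheses cover both tails at once: q is the upper tail 1 - Phi x, or the
lower tail Phi (- x). *)
Section mills.
Variable q : R -> R.
Hypothesis Dq : forall x, is_derive x (1 : R) q (- phi x).
Hypothesis q0 : forall x, 0 <= q x.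
Hypothesis qlim : frequently_small q.

Let den_gt0 x : 0 < 1 + x ^+ 2.
Proof. by rewrite ltr_wpDr ?sqr_ge0. Qed.

(** C = 0 gives the lower bound and C = 1 the upper bound. *)
Lemma is_derive_mills (C x : R) :
  is_derive x (1 : R) (fun x => (x + C) / (1 + x ^+ 2) * phi x)
    ((1 - x ^+ 2 - 2 * C * x - (x ^+ 2 + C * x) * (1 + x ^+ 2)) / (1 + x ^+ 2) ^+ 2 * phi x).
Proof.
have Dp := is_derive_phi x.
have n0 : 1 + x ^+ 2 != 0 by rewrite gt_eqF.
have Dd : is_derive x (1 : R) (fun x => 1 + x ^+ 2) (2 * x).
  by apply: is_derive_eq; rewrite /GRing.scale /=; ring.
have Di := @is_deriveV R (fun x => 1 + x ^+ 2) x _ _ n0 Dd.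
have Dc : is_derive x (1 : R) (fun x => x + C) 1.
  by apply: is_derive_eq; rewrite addr0.
have D1 := is_deriveM Dc Di.
have D2 := is_deriveM D1 Dp.
apply: is_derive_eq D2 _.
have EM (f g : R -> R) : (f * g) x = f x * g x by [].
by rewrite EM /GRing.scale /=; field.
Qed.

(** The difference of the two sides decreases on the half-line; were it negative
at x, it would stay below a negative constant, although q is nonnegative and
the rational bound tends to 0. *)
Lemma mills_lower x : 0 <= x -> x / (1 + x ^+ 2) * phi x <= q x.
Proof.
move=> x0; pose u y := q y - (y + 0) / (1 + y ^+ 2) * phi y.
have Du y : is_derive y (1 : R) u (- 2 / (1 + y ^+ 2) ^+ 2 * phi y).
  have D := is_deriveB (Dq y) (is_derive_mills 0 y).
  apply: is_derive_eq D _.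
  by field; rewrite gt_eqF.
have dec := derive_decr (x0 := 0) Du.
suff : 0 <= u x by rewrite /u addr0 subr_ge0.
rewrite leNgt; apply/negP => ux.
have [y xy] : exists2 y, x <= y & (2 * phi 0) / (1 + y) < - u x.
  have ux' : 0 < - u x by rewrite oppr_gt0.
  have t0 : 0 < (2 * phi 0) / - u x by rewrite divr_gt0 // mulr_gt0 // phi_gt0.
  have tE : (2 * phi 0) / - u x * - u x = (2 * phi 0) by rewrite divfK ?gt_eqF.
  exists (x + (2 * phi 0) / - u x); first by rewrite lerDl ltW.
  rewrite ltr_pdivrMr; last by rewrite ltr_wpDr // addr_ge0 // ltW.
  have key (t v p z : R) : 0 < t -> 0 < v -> t * v = p -> 0 <= z -> p < v * (1 + (z + t)).
    by move=> h1 h2 <- h4; nra.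
  exact: key.
rewrite ltNge => /negP; apply.
have y0 : 0 <= y by exact: le_trans xy.
have uyx : u y <= u x.
  apply: dec => // z z0; rewrite mulNr mulNr oppr_le0 mulr_ge0 ?(ltW (phi_gt0 _)) //.
  by rewrite divr_ge0 // sqr_ge0.
rewrite lerNl; apply: le_trans uyx; rewrite /u addr0 lerNl opprB.
apply: (@le_trans _ _ (y / (1 + y ^+ 2) * phi y)); first by rewrite lerBlDr lerDl.
have y1 : 0 < 1 + y by rewrite ltr_wpDr.
rewrite [leRHS]mulrAC; apply: ler_pM; rewrite ?(ltW (phi_gt0 _)) ?divr_ge0 ?(ltW (den_gt0 _)) //.
  by rewrite ler_pdivlMr // mulrAC ler_pdivrMr //; nra.
by apply: phi_le; rewrite normr0.
Qed.

(** The same monotonicity argument in the other direction: the derivative has the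
sign of 2 - 3 y - y^3, which is nonpositive from 1 on. *)
Lemma mills_upper x : 1 <= x -> q x <= (x + 1) / (1 + x ^+ 2) * phi x.
Proof.
move=> x1; pose u y := (y + 1) / (1 + y ^+ 2) * phi y - q y.
have Du y : is_derive y (1 : R) u ((2 - 3 * y - y ^+ 3) / (1 + y ^+ 2) ^+ 2 * phi y).
  have D := is_deriveB (is_derive_mills 1 y) (Dq y).
  apply: is_derive_eq D _.
  by field; rewrite gt_eqF.
have dec := derive_decr (x0 := 1) Du.
suff : 0 <= u x by rewrite /u subr_ge0.
rewrite leNgt; apply/negP => ux.
have [|y xy] := qlim (e := - u x) _ x; first by rewrite oppr_gt0.
rewrite ltNge => /negP; apply; rewrite lerNl.
have uyx : u y <= u x.
  apply: dec => // z z1; rewrite mulr_le0_ge0 ?(ltW (phi_gt0 _)) //.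
  rewrite mulr_le0_ge0 ?invr_ge0 ?sqr_ge0 //.
  have : 0 <= z ^+ 3 by rewrite exprn_ge0 // (le_trans _ z1).
  by move=> h; lra.
apply: le_trans uyx; rewrite /u lerBrDr addrC subrr mulr_ge0 ?(ltW (phi_gt0 _)) //.
rewrite divr_ge0 ?(ltW (den_gt0 _)) // addr_ge0 // (le_trans _ xy) //.
exact: le_trans x1.
Qed.

(** For a function equal to q / phi near infinity, these are the bounds on the
function, on its derivative and on its second derivative. *)
Lemma mills_bounds x : 1 <= x ->
  [/\ `|q x / phi x| <= 1, `|x * (q x / phi x) - 1| <= 1
    & `|(1 + x ^+ 2) * (q x / phi x) - x| <= 1].
Proof.
move=> x1; have p0 := phi_gt0 x; have d0 := den_gt0 x.
have x0 : 0 <= x by exact: le_trans x1.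
have L : x / (1 + x ^+ 2) <= q x / phi x by rewrite ler_pdivlMr // mills_lower.
have U : q x / phi x <= (x + 1) / (1 + x ^+ 2) by rewrite ler_pdivrMr // mills_upper.
move: L U; rewrite ler_pdivrMr // ler_pdivlMr //.
set m := q x / phi x => L U.
have m0 : 0 <= m by rewrite divr_ge0 // ltW.
by split; rewrite ler_norml; apply/andP; split; nra.
Qed.

End mills.

End normal.

(** * Stein's equation for a smoothed indicator *)
Section stein.
Context {R : realType}.
Variables (a b : R) (ab : a < b).
Implicit Types x y u : R.

Let al := Phi a.
Let be := Phi b.
Let h : R := (be - al) / 2.
Let m : R := (al + be) / 2.

Let h_gt0 : 0 < h.
Proof. by rewrite divr_gt0 // subr_gt0 Phi_lt. Qed.
Let al0 : 0 <= al. Proof. exact: Phi_ge0. Qed.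
Let be1 : be <= 1. Proof. exact: Phi_le1. Qed.
Let alE : al = m - h. Proof. by rewrite /m /h; field. Qed.
Let beE : be = m + h. Proof. by rewrite /m /h; field. Qed.

(** Second difference with knots at Phi a, at Phi b and at their midpoint m. *)
Definition second_diff (p : R -> R) u : R := p (u - al) - 2 * p (u - m) + p (u - be).

Lemma is_derive_second_diff (p dp : R -> R) u : (forall x, is_derive x (1 : R) p (dp x)) ->
  is_derive u (1 : R) (second_diff p) (second_diff dp u).
Proof.
move=> Dp.
have Ds c : is_derive u (1 : R) (fun u => p (u - c)) (dp (u - c)).
  have D1 : is_derive u (1 : R) (fun u => u - c) 1.
    by apply: is_derive_eq; rewrite subr0.
  by apply: is_derive_eq (@is_derive1_comp _ p (fun u => u - c) u _ _ (Dp _) D1) _; rewrite mulr1.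
have D := is_deriveD (is_deriveB (Ds al) (is_deriveZ (2 : R) (Ds m))) (Ds be).
exact: is_derive_eq D _.
Qed.

(** In the variable u = Phi x, the derivative ramp' is a continuously
differentiable step descending from 1 - m to - m between Phi a and Phi b. The
step is symmetric about m, so its mean on [0, 1] is that of a jump at m, namely
0, and its primitive ramp vanishes at both ends 0 and 1. The smoothing takes place in u, where the
Gaussian mean of the step is a Lebesgue mean and can be read off. *)
Definition ramp u := u - m * u - second_diff (fun t => pospart t ^+ 3) u / (6 * h ^+ 2).
Definition ramp' u := 1 - m - second_diff (fun t => pospart t ^+ 2) u / (2 * h ^+ 2).
Definition ramp'' u := - second_diff (fun t => pospart t) u / h ^+ 2.

Let h2 : h != 0. Proof. by rewrite gt_eqF. Qed.

Lemma is_derive_ramp u : is_derive u (1 : R) ramp (ramp' u).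
Proof.
have Dp := is_derive_second_diff u (@is_derive_pospart3 R).
have D := is_deriveB (is_deriveB (is_derive_id u (1:R)) (is_deriveZ m (is_derive_id u (1:R))))
   (is_deriveM Dp (is_derive_cst ((6 * h ^+ 2)^-1) u (1:R))).
apply: is_derive_eq D _.
by rewrite /ramp' /second_diff /GRing.scale /=; field.
Qed.

Lemma is_derive_ramp' u : is_derive u (1 : R) ramp' (ramp'' u).
Proof.
have Dp := is_derive_second_diff u (@is_derive_pospart2 R).
have D := is_deriveB (is_derive_cst (1 - m) u (1:R))
   (is_deriveM Dp (is_derive_cst ((2 * h ^+ 2)^-1) u (1:R))).
apply: is_derive_eq D _.
by rewrite /ramp'' /second_diff /GRing.scale /=; field.
Qed.

Lemma pospart0 u : u <= 0 -> pospart u = 0.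
Proof. by rewrite /pospart => /max_idPr. Qed.
Lemma pospartE u : 0 <= u -> pospart u = u.
Proof. by rewrite /pospart => /max_idPl. Qed.

(** Outside the window ramp is affine; this is what makes the solution explicit
in terms of a Gaussian tail for large x. *)
Lemma ramp_left u : u <= al -> [/\ ramp u = (1 - m) * u, ramp' u = 1 - m & ramp'' u = 0].
Proof.
have e1 := alE; have e2 := beE.
move=> ua; have := h_gt0; rewrite /ramp /ramp' /ramp'' /second_diff => hp.
rewrite !pospart0; [|lra..].
by rewrite !expr0n /=; split; ring.
Qed.

Lemma ramp_right u : be <= u -> [/\ ramp u = m * (1 - u), ramp' u = - m & ramp'' u = 0].
Proof.
have e1 := alE; have e2 := beE.
move=> ua; have := h_gt0; rewrite /ramp /ramp' /ramp'' /second_diff => hp.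
rewrite !pospartE; [|lra..].
by rewrite alE beE; split; field.
Qed.

Lemma ramp'_range u : - m <= ramp' u <= 1 - m.
Proof.
have hp := h_gt0; have e1 := alE; have e2 := beE.
case: (leP u al) => ua; first by have [_ -> _] := ramp_left ua; apply/andP; split; lra.
case: (leP be u) => ub; first by have [_ -> _] := ramp_right ub; apply/andP; split; lra.
rewrite /ramp' /second_diff alE beE.
have h2p : 0 < 2 * h ^+ 2 by rewrite mulr_gt0 // exprn_gt0.
suff : 0 <= (pospart (u - (m - h)) ^+ 2 - 2 * pospart (u - m) ^+ 2 + pospart (u - (m + h)) ^+ 2) <= 2 * h ^+ 2.
  move=> /andP[s0 s1].
  have t0 := divr_ge0 s0 (ltW h2p).
  have t1 : (pospart (u - (m - h)) ^+ 2 - 2 * pospart (u - m) ^+ 2 + pospart (u - (m + h)) ^+ 2) / (2 * h ^+ 2) <= 1.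
    by rewrite ler_pdivrMr // mul1r.
  by apply/andP; split; lra.
rewrite (pospart0 (u := u - (m + h))); last lra.
rewrite (pospartE (u := u - (m - h))); last lra.
case: (leP u m) => um.
  by rewrite pospart0; [|lra]; apply/andP; split; nra.
by rewrite pospartE; [|lra]; apply/andP; split; nra.
Qed.

Lemma second_diff_bd (p : R -> R) u : 0 <= u <= 1 -> (forall t, t <= 1 -> `|p t| <= 1) ->
  `|second_diff p u| <= 4.
Proof.
move=> /andP[u0 u1] pb; rewrite /second_diff; have hp := h_gt0; have a0 := al0; have b1' := be1; have e1 := alE; have e2 := beE.
have b1 := pb (u - al); have b2 := pb (u - m); have b3 := pb (u - be).
have {b1} b1 := b1 ltac:(lra). have {b2} b2 := b2 ltac:(lra). have {b3} b3 := b3 ltac:(lra).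
move: b1 b2 b3; rewrite !ler_norml => /andP[? ?] /andP[? ?] /andP[? ?].
by apply/andP; split; lra.
Qed.

Lemma pospart_bd (t : R) : t <= 1 -> `|pospart t| <= 1.
Proof. by rewrite /pospart; case: (leP t 0) => ht t1; rewrite ?normr0 // ger0_norm // ltW. Qed.

Lemma pospart_bdX n (t : R) : t <= 1 -> `|pospart t ^+ n| <= 1.
Proof. by move=> /pospart_bd ht; rewrite normrX exprn_ile1. Qed.

Lemma ramp_bd : exists2 B : R, 0 <= B & forall u, 0 <= u <= 1 -> [/\ `|ramp u| <= B, `|ramp' u| <= B & `|ramp'' u| <= B].
Proof.
have m01 : 0 <= m <= 1 by have := h_gt0; have := al0; have := be1; rewrite alE beE; lra.
exists (2 + 4 / (2 * h ^+ 2) + 4 / (6 * h ^+ 2) + 4 / h ^+ 2).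
  have d (c : R) : 0 <= c -> 0 <= 4 / c by move=> c0; exact: divr_ge0.
  have d1 := d _ (sqr_ge0 h).
  have d2 := d _ (mulr_ge0 (ler0n _ 2) (sqr_ge0 h)).
  have d3 := d _ (mulr_ge0 (ler0n _ 6) (sqr_ge0 h)).
  by lra.
move=> u u01.
have bd n (c : R) : 0 <= c -> `|second_diff (fun t => pospart t ^+ n) u / c| <= 4 / c.
  move=> c0; rewrite normrM normfV (ger0_norm c0) ler_wpM2r ?invr_ge0 //.
  by apply: second_diff_bd => // t; exact: pospart_bdX.
have b3 := bd 3 _ (mulr_ge0 (ler0n _ 6) (sqr_ge0 h)).
have b2 := bd 2 _ (mulr_ge0 (ler0n _ 2) (sqr_ge0 h)).
have b1 := bd 1 _ (sqr_ge0 h).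
have p3 : 0 <= 4 / (6 * h ^+ 2) by exact: le_trans b3.
have p2 : 0 <= 4 / (2 * h ^+ 2) by exact: le_trans b2.
have p1 : 0 <= 4 / (h ^+ 2) by exact: le_trans b1.
have mu : 0 <= m * u <= 1 by case/andP: m01 => *; case/andP: u01 => *; nra.
rewrite /ramp /ramp' /ramp''.
have E1 : `|- second_diff (fun t => pospart t) u / h ^+ 2| = `|second_diff (fun t => pospart t ^+ 1) u / h ^+ 2|.
  by rewrite mulNr normrN.
split.
- by move: b3; rewrite !ler_norml => /andP[? ?]; apply/andP; split; lra.
- by move: b2; rewrite !ler_norml => /andP[? ?]; apply/andP; split; lra.
- by rewrite E1 (le_trans b1) //; lra.
Qed.

(** The solution of f' - x f = ramp' (Phi x), since phi' = - x phi. *)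
Definition sol x : R := ramp (Phi x) / phi x.
Definition sol' x : R := ramp' (Phi x) + x * sol x.
Definition sol'' x : R := ramp'' (Phi x) * phi x + sol x + x * sol' x.

Lemma is_derive_sol x : is_derive x (1 : R) sol (sol' x).
Proof.
have n0 : phi x != 0 by rewrite gt_eqF // phi_gt0.
have Dv := @is_deriveV R phi x _ _ n0 (is_derive_phi x).
have Dc := @is_derive1_comp R ramp Phi x _ _ (is_derive_ramp _) (is_derive_Phi x).
have D := is_deriveM Dc Dv.
apply: is_derive_eq D _.
by rewrite /sol' /sol /GRing.scale /=; field.
Qed.

Lemma is_derive_sol' x : is_derive x (1 : R) sol' (sol'' x).
Proof.
have Dc := @is_derive1_comp R ramp' Phi x _ _ (is_derive_ramp' _) (is_derive_Phi x).
have D := is_deriveD Dc (is_deriveM (is_derive_id x (1 : R)) (is_derive_sol x)).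
apply: is_derive_eq D _.
by rewrite /sol'' /GRing.scale /=; ring.
Qed.

Lemma Phi_tail_small : frequently_small (fun x => 1 - Phi x : R).
Proof.
move=> e e0 x.
have /cvgrPdist_lt /(_ _ e0) := @Phi_cvgy R.
move=> H; near (+oo : set_system R) => y.
exists y; first by near: y; apply: nbhs_pinfty_ge; exact: num_real.
apply: le_lt_trans (ler_norm _) _.
by near: y.
Unshelve. all: by end_near. Qed.

Lemma PhiN_tail_small : frequently_small (fun x => Phi (- x) : R).
Proof.
move=> e e0 x.
have /cvgrPdist_lt /(_ _ e0) := @Phi_cvgNy R.
move=> H; near (-oo : set_system R) => y.
exists (- y).
  by rewrite lerNr; near: y; apply: nbhs_ninfty_le; exact: num_real.
rewrite opprK; apply: le_lt_trans (ler_norm _) _.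
rewrite -normrN -sub0r.
by near: y.
Unshelve. all: by end_near. Qed.

Lemma is_derive_PhiC x : is_derive x (1 : R) (fun x => 1 - Phi x : R) (- phi x).
Proof.
have D := is_deriveB (is_derive_cst (1 : R) x (1 : R)) (is_derive_Phi x).
by apply: is_derive_eq D _; rewrite sub0r.
Qed.

Lemma is_derive_PhiN x : is_derive x (1 : R) (fun x => Phi (- x) : R) (- phi x).
Proof.
have Dn : is_derive x (1 : R) (fun x => - x) (-1) by apply: is_derive_eq.
have D := @is_derive1_comp R Phi (fun x => - x) x _ _ (is_derive_Phi _) Dn.
by apply: is_derive_eq D _; rewrite mulrN1 phi_sym.
Qed.

(** On a compact interval containing a and b the density is bounded below. Beyond
it, ramp is affine and the solution is a multiple in [0, 1] of a tail divided
by the density, for which the bounds on the Mills ratio apply. *)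
Lemma sol_bd : exists2 C : R, 0 <= C & forall x, [/\ `|sol x| <= C, `|sol' x| <= C & `|sol'' x| <= C].
Proof.
have [B B0 hB] := ramp_bd.
have m01 : 0 <= m <= 1 by have := h_gt0; have := al0; have := be1; rewrite alE beE; lra.
pose L : R := 1 + `|a| + `|b|.
pose C0 : R := B / phi L.
have C00 : 0 <= C0 by rewrite divr_ge0 // ltW // phi_gt0.
have L0 : 1 <= L by rewrite /L -addrA lerDl addr_ge0.
pose C1 : R := B + L * C0.
have C10 : 0 <= C1 by rewrite addr_ge0 // mulr_ge0 // (le_trans _ L0).
have key x : 1 <= x -> [/\ `|(1 - Phi x) / phi x| <= 1, `|x * ((1 - Phi x) / phi x) - 1| <= 1
    & `|(1 + x ^+ 2) * ((1 - Phi x) / phi x) - x| <= 1].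
  apply: (mills_bounds is_derive_PhiC) => [y|]; last exact: Phi_tail_small.
  by rewrite subr_ge0 Phi_le1.
have keyN x : 1 <= x -> [/\ `|Phi (- x) / phi x| <= 1, `|x * (Phi (- x) / phi x) - 1| <= 1
    & `|(1 + x ^+ 2) * (Phi (- x) / phi x) - x| <= 1].
  apply: (mills_bounds is_derive_PhiN) => [y|]; last exact: PhiN_tail_small.
  exact: Phi_ge0.
have cut (c z : R) : 0 <= c <= 1 -> `|z| <= 1 -> `|c * z| <= 1.
  move=> /andP[c0 c1] hz; rewrite normrM ger0_norm //.
  by rewrite -[leRHS]mulr1 ler_pM.
exists (1 + C0 + C1 + B * phi 0 + L * C1).
  by rewrite !addr_ge0 // mulr_ge0 // ?ltW ?phi_gt0 // (lt_le_trans _ L0).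
move=> x.
have pp : 0 <= B * phi 0 by rewrite mulr_ge0 // ltW // phi_gt0.
have LC : 0 <= L * C1 by rewrite mulr_ge0 // (le_trans _ L0).
have n0 : phi x != 0 by rewrite gt_eqF // phi_gt0.
have T1 : 1 <= 1 + C0 + C1 + B * phi 0 + L * C1.
  have aux (t1 t2 t3 t4 : R) : 0 <= t1 -> 0 <= t2 -> 0 <= t3 -> 0 <= t4 -> 1 <= 1 + t1 + t2 + t3 + t4.
    by lra.
  exact: aux.
case: (leP `|x| L) => [xL|].
  have [k0 k1 k2] := hB (Phi x) ltac:(by rewrite Phi_ge0 Phi_le1).
  have f0 : `|sol x| <= C0.
    rewrite /sol normrM /C0 ler_pM // normfV lef_pV2 ?posrE ?normr_gt0 ?phi_gt0 //.
    by rewrite ger0_norm ?(ltW (phi_gt0 _)) //; apply: phi_le; rewrite [leRHS]ger0_norm // (le_trans _ L0).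
  have f1 : `|sol' x| <= C1.
    by rewrite /sol' (le_trans (ler_normD _ _)) // lerD // normrM ler_pM.
  split; [lra|lra|].
  rewrite /sol'' (le_trans (ler_normD _ _)) //.
  have : `|ramp'' (Phi x) * phi x + sol x| <= B * phi 0 + C0.
    rewrite (le_trans (ler_normD _ _)) // lerD // normrM ler_pM //.
    by rewrite ger0_norm ?(ltW (phi_gt0 _)) //; apply: phi_le; rewrite normr0.
  have : `|x * sol' x| <= L * C1 by rewrite normrM ler_pM.
  by lra.
have [x0 Lx|x0 Lx] := ger0P x.
  have xb : b < x.
    by rewrite (le_lt_trans (ler_norm b)) // (le_lt_trans _ Lx) // /L; have := normr_ge0 a; lra.
  have [e0 e1 e2] := ramp_right (ltW (Phi_lt xb)).
  have [b0 b1 b2] := key x ltac:(by rewrite (le_trans L0) // ltW).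
  have F : sol x = m * ((1 - Phi x) / phi x) by rewrite /sol e0 mulrA.
  have G : sol' x = m * (x * ((1 - Phi x) / phi x) - 1) by rewrite /sol' e1 F; ring.
  have H : sol'' x = m * ((1 + x ^+ 2) * ((1 - Phi x) / phi x) - x).
    by rewrite /sol'' e2 F G; ring.
  by rewrite F G H; split; apply: le_trans (cut _ _ m01 _) T1.
have xa : x < a.
  rewrite -ltrN2 (le_lt_trans (ler_norm _)) // normrN (le_lt_trans _ Lx) // /L; have := normr_ge0 b; lra.
have m01' : 0 <= 1 - m <= 1 by lra.
have [e0 e1 e2] := ramp_left (ltW (Phi_lt xa)).
have [] := keyN (- x) ltac:(by rewrite (le_trans L0) // ltW).
rewrite opprK phi_sym sqrrN => b0 b1 b2.
have F : sol x = (1 - m) * (Phi x / phi x) by rewrite /sol e0 mulrA.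
have G : sol' x = - ((1 - m) * (- x * (Phi x / phi x) - 1)) by rewrite /sol' e1 F; ring.
have H : sol'' x = (1 - m) * ((1 + x ^+ 2) * (Phi x / phi x) + x).
  by rewrite /sol'' e2 F G; ring.
split.
- by rewrite F; exact: le_trans (cut _ _ m01' b0) T1.
- by rewrite G normrN; exact: le_trans (cut _ _ m01' b1) T1.
- by rewrite H; exact: le_trans (cut _ _ m01' b2) T1.
Qed.

(** A test pair (f, k), with k the derivative of f, for which k x - x f x lies
between the centred indicators of x <= a and of x <= b. The constant c is
only located between Phi a and Phi b, which is enough as b - a will be small.
The quadratic remainder is the form in which the normal approximation uses the
second derivative. *)
Lemma stein_solution : exists (f k : R -> R) (C c : R),
  [/\ 0 <= C, measurable_fun setT f, measurable_fun setT k,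
    Phi a <= c <= Phi b &
    (forall x, `|f x| <= C /\ `|k x| <= C) /\
    (forall x y, `|f y - f x - k x * (y - x)| <= C * (y - x) ^+ 2) /\
    (forall x, (if x <= a then 1 else 0) - c <= k x - x * f x <= (if x <= b then 1 else 0) - c)].
Proof.
have [C C0 hC] := sol_bd.
have mes (g dg : R -> R) : (forall x, is_derive x (1 : R) g (dg x)) -> measurable_fun setT g.
  move=> Dg; apply: continuous_measurable_fun => x.
  by apply/differentiable_continuous/derivable1_diffP; have [] := Dg x.
exists sol, sol', C, m; split => //.
- exact: (mes _ _ is_derive_sol).
- exact: (mes _ _ is_derive_sol').
- by rewrite -/al -/be alE beE; have := h_gt0; lra.
split; first by move=> x; have [] := hC x.
split.
  by apply: (taylor2 is_derive_sol is_derive_sol') => x; have [] := hC x.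
move=> x; rewrite /sol' addrK.
have /andP[l u] := ramp'_range (Phi x).
case: (leP x a) => xa.
  have xb : x <= b by rewrite (le_trans xa) // ltW.
  rewrite xb; suff -> : ramp' (Phi x) = 1 - m by rewrite lexx.
  apply: (fun H => let: And3 _ h _ := ramp_left H in h).
  by move: xa; rewrite le_eqVlt => /predU1P[->//|/Phi_lt/ltW].
rewrite sub0r l /=; case: (leP x b) => xb //.
by have [_ -> _] := ramp_right (ltW (Phi_lt xb)); rewrite sub0r.
Qed.

End stein.

(** * Partition functions of induced subgraphs *)
Section graph.
Context {R : realType} (G : sgraph).
Implicit Types (A : {set G}) (M : {set edge G}) (e : edge G) (x z : G).
Notation I := (edge G + G)%type.
Implicit Types (y : I -> R).

Definition within M A := [forall e in M, (val e : {set G}) \subset A].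

Definition weight A y M : R :=
  expR (\sum_(e in M) y (inl e) + \sum_(x in A | ~~ matched M x) y (inr x)).

Definition Zsub A y : R := \sum_(M : {set edge G} | is_matching M && within M A) weight A y M.

Lemma Zsub_setT y : Zsub [set: G]%SET y = partition_function (fun e => y (inl e)) (fun x => y (inr x)).
Proof.
rewrite /Zsub /partition_function; apply: eq_big => M; last first.
  move=> _; rewrite /weight /boltzmann; congr (expR (_ + _)).
  by apply: eq_bigl => x; rewrite finset.in_setT.
by rewrite [within _ _](_ : _ = true) ?andbT //; apply/forall_inP => e _; exact: finset.subsetT.
Qed.

Lemma matching0 : is_matching (finset.set0 : {set edge G}).
Proof. by apply/forall_inP => e; rewrite finset.in_set0. Qed.

Lemma within0 A : within finset.set0 A.
Proof. by apply/forall_inP => e; rewrite finset.in_set0. Qed.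

Lemma Zsub_gt0 A y : 0 < Zsub A y.
Proof.
rewrite /Zsub (bigD1 finset.set0) /=; last by rewrite matching0 within0.
by rewrite ltr_wpDr ?expR_gt0 // sumr_ge0 // => M _; exact: expR_ge0.
Qed.

Lemma matchedP M x : reflect (exists2 e, e \in M & x \in (val e : {set G})) (matched M x).
Proof. exact: exists_inP. Qed.

Lemma matching_uniq M e f x : is_matching M -> e \in M -> f \in M ->
  x \in (val e : {set G}) -> x \in (val f : {set G}) -> e = f.
Proof.
move=> /forall_inP mM eM fM xe xf; apply/eqP; apply: contraT => ef.
have /forall_inP/(_ f fM)/implyP/(_ ef) := mM e eM.
by rewrite finset.disjoints_subset => /fintype.subsetP/(_ x xe); rewrite inE xf.
Qed.

Lemma edge_nonempty e : exists x, x \in (val e : {set G}).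
Proof.
case: e => E /= /existsP[x /existsP[z /andP[_ /eqP ->]]]; exists x.
by rewrite !inE eqxx.
Qed.

Lemma matching_add M e A : (val e : {set G}) \subset A ->
  (is_matching (e |: M)%SET && within (e |: M)%SET A && (e \notin M)) =
  (is_matching M && within M (A :\: val e)%SET).
Proof.
move=> eA; have eE : e \in (e |: M)%SET by rewrite !inE eqxx.
have fE f : f \in M -> f \in (e |: M)%SET by move=> fM; rewrite !inE fM orbT.
apply/idP/idP.
  move=> /andP[/andP[/forall_inP mM /forall_inP wM] eM]; apply/andP; split.
    apply/forall_inP => f fM; have /forall_inP h := mM f (fE f fM).
    by apply/forall_inP => g gM; apply: h; exact: fE.
  apply/forall_inP => f fM; have fe : e != f by apply: contraNneq eM => ->.
  have := wM f (fE f fM) => fA.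
  have /forall_inP/(_ f (fE f fM))/implyP/(_ fe) := mM e eE.
  rewrite disjoint_sym finset.disjoints_subset => dis.
  by rewrite finset.setDE finset.subsetI fA.
move=> /andP[/forall_inP mM /forall_inP wM].
have dis f : f \in M -> [disjoint (val e : {set G}) & (val f : {set G})]%B.
  by move=> /wM; rewrite finset.setDE finset.subsetI => /andP[_]; rewrite disjoint_sym finset.disjoints_subset.
have eM : e \notin M.
  apply/negP => /dis; have [x xe] := edge_nonempty e.
  by rewrite finset.disjoints_subset => /fintype.subsetP/(_ x xe); rewrite inE xe.
rewrite eM andbT; apply/andP; split; last first.
  apply/forall_inP => f; rewrite !inE => /orP[/eqP->//|/wM].
  by rewrite finset.setDE finset.subsetI => /andP[].
apply/forall_inP => f; rewrite !inE => /orP[/eqP->|fM]; apply/forall_inP => g; rewrite !inE => /orP[/eqP->|gM].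
- by rewrite eqxx.
- by apply/implyP => _; exact: dis.
- by apply/implyP => _; rewrite disjoint_sym; exact: dis.
- by have /forall_inP/(_ g gM) := mM f fM.
Qed.

Lemma weight_add M e A y : (val e : {set G}) \subset A -> e \notin M ->
  weight A y (e |: M)%SET = expR (y (inl e)) * weight (A :\: val e)%SET y M.
Proof.
move=> eA eM; rewrite /weight -expRD finset.big_setU1 //= -addrA; congr (expR (_ + (_ + _))).
apply: eq_bigl => x; rewrite !inE.
have -> : matched (e |: M)%SET x = (x \in (val e : {set G})) || matched M x.
  apply/matchedP/orP.
    move=> [f]; rewrite !inE => /orP[/eqP->|fM] xf; first by left.
    by right; apply/matchedP; exists f.
  move=> [xe|/matchedP[f fM xf]]; first by exists e; rewrite // !inE eqxx.
  by exists f; rewrite // !inE fM orbT.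
by rewrite negb_or andbA; congr (_ && _); exact: andbC.
Qed.

Lemma weight_del M x A y : x \in A -> ~~ matched M x ->
  weight A y M = expR (y (inr x)) * weight (A :\ x)%SET y M.
Proof.
move=> xA xM; rewrite /weight -expRD (bigD1 x) /=; last by rewrite xA.
rewrite addrCA; congr (expR (_ + (_ + _))); apply: eq_bigl => z; rewrite !inE.
by case: (z == x); case: (z \in A); case: (matched M z).
Qed.

(** The classical deletion recursion: x is either unmatched, or matched along
exactly one of its edges. *)
Lemma Zsub_rec A x y : x \in A ->
  Zsub A y = expR (y (inr x)) * Zsub (A :\ x)%SET y +
    \sum_(e | (x \in (val e : {set G})) && ((val e : {set G}) \subset A))
       expR (y (inl e)) * Zsub (A :\: val e)%SET y.
Proof.
move=> xA; rewrite {1}/Zsub (bigID (fun M => matched M x)) /= addrC; congr (_ + _).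
  rewrite /Zsub big_distrr /=; apply: eq_big => M.
    rewrite -andbA; congr (_ && _); apply/andP/forall_inP.
      move=> [/forall_inP wM xM] e eM; rewrite finset.subsetD1 wM //=.
      by apply: contra xM => xe; apply/matchedP; exists e.
    move=> h; split.
      by apply/forall_inP => e /h; rewrite finset.subsetD1 => /andP[].
    by apply/matchedP => -[e /h]; rewrite finset.subsetD1 => /andP[_ /negbTE ->].
  by move=> /andP[_ xM]; exact: weight_del.
transitivity (\sum_(M | is_matching M && within M A && matched M x)
   \sum_(e | (x \in (val e : {set G})) && (e \in M)) weight A y M).
  apply: eq_bigr => M /andP[/andP[mM wM] /matchedP[e eM xe]].
  rewrite (bigD1 e) ?xe ?eM //= big1 ?addr0 // => f /andP[/andP[xf fM] /eqP fe].
  by case: fe; apply: (matching_uniq mM fM eM xf xe).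
rewrite (exchange_big_dep (fun e => (x \in (val e : {set G})) && ((val e : {set G}) \subset A))) /=; last first.
  by move=> M e /andP[/andP[_ /forall_inP wM] _] /andP[-> /wM].
apply: eq_bigr => e /andP[xe eA].
rewrite /Zsub big_distrr /=.
rewrite (reindex_onto (fun M => (e |: M)%SET) (fun M => (M :\ e)%SET)) /=; last first.
  by move=> M /andP[_ /andP[_ eM]]; rewrite finset.setD1K.
apply: eq_big => M.
  rewrite -(matching_add M eA) xe !inE eqxx /=.
  have -> : ((e |: M) :\ e == M)%SET = (e \notin M).
    apply/eqP/idP => [<-|eM]; first by rewrite !inE eqxx.
    by rewrite finset.setU1K.
  have -> : matched (e |: M)%SET x by apply/matchedP; exists e; rewrite // !inE eqxx.
  by rewrite !andbT.
move=> /andP[_ /eqP h]; apply: weight_add => //.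
by rewrite -h !inE eqxx.
Qed.

Definition other e x : G := odflt x [pick z in (val e :\ x)%SET].

Lemma otherP e x : x \in (val e : {set G}) ->
  [/\ adj x (other e x), x != other e x & val e = [set x; other e x]%SET].
Proof.
move=> xe; have : exists2 z, adj x z & val e = [set x; z]%SET.
  case: e xe => E /= /existsP[u /existsP[v /andP[uv /eqP ->]]]; rewrite !inE => /orP[/eqP->|/eqP->].
    by exists v.
  by exists u; [rewrite adj_sym|rewrite finset.setUC].
case=> z xz E.
have xnz : x != z by apply: contraTneq xz => ->; rewrite adj_irrefl.
suff -> : other e x = z by split.
rewrite /other; case: pickP => [t|]; rewrite E.
  by rewrite !inE => /andP[/negbTE-> /eqP].
by move=> /(_ z); rewrite !inE eqxx orbT eq_sym xnz.
Qed.

Lemma Zsub_other A e x y : x \in (val e : {set G}) ->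
  Zsub (A :\: val e)%SET y = Zsub (A :\ x :\ other e x)%SET y.
Proof. by move=> /otherP[_ _ ->]; congr (Zsub _ _); rewrite finset.setDDl. Qed.

Definition incident x A := [pred e : edge G | (x \in (val e : {set G})) && ((val e : {set G}) \subset A)].

Lemma incident_other A e x : incident x A e -> other e x \in (A :\ x)%SET.
Proof.
move=> /andP[xe eA]; have [_ n E] := otherP xe; rewrite !inE eq_sym n /=.
by apply: (fintype.subsetP eA); rewrite E !inE eqxx orbT.
Qed.

(** In the model on A, the vertex x is unmatched with probability
exp (y (inr x) - logratio A x y). *)
Definition logratio A x y : R := ln (Zsub A y) - ln (Zsub (A :\ x)%SET y).

Lemma expR_logratio A x y : expR (logratio A x y) = Zsub A y / Zsub (A :\ x)%SET y.
Proof. by rewrite expRB !lnK ?posrE ?Zsub_gt0. Qed.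

(** Dividing the deletion recursion at x by the partition function of A minus x
expresses the ratio at x through the ratios at its neighbours, in the graph
from which x has been removed. *)
Lemma logratio_rec A x y : x \in A ->
  logratio A x y = ln (expR (y (inr x)) +
    \sum_(e | incident x A e) expR (y (inl e) - logratio (A :\ x)%SET (other e x) y)).
Proof.
move=> xA; rewrite /logratio -ln_div ?posrE ?Zsub_gt0 //; congr ln.
rewrite (Zsub_rec y xA) mulrDl mulfK ?gt_eqF ?Zsub_gt0 //; congr (_ + _).
rewrite mulr_suml; apply: eq_bigr => e /andP[xe eA].
by rewrite expRB expR_logratio (Zsub_other _ _ xe) invf_div mulrA.
Qed.

(** The recursion of the ratios stopped after k steps; it depends on the weights
within distance k of x only. *)
Fixpoint truncated (k : nat) A x y : R :=
  if k is k'.+1 then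
    ln (expR (y (inr x)) + \sum_(e | incident x A e) expR (y (inl e) - truncated k' (A :\ x)%SET (other e x) y))
  else y (inr x).

Lemma ln_geD (c s : R) : 0 <= s -> c <= ln (expR c + s).
Proof.
move=> s0; rewrite -{1}(expRK c) ler_ln ?posrE ?expR_gt0 ?ltr_wpDr ?expR_gt0 //.
by rewrite lerDl.
Qed.

Lemma logratio_ge A x y : x \in A -> y (inr x) <= logratio A x y.
Proof. by move=> xA; rewrite logratio_rec // ln_geD // sumr_ge0 // => e _; exact: expR_ge0. Qed.

Lemma truncated_ge k A x y : y (inr x) <= truncated k A x y.
Proof. by case: k => //= k; rewrite ln_geD // sumr_ge0 // => e _; exact: expR_ge0. Qed.

(** Since a ratio is at least the exponential of its vertex weight, the dimer
terms of the recursion are at most this multiple of the monomer term. *)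
Definition activity x y : R :=
  \sum_(e : edge G | x \in (val e : {set G})) expR (y (inl e) - y (inr x) - y (inr (other e x))).

Lemma activity_ge0 x y : 0 <= activity x y.
Proof. by apply: sumr_ge0 => e _; exact: expR_ge0. Qed.

Lemma sum_incident_le A x y (u : edge G -> R) : (forall e, incident x A e -> y (inr (other e x)) <= u e) ->
  \sum_(e | incident x A e) expR (y (inl e) - u e) <= activity x y * expR (y (inr x)).
Proof.
move=> h; rewrite /activity mulr_suml.
apply: (@le_trans _ _ (\sum_(e | incident x A e) expR (y (inl e) - y (inr x) - y (inr (other e x))) * expR (y (inr x)))).
  apply: ler_sum => e ie; rewrite -expRD ler_expR; have := h e ie; lra.
rewrite [leRHS](bigID (fun e : edge G => (val e : {set G}) \subset A)) /= lerDl.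
by apply: sumr_ge0 => e _; rewrite mulr_ge0 ?expR_ge0.
Qed.

Lemma ln_upper (c s l : R) : 0 <= s -> s <= l * expR c -> ln (expR c + s) <= c + ln (1 + l).
Proof.
move=> s0 sl.
have l0 : 0 <= l by rewrite -(pmulr_lge0 _ (expR_gt0 c)) (le_trans s0).
have p : 0 < 1 + l by rewrite ltr_wpDr.
rewrite -{2}(expRK c) -lnM ?posrE ?expR_gt0 //.
rewrite ler_ln ?posrE ?mulr_gt0 ?expR_gt0 ?ltr_wpDr ?expR_gt0 //.
by rewrite mulrDr mulr1 lerD2l mulrC.
Qed.

Lemma logratio_le A x y : x \in A -> logratio A x y <= y (inr x) + ln (1 + activity x y).
Proof.
move=> xA; rewrite logratio_rec //; apply: ln_upper.
  by apply: sumr_ge0 => e _; exact: expR_ge0.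
by apply: sum_incident_le => e /incident_other; exact: logratio_ge.
Qed.

Lemma truncated_le k A x y : truncated k A x y <= y (inr x) + ln (1 + activity x y).
Proof.
case: k => [|k] /=; first by rewrite lerDl ln_ge0 // lerDl activity_ge0.
apply: ln_upper.
  by apply: sumr_ge0 => e _; exact: expR_ge0.
by apply: sum_incident_le => e _; exact: truncated_ge.
Qed.

(** Convexity of the exponential, obtained from its tangent at - t d. *)
Lemma expR_conv (t d : R) : 0 <= t <= 1 -> expR (- (t * d)) <= 1 - t + t * expR (- d).
Proof.
move=> /andP[t0 t1].
have p0 := expR_gt0 (- (t * d)).
have h1 : expR (- (t * d)) * (1 + t * d) <= 1.
  rewrite -[leRHS](expR0 R) -(subrr (- (t * d))) expRD ler_pM2l //.
  by rewrite opprK expR_ge1Dx.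
have h2 : expR (- (t * d)) * (1 + (t * d - d)) <= expR (- d).
  have -> : expR (- d) = expR (- (t * d)) * expR (t * d - d) by rewrite -expRD; congr expR; ring.
  by rewrite ler_pM2l // expR_ge1Dx.
move: p0 h1 h2; move: (expR (- (t * d))) (expR (- d)) => p q p0 h1 h2.
have := ler_wpM2l t0 h2; have : 0 <= 1 - t by rewrite subr_ge0.
by move=> t2; have := ler_wpM2l t2 h1; nra.
Qed.

(** If the dimer part s carries a share t = s / (c + s) of the total, changing it
by a factor exp d changes the logarithm by at most t d; the share is at most
l / (1 + l) because s <= l c. *)
Lemma ln_contraction (c s s' l d : R) : 0 < c -> 0 <= s -> 0 <= s' -> 0 <= d ->
  s <= l * c -> s <= expR d * s' ->
  ln (c + s) - ln (c + s') <= l / (1 + l) * d.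
Proof.
move=> c0 s0 s0' d0 sl ss.
have l0 : 0 <= l by rewrite -(pmulr_lge0 _ c0) (le_trans s0).
have l1 : 0 < 1 + l by rewrite ltr_wpDr.
have cs : 0 < c + s by rewrite ltr_wpDr.
have cs' : 0 < c + s' by rewrite ltr_wpDr.
pose t := s / (c + s).
have t0 : 0 <= t by rewrite divr_ge0 // ltW.
have t1 : t <= l / (1 + l).
  rewrite /t ler_pdivrMr // mulrAC ler_pdivlMr //; nra.
have t2 : t <= 1 by rewrite ler_pdivrMr // mul1r lerDr ltW.
apply: (@le_trans _ _ (t * d)); last by rewrite ler_wpM2r.
rewrite lerBlDr -(expRK (t * d)) -lnM ?posrE ?expR_gt0 //.
rewrite ler_ln ?posrE ?mulr_gt0 ?expR_gt0 //.
have e0 := expR_gt0 (t * d).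
rewrite -ler_pdivrMl // -expRN.
have ct : 0 <= t <= 1 by rewrite t0.
apply: le_trans (ler_wpM2r (ltW cs) (expR_conv d ct)) _.
have -> : (1 - t + t * expR (- d)) * (c + s) = c + s * expR (- d).
  by rewrite /t; field; rewrite gt_eqF.
by rewrite lerD2l expRN ler_pdivrMr ?expR_gt0 // mulrC.
Qed.

Definition err k A x y := `|logratio A x y - truncated k A x y|.

Lemma err_le k A x y : x \in A -> err k A x y <= ln (1 + activity x y).
Proof.
move=> xA; rewrite /err ler_norml.
have := logratio_le y xA; have := logratio_ge y xA; have := truncated_le k A x y; have := truncated_ge k A x y.
by move=> *; apply/andP; split; lra.
Qed.

(** Correlation decay, one step: the truncation errors at the neighbours are
contracted by a factor which is strictly below 1 as long as the activity at x
is bounded. *)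
Lemma err_step k A x y (d : R) : x \in A -> 0 <= d ->
  (forall e, incident x A e -> err k (A :\ x)%SET (other e x) y <= d) ->
  err k.+1 A x y <= activity x y / (1 + activity x y) * d.
Proof.
move=> xA d0 h; rewrite /err logratio_rec //= .
set s := \sum_(e | _) _; set s' := \sum_(e | _) _.
have s0 : 0 <= s by apply: sumr_ge0 => e _; exact: expR_ge0.
have s0' : 0 <= s' by apply: sumr_ge0 => e _; exact: expR_ge0.
have sl : s <= activity x y * expR (y (inr x)) by apply: sum_incident_le => e /incident_other; exact: logratio_ge.
have sl' : s' <= activity x y * expR (y (inr x)) by apply: sum_incident_le => e _; exact: truncated_ge.
have ss : s <= expR d * s'.
  rewrite /s' big_distrr /=; apply: ler_sum => e /h; rewrite ler_norml => /andP[h1 h2].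
  by rewrite -expRD ler_expR; lra.
have ss' : s' <= expR d * s.
  rewrite /s big_distrr /=; apply: ler_sum => e /h; rewrite ler_norml => /andP[h1 h2].
  by rewrite -expRD ler_expR; lra.
have c0 := expR_gt0 (y (inr x)).
rewrite ler_norml -opprB lerN2 opprB; apply/andP; split.
  exact: ln_contraction.
exact: ln_contraction.
Qed.

End graph.

(** * Locality and capped truncation errors *)
Lemma card_bigcup_le (T T' : finType) (A : {set T}) (F : T -> {set T'}) :
  (#|(\bigcup_(i in A) F i)%SET| <= \sum_(i in A) #|F i|)%N.
Proof.
elim/big_rec2: _ => [|i n B _ h]; first by rewrite cards0.
by rewrite (leq_trans (leq_card_setU _ _)) // leq_add2l.
Qed.

Section local.
Context {R : realType} (G : sgraph).
Implicit Types (A : {set G}) (M : {set edge G}) (e : edge G) (x z v : G).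
Notation I := (edge G + G)%type.
Implicit Types (y : I -> R) (i j : I).

Lemma lnZ_lip A y y' : `|ln (Zsub A y) - ln (Zsub A y')| <= \sum_i `|y i - y' i|.
Proof.
have H y1 y2 : ln (Zsub A y1) - ln (Zsub A y2) <= \sum_i `|y1 i - y2 i|.
  set d := \sum_i _.
  rewrite lerBlDr -(expRK d) -lnM ?posrE ?expR_gt0 ?Zsub_gt0 //.
  rewrite ler_ln ?posrE ?mulr_gt0 ?expR_gt0 ?Zsub_gt0 //.
  rewrite /Zsub big_distrr /=; apply: ler_sum => M _.
  rewrite /weight -expRD ler_expR -lerBlDr opprD addrACA -!sumrB /d big_sumType /=.
  apply: lerD.
    apply: (@le_trans _ _ (\sum_(e in M) `|y1 (inl e) - y2 (inl e)|)).
      by apply: ler_sum => e _; exact: ler_norm.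
    by rewrite [leRHS](bigID (mem M)) /= lerDl sumr_ge0.
  apply: (@le_trans _ _ (\sum_(x in A | ~~ matched M x) `|y1 (inr x) - y2 (inr x)|)).
    by apply: ler_sum => e _; exact: ler_norm.
  by rewrite [leRHS](bigID (fun x => (x \in A) && ~~ matched M x)) /= lerDl sumr_ge0.
rewrite ler_norml -opprB lerN2 opprB H andbT.
by under eq_bigr do rewrite distrC; exact: H.
Qed.

Definition alive A i := match i with inl e => (val e : {set G}) \subset A | inr x => x \in A end.

Lemma Zsub_dep A y y' : (forall i, alive A i -> y i = y' i) -> Zsub A y = Zsub A y'.
Proof.
move=> h; rewrite /Zsub; apply: eq_bigr => M /andP[_ /forall_inP wM]; congr expR; congr (_ + _).
  by apply: eq_bigr => e /wM eA; exact: h.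
by apply: eq_bigr => x /andP[xA _]; exact: h.
Qed.

Definition touch i : {set G} := match i with inl e => val e | inr x => [set x]%SET end.

Lemma touch_ex i : exists x, x \in touch i.
Proof. by case: i => [e|x] /=; [exact: edge_nonempty|exists x; rewrite inE]. Qed.

(** A vertex touched by the item; for an edge, an arbitrary end. *)
Definition root i : G := xchoose (touch_ex i).

Lemma rootP i : root i \in touch i.
Proof. exact: xchooseP. Qed.

(** Once the root of i is deleted, item i no longer enters the partition function.
Hence the effect of i on the free energy is its effect on a single ratio, and
correlation decay for ratios makes it approximately local. *)
Lemma lnZ_diff_root i y y' : (forall j, j != i -> y j = y' j) ->
  ln (Zsub [set: G]%SET y) - ln (Zsub [set: G]%SET y') =
  logratio [set: G]%SET (root i) y - logratio [set: G]%SET (root i) y'.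
Proof.
move=> h; rewrite /logratio [in X in _ - (_ - X)](@Zsub_dep _ y' y) ?opprB ?addrA ?subrK //.
move=> j aj; apply/esym/h; apply: contraTneq aj => ->.
have := rootP i; case: {+}i => [e|x] /= r.
  by rewrite finset.subsetD1 r andbF.
by move: r; rewrite inE => /eqP ->; rewrite !inE eqxx.
Qed.

Variable D : nat.
Hypothesis hD : (max_degree G <= D)%N.

Definition neighbours x : {set G} := [set z | adj x z]%SET.

Lemma card_neighbours x : (#|neighbours x| <= D)%N.
Proof. by apply: leq_trans hD; apply: (@leq_bigmax _ (fun x => #|neighbours x|)). Qed.

Lemma card_incident x (p : pred (edge G)) : (forall e, p e -> x \in (val e : {set G})) -> (#|p| <= D)%N.
Proof.
move=> h; apply: leq_trans (card_neighbours x).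
rewrite -(card_in_imset (f := fun e => other e x) (D := p)); last first.
  move=> e f /h xe /h xf E; apply: val_inj.
  by have [_ _ ->] := otherP xe; have [_ _ ->] := otherP xf; rewrite E.
apply: fintype.subset_leq_card; apply/fintype.subsetP => z /imsetP[e /h xe ->].
by rewrite inE; have [] := otherP xe.
Qed.

Lemma card_root x : (#|[set i | root i == x]%SET| <= D.+1)%N.
Proof.
have : ([set i | root i == x] \subset [set inl e | e in [pred e : edge G | x \in (val e : {set G})]] :|: [set inr x])%SET.
  apply/fintype.subsetP => -[e|z]; rewrite !inE => /eqP rx.
    apply/orP; left; apply/imsetP; exists e => //; rewrite inE.
    by have := rootP (inl e); rewrite rx.
  by have := rootP (inr z); rewrite rx inE => /eqP ->; rewrite eqxx orbT.
move/fintype.subset_leq_card => h; apply: (leq_trans h).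
rewrite (leq_trans (leq_card_setU _ _)) // cards1 addn1 ltnS (leq_trans (leq_imset_card _ _)) //.
exact: (@card_incident x).
Qed.

Fixpoint reach k x z : bool :=
  if k is k'.+1 then [exists u, ((u == x) || adj x u) && reach k' u z] else x == z.

Lemma reach_refl k x : reach k x x.
Proof. by elim: k => //= k IH; apply/existsP; exists x; rewrite eqxx. Qed.

Lemma reach_add k l x z v : reach k x z -> reach l z v -> reach (k + l) x v.
Proof.
elim: k x => [|k IH] x /=; first by move=> /eqP ->.
by move=> /existsP[u /andP[xu uz]] zv; apply/existsP; exists u; rewrite xu IH.
Qed.

Lemma reach1 x z : (z == x) || adj x z -> reach 1 x z.
Proof. by move=> h; apply/existsP; exists z; rewrite h /= eqxx. Qed.

Lemma reach_sym k x z : reach k x z -> reach k z x.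
Proof.
elim: k x => [|k IH] x; first by move=> /= /eqP ->.
move=> /existsP[u /andP[xu /IH uz]]; rewrite -addn1; apply: (reach_add uz).
by apply: reach1; rewrite eq_sym adj_sym.
Qed.

Lemma card_reach k x : (#|[set z | reach k x z]%SET| <= D.+1 ^ k)%N.
Proof.
elim: k x => [|k IH] x.
  have -> : [set z | reach 0 x z]%SET = [set x]%SET by apply/setP => z; rewrite !inE eq_sym.
  by rewrite cards1.
have : ([set z | reach k.+1 x z] \subset \bigcup_(u in (x |: neighbours x)) [set z | reach k u z])%SET.
  apply/fintype.subsetP => z; rewrite inE => /existsP[u /andP[xu uz]].
  apply/bigcupP; exists u; last by rewrite inE.
  by rewrite !inE.
move/fintype.subset_leq_card => h; apply: (leq_trans h).
apply: (leq_trans (card_bigcup_le _ _)) => /=.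
apply: (@leq_trans (\sum_(u in (x |: neighbours x)%SET) D.+1 ^ k)%N); first exact: leq_sum.
rewrite sum_nat_const expnS leq_mul2r; apply/orP; right.
rewrite (leq_trans (leq_card_setU _ _)) // cards1 add1n ltnS; exact: card_neighbours.
Qed.

(** The items that touch the ball of radius k around x. *)
Definition ball_items k x : {set I} := [set i | [exists z, (z \in touch i) && reach k x z]]%SET.

Lemma truncated_dep k A x y y' : (forall i, i \in ball_items k x -> y i = y' i) -> truncated k A x y = truncated k A x y'.
Proof.
elim: k A x => [|k IH] A x h /=.
  by apply: h; rewrite inE; apply/existsP; exists x; rewrite /= inE !eqxx.
rewrite h; last by rewrite inE; apply/existsP; exists x; apply/andP; split; [by rewrite /= inE|exact: (reach_refl k.+1)].
congr (ln (_ + _)); apply: eq_bigr => e /andP[xe _].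
rewrite h; last by rewrite inE; apply/existsP; exists x; apply/andP; split; [by []|exact: (reach_refl k.+1)].
congr (expR (_ - _)); apply: IH => i; rewrite inE => /existsP[z /andP[zi r]].
apply: h; rewrite inE; apply/existsP; exists z; rewrite zi /=; apply/existsP; exists (other e x).
by rewrite r andbT; have [-> _ _] := otherP xe; rewrite orbT.
Qed.

Lemma edge_adj e x z : x \in (val e : {set G}) -> z \in (val e : {set G}) -> (z == x) || adj x z.
Proof.
move=> xe; have [xo _ ->] := otherP xe; rewrite !inE => /orP[->//|/eqP ->].
by rewrite xo orbT.
Qed.

(** The two balls are joined through the ends of a common item, which may be an
edge: hence the 1 between the two radii. *)
Lemma ball_items_meet k i j : ~~ [disjoint ball_items k (root i) & ball_items k (root j)]%B ->
  reach (k + (1 + k)) (root i) (root j).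
Proof.
rewrite -finset.setI_eq0 => /finset.set0Pn[l]; rewrite !inE => /andP[/existsP[z /andP[zl rz]] /existsP[u /andP[ul ru]]].
apply: (reach_add rz); apply: (@reach_add _ _ _ u); last exact: reach_sym.
apply: reach1; move: zl ul; case: {+}l => [e|v] /=; first exact: edge_adj.
by rewrite !inE => /eqP -> /eqP ->; rewrite eqxx.
Qed.

Lemma card_meet k i :
  (#|[set j | ~~ [disjoint ball_items k (root i) & ball_items k (root j)]%B]%SET| <= D.+1 ^ (2 * k).+2)%N.
Proof.
have : ([set j | ~~ [disjoint ball_items k (root i) & ball_items k (root j)]%B] \subset
   \bigcup_(z in [set z | reach (k + (1 + k)) (root i) z]) [set j | root j == z])%SET.
  apply/fintype.subsetP => j; rewrite inE => /ball_items_meet h.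
  by apply/bigcupP; exists (root j); rewrite inE.
move/fintype.subset_leq_card => h; apply: (leq_trans h).
apply: (leq_trans (card_bigcup_le _ _)) => /=.
apply: (@leq_trans (\sum_(z in [set z | reach (k + (1 + k)) (root i) z]%SET) D.+1)%N).
  by apply: leq_sum => z _; exact: card_root.
rewrite sum_nat_const -(addn1 (2 * k).+1) expnD expn1 leq_mul2r; apply/orP; right.
apply: (leq_trans (card_reach _ _)); rewrite leq_pexp2l //; lia.
Qed.

(** The weights that enter the activity at x. *)
Definition nbhd_items x : {set I} := [set i | match i with inl e => x \in (val e : {set G}) | inr z => (z == x) || adj x z end]%SET.

Lemma card_nbhd_items x : (#|nbhd_items x| <= 2 * D + 1)%N.
Proof.
have : (nbhd_items x \subset [set inl e | e in [pred e : edge G | x \in (val e : {set G})]] :|: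
   [set inr z | z in x |: neighbours x])%SET.
  apply/fintype.subsetP => -[e|z]; rewrite !inE => h.
    by apply/orP; left; apply/imsetP; exists e.
  by apply/orP; right; apply/imsetP; exists z => //; rewrite !inE.
move/fintype.subset_leq_card => h; apply: (leq_trans h).
apply: (leq_trans (leq_card_setU _ _)).
have h1 : (#|([set inl e | e in [pred e : edge G | x \in (val e : {set G})]]%SET : {set I})| <= D)%N.
  by apply: (leq_trans (leq_imset_card _ _)); exact: (@card_incident x).
have h2 : (#|([set inr z | z in (x |: neighbours x)%SET]%SET : {set I})| <= D.+1)%N.
  apply: (leq_trans (leq_imset_card _ _)).
  by rewrite (leq_trans (leq_card_setU _ _)) // cards1 add1n ltnS card_neighbours.
by rewrite (leq_trans (leq_add h1 h2)) // addnS addn1 ltnS mul2n addnn.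
Qed.

Lemma card_nbhd_items_dual (S : {set G}) i : (#|[set v in S | i \in nbhd_items v]%SET| <= D + 2)%N.
Proof.
case: i => [e|z].
  apply: (@leq_trans 2); last by rewrite leq_addl.
  have [x xe] := edge_nonempty e; have [_ _ E] := otherP xe.
  rewrite (leq_trans (fintype.subset_leq_card (_ : _ \subset [set x; other e x]%SET))) //.
    by apply/fintype.subsetP => v; rewrite !inE E !inE => /andP[].
  by rewrite cards2; case: eqP.
apply: (@leq_trans D.+1); last by rewrite addn2.
rewrite (leq_trans (fintype.subset_leq_card (_ : _ \subset (z |: neighbours z)%SET))) //.
  by apply/fintype.subsetP => v; rewrite !inE eq_sym (adj_sym v) => /andP[].
by rewrite (leq_trans (leq_card_setU _ _)) // cards1 add1n ltnS card_neighbours.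
Qed.

Definition good (K : R) x y := [forall i in nbhd_items x, `|y i| <= K].

Lemma activity_good K x y : good K x y -> activity x y <= D%:R * expR (3 * K).
Proof.
move=> /forall_inP g; rewrite /activity.
apply: (@le_trans _ _ (\sum_(e : edge G | x \in (val e : {set G})) expR (3 * K))).
  apply: ler_sum => e xe; rewrite ler_expR.
  have h1 := g (inl e) ltac:(by rewrite inE).
  have h2 := g (inr x) ltac:(by rewrite inE eqxx).
  have h3 := g (inr (other e x)) ltac:(by rewrite inE; have [-> _ _] := otherP xe; rewrite orbT).
  move: h1 h2 h3; rewrite !ler_norml => /andP[? ?] /andP[? ?] /andP[? ?]; lra.
rewrite sumr_const -[leLHS]mulr_natl ler_wpM2r ?expR_ge0 // ler_nat.
exact: (@card_incident x).
Qed.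

(** Under moment assumptions the weights are unbounded and the contraction factor
may come close to 1. The errors are therefore capped at a level L which is more
than twice the largest error possible at a good vertex, and raised to a large
power p. A good vertex then multiplies the capped power by at most c^p <= s; a
bad vertex does not contract, but the penalty, at least th, of one of its large
weights makes up for the missing factor, as 1 <= s * th. *)
Section capped_errors.
Variables (K L s th : R) (p : nat).
Let L0 : R := D%:R * expR (3 * K).
Hypothesis LE : L = 2 * ln (1 + L0) + 1.
Let c := Num.max (L0 / (1 + L0)) (1 / 2).
Hypothesis cp : c ^+ p <= s.
Hypothesis p0 : (0 < p)%N.
Hypothesis th0 : 0 <= th.
Hypothesis sth : 1 <= s * th.

(** The price 1 + th is paid for a weight beyond the threshold K. *)
Definition penalty (t : R) : R := if `|t| <= K then 1 else 1 + th.
Definition nbhd_penalty x y : R := \prod_(i in nbhd_items x) penalty (y i).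

Lemma penalty_ge1 t : 1 <= penalty t.
Proof. by rewrite /penalty; case: ifP => _ //; rewrite lerDl. Qed.

Lemma nbhd_penalty_ge1 x y : 1 <= nbhd_penalty x y.
Proof.
rewrite /nbhd_penalty; elim/big_rec: _ => // i t _ h.
by rewrite -[leLHS]mulr1 ler_pM // penalty_ge1.
Qed.

Lemma nbhd_penalty_bad x y : ~~ good K x y -> th <= nbhd_penalty x y.
Proof.
rewrite /good negb_forall_in => /exists_inP[i iN hi].
rewrite /nbhd_penalty (bigD1 i) //= /penalty (negbTE hi).
apply: (@le_trans _ _ (1 + th)); first by rewrite lerDr.
rewrite -[leLHS]mulr1 ler_wpM2l ?addr_ge0 //.
by elim/big_rec: _ => // j t _ h; rewrite -[leLHS]mulr1 ler_pM // penalty_ge1.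
Qed.

Let L0_ge0 : 0 <= L0. Proof. by rewrite mulr_ge0 ?expR_ge0. Qed.
Let lnL0 : 0 <= ln (1 + L0). Proof. by rewrite ln_ge0 // lerDl. Qed.
Let L_gt0 : 0 < L. Proof. by rewrite LE ltr_wpDl // mulr_ge0. Qed.
Let c_half : 1 / 2 <= c. Proof. by rewrite le_max lexx orbT. Qed.
Let c_ge0 : 0 <= c. Proof. exact: le_trans c_half. Qed.
Let c_le1 : c <= 1.
Proof.
rewrite ge_max; apply/andP; split; last by lra.
by rewrite ler_pdivrMr ?mul1r ?lerDr // ltr_wpDr.
Qed.
Let s_ge0 : 0 <= s. Proof. by apply: le_trans cp; exact: exprn_ge0. Qed.

Definition capped_err k A x y : R := Num.min (err k A x y) L / L.

Lemma capped_err_ge0 k A x y : 0 <= capped_err k A x y.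
Proof. by rewrite divr_ge0 ?(ltW L_gt0) // le_min normr_ge0 ltW. Qed.

Lemma capped_err_le1 k A x y : capped_err k A x y <= 1.
Proof. by rewrite ler_pdivrMr // mul1r ge_min lexx orbT. Qed.

(** At a good vertex: either the largest error d at the neighbours is at most L,
and the contraction applies, or it exceeds L, and then the uniform bound
ln (1 + activity) on the new error is at most L / 2. *)
Lemma capped_err_step k A x y : x \in A ->
  capped_err k.+1 A x y ^+ p <= s * nbhd_penalty x y * \sum_(e | incident x A e) capped_err k (A :\ x)%SET (other e x) y ^+ p.
Proof.
move=> xA.
pose d := \big[Num.max/0]_(e | incident x A e) err k (A :\ x)%SET (other e x) y.
have sum0 (e0 : edge G) : incident x A e0 -> capped_err k (A :\ x)%SET (other e0 x) y ^+ p <=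
    \sum_(e | incident x A e) capped_err k (A :\ x)%SET (other e x) y ^+ p.
  by move=> ie; rewrite (bigD1 e0) //= lerDl sumr_ge0 // => e _; rewrite exprn_ge0 ?capped_err_ge0.
have d0 : 0 <= d.
  by rewrite /d; elim/big_rec: _ => // e t _ h; rewrite le_max h orbT.
have dmax e : incident x A e -> err k (A :\ x)%SET (other e x) y <= d.
  by move=> ie; rewrite /d (bigD1 e) //= le_max lexx.
have st := err_step xA d0 dmax.
(* The maximum over an empty range is 0, which is the case of an isolated x. *)
have dcase : d = 0 \/ exists2 e, incident x A e & d = err k (A :\ x)%SET (other e x) y.
  rewrite /d; elim/big_rec: _ => [|e t ie h]; first by left.
  by rewrite maxEle; case: ifP => _ //; right; exists e.
have b0 : 0 <= nbhd_penalty x y by rewrite (le_trans _ (nbhd_penalty_ge1 x y)).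
case: dcase => [dE|[e ie dE]].
  have -> : capped_err k.+1 A x y = 0.
    rewrite /capped_err; have : err k.+1 A x y <= 0 by rewrite (le_trans st) // dE mulr0.
    have : 0 <= err k.+1 A x y by exact: normr_ge0.
    move=> h1 h2; have -> : err k.+1 A x y = 0 by apply/eqP; rewrite eq_le h1 h2.
    by rewrite /Num.min L_gt0 mul0r.
  rewrite expr0n (gtn_eqF p0) mulr_ge0 //; first exact: mulr_ge0.
  by apply: sumr_ge0 => e _; rewrite exprn_ge0 ?capped_err_ge0.
have ratio_le1 : activity x y / (1 + activity x y) <= 1.
  by rewrite ler_pdivrMr ?mul1r ?lerDr // ltr_wpDr ?activity_ge0.
apply: (@le_trans _ _ (s * nbhd_penalty x y * capped_err k (A :\ x)%SET (other e x) y ^+ p)); last first.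
  by rewrite ler_wpM2l ?sum0 // mulr_ge0.
have cge := capped_err_ge0 k (A :\ x)%SET (other e x) y.
have [g|g] := boolP (good K x y); last first.
  have e1 : capped_err k.+1 A x y <= capped_err k (A :\ x)%SET (other e x) y.
    rewrite /capped_err ler_wpM2r ?invr_ge0 ?(ltW L_gt0) // le_min ge_min ge_min lexx orbT andbT.
    by rewrite -dE (le_trans st) // -[leRHS]mul1r ler_wpM2r.
  apply: (@le_trans _ _ (1 * capped_err k (A :\ x)%SET (other e x) y ^+ p)).
    by rewrite mul1r lerXn2r ?nnegrE ?capped_err_ge0.
  rewrite ler_wpM2r ?exprn_ge0 // (le_trans sth) // ler_wpM2l //; exact: nbhd_penalty_bad.
have LL := activity_good g.
have e1 : capped_err k.+1 A x y <= c * capped_err k (A :\ x)%SET (other e x) y.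
  rewrite /capped_err mulrA ler_wpM2r ?invr_ge0 ?(ltW L_gt0) //.
  rewrite -dE; case: (leP d L) => dL.
    rewrite ge_min; apply/orP; left; apply: (le_trans st); rewrite ler_wpM2r //.
    rewrite le_max; apply/orP; left; rewrite ler_pdivrMr ?ltr_wpDr ?activity_ge0 //.
    rewrite mulrAC ler_pdivlMr ?ltr_wpDr //; have := activity_ge0 x y.
    by move: (activity x y) LL => l; rewrite -/L0 => *; nra.
  rewrite ge_min; apply/orP; left.
  apply: (@le_trans _ _ (1 / 2 * L)); last by rewrite ler_wpM2r // ltW.
  apply: (le_trans (err_le _ _ xA)).
  have : ln (1 + activity x y) <= ln (1 + L0) by rewrite ler_ln ?posrE ?ltr_wpDr ?activity_ge0 // lerD2l.
  by rewrite LE; lra.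
apply: (@le_trans _ _ ((c * capped_err k (A :\ x)%SET (other e x) y) ^+ p)).
  by rewrite lerXn2r ?nnegrE ?capped_err_ge0 // mulr_ge0.
rewrite exprMn ler_wpM2r ?exprn_ge0 // (le_trans cp) // -[leLHS]mulr1 ler_wpM2l //.
exact: nbhd_penalty_ge1.
Qed.

(** The bound on the capped power that results from iterating the step: a sum,
over the self-avoiding paths of length k from x, of s^k times the product of the
penalties along the path. *)
Fixpoint path_bound k A x y : R :=
  if k is k'.+1 then s * nbhd_penalty x y * \sum_(e | incident x A e) path_bound k' (A :\ x)%SET (other e x) y else 1.

Lemma capped_err_path_bound k A x y : x \in A -> capped_err k A x y ^+ p <= path_bound k A x y.
Proof.
elim: k A x => [|k IH] A x xA /=.
  by rewrite exprn_ile1 ?capped_err_ge0 ?capped_err_le1.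
apply: (le_trans (capped_err_step _ _ xA)); rewrite ler_wpM2l //.
  by rewrite mulr_ge0 // (le_trans _ (nbhd_penalty_ge1 x y)).
by apply: ler_sum => e /incident_other; exact: IH.
Qed.

End capped_errors.

End local.

(** * Decay of the truncation error in mean *)
Lemma measurable_sumP {R : realType} d (T : measurableType d) (S : Type) (r : seq S) (p : pred S)
  (f : S -> T -> R) : (forall u, measurable_fun setT (f u)) ->
  measurable_fun setT (fun t => \sum_(u <- r | p u) f u t).
Proof. by move=> h; under eq_fun do rewrite -big_filter; exact: measurable_sum. Qed.

Section prodE.
Context {R : realType} (J : finType) (Q : probability (weights (R:=R) J) R).
Variable mu : J -> probability R R.
Hypothesis Qmu : product_law Q mu.
Hypothesis Q4 : forall j, rintegrable Q (fun y => y j ^+ 4).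

Lemma mean_prod (s : seq J) (f : J -> R -> R) : uniq s ->
  (forall j, growth 0 (fun y : weights (R:=R) J => f j (y j))) ->
  growth 0 (fun y : weights (R:=R) J => \prod_(j <- s) f j (y j)) /\
  mean Q (fun y => \prod_(j <- s) f j (y j)) = \prod_(j <- s) mean Q (fun y => f j (y j)).
Proof.
move=> us gf; elim: s us => [_|a s IH /= /andP[nas us]].
  rewrite big_nil (_ : (fun _ => _) = fun=> 1); last by apply/funext => y; rewrite big_nil.
  by split; [exact: growth_cst|exact: mean_cst].
have [gs Es] := IH us.
rewrite big_cons -Es (_ : (fun _ => _) = fun y : weights (R:=R) J => f a (y a) * \prod_(j <- s) f j (y j)); last first.
  by apply/funext => y; rewrite big_cons.
have gp := growthM (gf a) gs; split => //.
apply: (mean_indep Qmu (S := [set a]%SET)) => //.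
- by move=> y z /(_ a) -> //; rewrite inE.
- move=> y z h; apply: eq_big_seq => j js; rewrite h // !inE.
  by apply: contraNneq nas => <-.
- exact: (growth_rintegrable Q4 _ (gf a)).
- exact: (growth_rintegrable Q4 _ gs).
- exact: (growth_rintegrable Q4 _ gp).
Qed.

End prodE.

Lemma small_pow {R : realType} (c s : R) : 0 <= c -> c < 1 -> 0 < s ->
  exists2 p, (0 < p)%N & c ^+ p <= s.
Proof.
move=> c0 c1 s0.
have c1' : `|c| < 1 by rewrite ger0_norm.
have /cvgrPdist_lt /(_ s s0) H := cvg_expr c1'.
near \oo => p; exists p; first by near: p; exact: nbhs_infty_gt.
apply: ltW; apply: (le_lt_trans (ler_norm _)); rewrite -normrN -sub0r.
by near: p.
Unshelve. all: by end_near. Qed.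

Section expect.
Context {R : realType} (G : sgraph).
Notation I := (edge G + G)%type.
Notation Y := (weights (R:=R) I).
Variable Q : probability (weights (R:=R) I) R.
Variable mu : I -> probability R R.
Hypothesis Qmu : product_law Q mu.
Hypothesis Q4 : forall j, rintegrable Q (fun y => y j ^+ 4).
Variable m4 : R.
Hypothesis Em4 : forall j, mean Q (fun y => y j ^+ 4) <= m4.
Variable D : nat.
Hypothesis hD : (max_degree G <= D)%N.
Implicit Types (A : {set G}) (x : G) (e : edge G).

Lemma measurable_lnZ A : measurable_fun setT (fun y : Y => ln (Zsub A y)).
Proof.
apply: measurableT_comp; first exact: measurable_ln.
apply: measurable_sumP => M; apply: measurableT_comp => //.
by apply: measurable_funD; apply: measurable_sumP => i; exact: measurable_coord.
Qed.

Lemma measurable_logratio A x : measurable_fun setT (fun y : Y => logratio A x y).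
Proof. by apply: measurable_funB; exact: measurable_lnZ. Qed.

Lemma measurable_truncated k A x : measurable_fun setT (fun y : Y => truncated k A x y).
Proof.
elim: k A x => [|k IH] A x /=; first exact: measurable_coord.
apply: measurableT_comp; first exact: measurable_ln.
apply: measurable_funD.
  by apply: measurableT_comp => //; exact: measurable_coord.
apply: measurable_sumP => e.
apply: measurableT_comp => //; apply: measurable_funB; last exact: IH.
exact: measurable_coord.
Qed.

Lemma measurable_err k A x : measurable_fun setT (fun y : Y => err k A x y).
Proof.
rewrite /err; apply: measurableT_comp => //; apply: measurable_funB.
  exact: measurable_logratio.
exact: measurable_truncated.
Qed.

Section path_bound_mean.
Variables (K s th : R).
Hypothesis K0 : 0 < K.
Hypothesis th0 : 0 <= th.
Hypothesis s0 : 0 <= s.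
Hypothesis hK : (1 + th) ^+ (D + 2) * m4 <= K ^+ 4.

Lemma measurable_penalty : measurable_fun setT (penalty K th).
Proof.
apply: measurable_fun_ifT => //.
by apply: measurable_fun_ler => //; exact: measurableT_comp.
Qed.

Lemma penalty_le (t : R) : penalty K th t <= 1 + th.
Proof. by rewrite /penalty; case: ifP => // _; rewrite lerDl. Qed.

Lemma penalty_ge0 (t : R) : 0 <= penalty K th t.
Proof. by rewrite (le_trans _ (penalty_ge1 K th0 t)). Qed.

Lemma growth_penaltyX n (i : I) : growth 0 (fun y : Y => penalty K th (y i) ^+ n).
Proof.
apply: (@growth_bd _ _ _ ((1 + th) ^+ n)).
  apply: measurable_funX; apply: measurableT_comp; [exact: measurable_penalty|exact: measurable_coord].
move=> y; rewrite ger0_norm ?exprn_ge0 ?penalty_ge0 //.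
by rewrite lerXn2r ?nnegrE ?penalty_ge0 ?penalty_le // addr_ge0.
Qed.

(** Markov's inequality with the fourth moment: the threshold K is large enough
for the rare price (1 + th)^n to add at most 1 to the mean. *)
Lemma mean_penaltyX n (i : I) : (n <= D + 2)%N -> mean Q (fun y => penalty K th (y i) ^+ n) <= 2 ^+ n.
Proof.
case: n => [_|n nD].
  by rewrite (_ : (fun _ => _) = fun=> 1) ?mean_cst ?expr0 //; apply/funext => y; rewrite expr0.
have K4 : 0 < K ^+ 4 by exact: exprn_gt0.
pose C := (1 + th) ^+ (D + 2) / K ^+ 4.
have C0 : 0 <= C by rewrite divr_ge0 ?exprn_ge0 ?addr_ge0 // ltW.
have bd (t : R) : penalty K th t ^+ n.+1 <= 1 + C * t ^+ 4.
  have t4 : t ^+ 4 = `|t| ^+ 4 by rewrite -normrX ger0_norm // (exprM _ 2 2) sqr_ge0.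
  rewrite /penalty; case: (leP `|t| K) => h.
    by rewrite expr1n lerDl mulr_ge0 // t4 exprn_ge0.
  apply: (@le_trans _ _ (C * t ^+ 4)); last by rewrite lerDr.
  rewrite /C mulrAC ler_pdivlMr // ler_pM ?exprn_ge0 ?addr_ge0 ?(ltW K0) //.
    by rewrite ler_weXn2l // lerDl.
  by rewrite t4 lerXn2r ?nnegrE ?(ltW K0) ?(ltW h).
have I1 := rintegrableD (rintegrable_cst Q 1) (rintegrableZ C (Q4 i)).
apply: (le_trans (mean_le (growth_rintegrable Q4 _ (growth_penaltyX n.+1 i)) I1 (fun y => bd (y i)))) => //.
rewrite meanD ?mean_cst ?meanZ //; [|exact: rintegrable_cst|exact: rintegrableZ].
apply: (@le_trans _ _ 2); last by rewrite exprS ler_peMr // exprn_ege1 // ler1n.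
rewrite (_ : 2 = 1 + 1 :> R) // lerD2l /C mulrAC ler_pdivrMr // mul1r.
by rewrite (le_trans _ hK) // ler_wpM2l // exprn_ge0 // addr_ge0.
Qed.

(** Grouped by item, the product is a product of independent factors; an item
occurs in it at most D + 2 times, which explains the exponent in the condition
on the threshold. *)
Lemma mean_nbhd_penalty (S : {set G}) :
  growth 0 (fun y : Y => \prod_(v in S) nbhd_penalty K th v y) /\
  mean Q (fun y => \prod_(v in S) nbhd_penalty K th v y) <= 2 ^+ ((2 * D + 1) * #|S|).
Proof.
pose n (i : I) := #|[set v in S | i \in nbhd_items v]%SET|.
have E : (fun y : Y => \prod_(v in S) nbhd_penalty K th v y) =
         (fun y => \prod_(i <- index_enum I) penalty K th (y i) ^+ n i).
  apply/funext => y; rewrite /nbhd_penalty (exchange_big_dep predT) //=; apply: eq_bigr => i _.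
  rewrite prodr_const; congr (_ ^+ _); apply: eq_card => v.
  by rewrite [RHS]finset.in_set.
have [g e] := @mean_prod _ _ Q mu Qmu Q4 _ (fun i t => penalty K th t ^+ n i) (index_enum_uniq I) (fun i => growth_penaltyX (n i) i).
rewrite E; split => //; rewrite e.
apply: (@le_trans _ _ (\prod_(i : I) 2 ^+ n i)).
  apply: ler_prod => i _; rewrite mean_penaltyX ?andbT; last exact: card_nbhd_items_dual.
  by apply: mean_ge0 => y; rewrite exprn_ge0 ?penalty_ge0.
rewrite prodrXr ler_weXn2l // ?ler1n //.
apply: (@leq_trans (\sum_(v in S) #|nbhd_items v|)).
  rewrite /n; under eq_bigr do rewrite -sum1_card.
  under [X in (_ <= X)%N]eq_bigr do rewrite -sum1_card.
  rewrite [X in (_ <= X)%N](exchange_big_dep predT) //=.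
  apply: leq_sum => i _; rewrite leq_eqVlt; apply/orP; left; apply/eqP.
  by apply: eq_bigl => v; rewrite [LHS]finset.in_set.
apply: (@leq_trans (\sum_(v in S) (2 * D + 1))); first by apply: leq_sum => v _; exact: card_nbhd_items.
by rewrite sum_nat_const mulnC.
Qed.

Lemma growth_path_bound k A x : growth 0 (fun y : Y => path_bound K s th k A x y).
Proof.
have gb z : growth 0 (fun y : Y => nbhd_penalty K th z y).
  have [g _] := mean_nbhd_penalty [set z]%SET.
  rewrite (_ : (fun _ => _) = (fun y : Y => \prod_(v in [set z]%SET) nbhd_penalty K th v y)) //.
  by apply/funext => y; rewrite big_set1.
elim: k A x => [|k IH] A x /=; first exact: growth_cst.
by apply: (growthM (growthZ s (gb x))); apply: growth_sum => e; exact: IH.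
Qed.

(** Along a path the penalties are not independent, as neighbouring vertices share
weights. The induction therefore carries the product of the penalties of all
vertices deleted so far and takes the mean only at the end. Since the path is
self-avoiding, each vertex enters that product once. *)
Lemma mean_path_bound_alive k A x : x \in A ->
  mean Q (fun y => \prod_(v in (~: A)%SET) nbhd_penalty K th v y * path_bound K s th k A x y) <=
  (s * D%:R) ^+ k * 2 ^+ ((2 * D + 1) * (#|(~: A)%SET| + k)).
Proof.
have gA (B : {set G}) : growth 0 (fun y : Y => \prod_(v in B) nbhd_penalty K th v y) by have [] := mean_nbhd_penalty B.
elim: k A x => [|k IH] A x xA.
  rewrite expr0 mul1r addn0 (_ : (fun _ => _) = fun y => \prod_(v in (~: A)%SET) nbhd_penalty K th v y); last first.
    by apply/funext => y; rewrite mulr1.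
  by have [] := mean_nbhd_penalty (~: A)%SET.
rewrite (_ : (fun _ => _) = fun y => s * \sum_(e | incident x A e)
    (\prod_(v in (~: (A :\ x))%SET) nbhd_penalty K th v y * path_bound K s th k (A :\ x)%SET (other e x) y)); last first.
  apply/funext => y /=; rewrite -big_distrr /= mulrA [_ * (s * _)]mulrC -mulrA -mulrA; congr (_ * _).
  rewrite mulrA; congr (_ * _); rewrite [RHS](bigD1 x) /=; last by rewrite !inE eqxx.
  congr (_ * _); apply: eq_bigl => v; rewrite !inE.
  by case: eqP => [->|] //=; rewrite ?xA // andbT.
have gI e : growth 0 (fun y : Y => \prod_(v in (~: (A :\ x))%SET) nbhd_penalty K th v y *
     path_bound K s th k (A :\ x)%SET (other e x) y) by exact: (growthM (gA _) (growth_path_bound _ _ _)).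
have I1 e := growth_rintegrable Q4 (leq0n 4) (gI e).
rewrite meanZ; last exact: rintegrable_sum.
rewrite mean_sum //.
have card1 : #|(~: (A :\ x))%SET| = #|(~: A)%SET|.+1.
  by rewrite finset.setCD finset.setUC cardsU1 finset.in_setC xA.
apply: (@le_trans _ _ (s * \sum_(e | incident x A e) ((s * D%:R) ^+ k * 2 ^+ ((2 * D + 1) * (#|(~: A)%SET| + k.+1))))).
  rewrite ler_wpM2l //; apply: ler_sum => e /incident_other ox.
  by have := IH _ _ ox; rewrite card1 addSnnS.
rewrite sumr_const -[X in s * X]mulr_natl exprS -!mulrA ler_wpM2l //.
apply: ler_wpM2r; first by rewrite mulr_ge0 ?exprn_ge0 ?mulr_ge0.
rewrite ler_nat.
by apply: (card_incident hD (x := x)) => e /andP[].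
Qed.

Lemma mean_path_bound k x : mean Q (fun y => path_bound K s th k [set: G]%SET x y) <=
  (s * D%:R * 2 ^+ (2 * D + 1)) ^+ k.
Proof.
have := mean_path_bound_alive k (finset.in_setT x).
rewrite finset.setCT cards0 add0n exprM -exprMn.
rewrite (_ : (fun _ => _) = (fun y => path_bound K s th k [set: G]%SET x y)) //.
by apply/funext => y; rewrite big_set0 mul1r.
Qed.

End path_bound_mean.
End expect.

(** The number s is chosen so small that s D 2^(2D+1) <= 1/2: then the mean of the
path bound beats both the number D^k of paths and the cost of the penalties,
and decays geometrically. The threshold K, the cap L and the power p follow.
The truncation depth k depends on D, on the moment bound and on eps only,
which is the uniformity over all graphs that the limit theorem needs. *)
Lemma decay {R : realType} (D : nat) (m4 eps : R) : 0 <= m4 -> 0 < eps ->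
  exists k, forall (G : sgraph) (Q : probability (weights (R:=R) (edge G + G)%type) R)
    (mu : edge G + G -> probability R R),
    (max_degree G <= D)%N -> product_law Q mu ->
    (forall j, rintegrable Q (fun y => y j ^+ 4)) ->
    (forall j, mean Q (fun y => y j ^+ 4) <= m4) ->
    forall x, mean Q (fun y => Num.min 1 (err k [set: G]%SET x y)) <= eps.
Proof.
move=> m40 eps0.
(* D.+1 rather than D keeps the denominator positive when D = 0. *)
pose s : R := (D.+1%:R * 2 ^+ (2 * D + 2))^-1.
have s0 : 0 < s by rewrite invr_gt0 mulr_gt0 ?ltr0n // exprn_gt0.
pose th : R := s^-1.
have th0 : 0 <= th by rewrite invr_ge0 ltW.
have sth : 1 <= s * th by rewrite /th mulfV ?gt_eqF.
pose M : R := (1 + th) ^+ (D + 2) * m4.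
have M0 : 0 <= M by rewrite mulr_ge0 // exprn_ge0 // addr_ge0.
pose K : R := 1 + M.
have K1 : 1 <= K by rewrite lerDl.
have K0 : 0 < K by exact: lt_le_trans K1.
have hK : (1 + th) ^+ (D + 2) * m4 <= K ^+ 4.
  rewrite -/M (@le_trans _ _ K) // /K ?lerDr // -/K.
  by rewrite -[leLHS]expr1 ler_weXn2l.
pose L0 : R := D%:R * expR (3 * K).
have L00 : 0 <= L0 by rewrite mulr_ge0 ?expR_ge0.
pose L : R := 2 * ln (1 + L0) + 1.
have L_gt0 : 0 < L by rewrite ltr_wpDl // mulr_ge0 // ln_ge0 // lerDl.
pose c : R := Num.max (L0 / (1 + L0)) (1 / 2).
have c0 : 0 <= c by rewrite le_max; apply/orP; left; rewrite divr_ge0 // addr_ge0.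
have c1 : c < 1.
  rewrite gt_max; apply/andP; split; last by lra.
  by rewrite ltr_pdivrMr ?mul1r ?ltrDr // ltr_wpDr.
have [p p0 cp] := small_pow c0 c1 s0.
pose e2 := eps / 2.
have e20 : 0 < e2 by rewrite divr_gt0.
(* An error above e2 has capped value at least kap; the event is then controlled
   by the p-th power of the capped error. *)
pose kap := Num.min e2 L / L.
have kap0 : 0 < kap by rewrite divr_gt0 // lt_min e20.
have kp0 : 0 < kap ^+ p by exact: exprn_gt0.
have h0 : 0 <= 1 / 2 :> R by lra.
have h1 : 1 / 2 < 1 :> R by lra.
have [k _ hk] := small_pow h0 h1 (mulr_gt0 e20 kp0).
exists k => G Q mu hD Qmu Q4 Em4 x.
have mm : growth 0 (fun y : weights (R:=R) (edge G + G)%type => Num.min 1 (err k [set: G]%SET x y)).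
  apply: (@growth_bd _ _ _ 1); first by apply: measurable_minr => //; exact: measurable_err.
  by move=> y; rewrite ger0_norm ?ge_min ?lexx // le_min ler01 normr_ge0.
have gB := growth_path_bound Qmu Q4 Em4 hD s K0 th0 hK k [set: G]%SET x.
have IB := growth_rintegrable Q4 (leq0n 4) gB.
have I1 := rintegrableD (rintegrable_cst Q e2) (rintegrableZ (kap ^- p) IB).
apply: (@le_trans _ _ (mean Q (fun y => e2 + kap ^- p * path_bound K s th k [set: G]%SET x y))).
  apply: mean_le => //; first exact: (growth_rintegrable Q4 _ mm).
  move=> y; set er := err _ _ _ _.
  have er0 : 0 <= er by exact: normr_ge0.
  have cB := @capped_err_path_bound R G D hD K L s th p (erefl _) cp p0 th0 sth k [set: G]%SET x y (finset.in_setT x).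
  have cap0 := @capped_err_ge0 R G D K L (erefl _) k [set: G]%SET x y.
  have B0 : 0 <= path_bound K s th k [set: G]%SET x y by rewrite (le_trans _ cB) // exprn_ge0.
  case: (leP er e2) => h.
    by rewrite ge_min; apply/orP; right; rewrite (le_trans h) // lerDl mulr_ge0 // invr_ge0 ltW.
  rewrite ge_min; apply/orP; left.
  apply: (@le_trans _ _ (kap ^- p * path_bound K s th k [set: G]%SET x y)); last by rewrite lerDr ltW.
  rewrite mulrC ler_pdivlMr // mul1r (le_trans _ cB) // lerXn2r ?nnegrE ?(ltW kap0) //.
  rewrite /kap /capped_err ler_wpM2r ?invr_ge0 ?(ltW L_gt0) //.
  by rewrite le_min !ge_min (ltW h) lexx orbT.
rewrite meanD ?mean_cst ?meanZ //; [|exact: rintegrable_cst|exact: rintegrableZ].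
have -> : eps = e2 + e2 by rewrite /e2; lra.
rewrite lerD2l mulrC ler_pdivrMr //.
apply: le_trans hk.
apply: (le_trans (mean_path_bound Qmu Q4 Em4 hD K0 th0 (ltW s0) hK k x)).
have s2 : 0 <= s * D%:R * 2 ^+ (2 * D + 1) by rewrite mulr_ge0 ?exprn_ge0 // mulr_ge0 // ltW.
rewrite lerXn2r ?nnegrE //.
rewrite /s -[X in _ <= X]/(1 / 2) -mulrA mulrC ler_pdivrMr; last by rewrite mulr_gt0 ?ltr0n ?exprn_gt0.
rewrite (_ : (2 * D + 2 = (2 * D + 1).+1)%N); last by rewrite addnS.
rewrite exprS (_ : 1 / 2 * (D.+1%:R * (2 * 2 ^+ (2 * D + 1))) = D.+1%:R * 2 ^+ (2 * D + 1)); last by field.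
by rewrite ler_wpM2r ?exprn_ge0 // ler_nat.
Qed.

(** * Stein's method by resampling *)
Section exchange.
Context {R : realType} (I : finType).
Variable Q : probability (weights (R:=R) (I + I)%type) R.
Variable lam : I -> probability R R.
Hypothesis Qmu : product_law Q (doubled lam).
Hypothesis Q4 : forall j, rintegrable Q (fun y => y j ^+ 4).
Variable m4 : R.
Hypothesis Em4 : forall j, mean Q (fun y => y j ^+ 4) <= m4.
Notation Y := (weights (R:=R) (I + I)%type).
Implicit Types (S : {set I}) (i : I) (y : Y).

Let growth_int k f (hk : (k <= 4)%N) (h : growth k f) : rintegrable Q f := growth_rintegrable Q4 hk h.

(** The configuration in which the items of S have been resampled. *)
Definition hybrid S y : weights (R:=R) I := fun i => if i \in S then y (inr i) else y (inl i).

Definition exch i (j : I + I) : I + I :=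
  match j with inl k => if k == i then inr k else inl k | inr k => if k == i then inl k else inr k end.

Lemma exchK i : involutive (exch i).
Proof. by case=> k /=; case: ifP => h /=; rewrite h. Qed.

Lemma mean_exch i f : rintegrable Q f ->
  rintegrable Q (fun y => f (fun j => y (exch i j))) /\ mean Q (fun y => f (fun j => y (exch i j))) = mean Q f.
Proof. by apply: (mean_perm Qmu (exchK i)) => -[k|k] /=; case: ifP. Qed.

Lemma hybrid_exch_in S i y : i \notin S -> hybrid S (fun j => y (exch i j)) = hybrid (i |: S)%SET y.
Proof.
move=> iS; apply/funext => k; rewrite /hybrid !inE /=.
by case: eqP => [->|_] //=; rewrite (negbTE iS).
Qed.

Lemma hybrid_exch_out S i y : i \notin S -> hybrid (i |: S)%SET (fun j => y (exch i j)) = hybrid S y.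
Proof.
move=> iS; apply/funext => k; rewrite /hybrid !inE /=.
by case: eqP => [->|_] //=; rewrite (negbTE iS).
Qed.

Lemma measurable_hybrid S : measurable_fun setT (hybrid S).
Proof. by apply: measurable_to_weights => i; rewrite /hybrid; case: (i \in S); exact: measurable_coord. Qed.

Lemma mean_hybrid (Q0 : probability (weights (R:=R) I) R) S f : product_law Q0 lam -> rintegrable Q0 f ->
  rintegrable Q (fun y => f (hybrid S y)) /\ mean Q (fun y => f (hybrid S y)) = mean Q0 f.
Proof.
move=> Q0l If; apply: (@rintegrable_law _ _ _ Q I (hybrid S) Q0) => //.
  by move=> i; rewrite /hybrid; case: (i \in S); exact: measurable_coord.
move=> B mB; rewrite Q0l //.
have -> : hybrid S @^-1` rectangle B = rectangle (fun j => match j with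
    inl i => if i \in S then setT else B i | inr i => if i \in S then B i else setT end).
  apply/seteqP; split => y h.
    by move=> [i|i]; have := h i; rewrite /hybrid; case: (i \in S).
  by move=> i; have := h (inl i); have := h (inr i); rewrite /hybrid /=; case: (i \in S).
rewrite Qmu; last by move=> [i|i]; case: (i \in S).
rewrite big_sumType /= -big_split /=; apply: eq_bigr => i _.
by case: (i \in S); rewrite probability_setT ?mule1 ?mul1e.
Qed.

Definition gap i y : R := `|y (inl i) - y (inr i)|.

Lemma growth_gap i : growth 1 (gap i).
Proof. by apply: growth_abs; apply: growthB; exact: growth_coord. Qed.

Lemma gap4_le i y : gap i y ^+ 4 <= 8 * (y (inl i) ^+ 4 + y (inr i) ^+ 4).
Proof.
rewrite /gap -normrX ger0_norm; last by rewrite (exprM _ 2 2) sqr_ge0.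
move: (y (inl i)) (y (inr i)) => a b.
have h1 : (a - b) ^+ 2 <= 2 * (a ^+ 2 + b ^+ 2) by have := sqr_ge0 (a + b); lra.
have h2 : (a ^+ 2 + b ^+ 2) ^+ 2 <= 2 * (a ^+ 4 + b ^+ 4) by have := sqr_ge0 (a ^+ 2 - b ^+ 2); lra.
have h3 := sqr_ge0 (a - b).
rewrite (exprM _ 2 2); nra.
Qed.

Lemma mean_gap4 i : mean Q (fun y => gap i y ^+ 4) <= 16 * m4.
Proof.
have g4 : growth 4 (fun y : Y => gap i y ^+ 4).
  rewrite (_ : (fun _ => _) = fun y => (gap i y * gap i y) * (gap i y * gap i y)).
    exact: (growthM (growthM (growth_gap i) (growth_gap i)) (growthM (growth_gap i) (growth_gap i))).
  by apply/funext => y; ring.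
have I1 := rintegrableZ 8 (rintegrableD (Q4 (inl i)) (Q4 (inr i))).
apply: (le_trans (mean_le (growth_int (leqnn 4) g4) I1 (gap4_le i))).
rewrite meanZ; last exact: rintegrableD.
rewrite meanD //; have := Em4 (inl i); have := Em4 (inr i); lra.
Qed.

Lemma growth_gapX i n : growth n (fun y : Y => gap i y ^+ n).
Proof.
elim: n => [|n IH]; first by rewrite (_ : (fun _ => _) = fun=> 1); [exact: growth_cst|apply/funext => y; rewrite expr0].
rewrite (_ : (fun _ => _) = fun y : Y => gap i y * gap i y ^+ n); last by apply/funext => y; rewrite exprS.
exact: (growthM (growth_gap i) IH).
Qed.

Lemma mean_gap3 i : mean Q (fun y => gap i y ^+ 3) <= 1 + 16 * m4.
Proof.
have g4 := growth_int (leqnn 4) (growth_gapX i 4).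
have I1 := rintegrableD (rintegrable_cst Q 1) g4.
apply: (@le_trans _ _ (mean Q (fun y => 1 + gap i y ^+ 4))).
  apply: mean_le => //; first exact: (growth_int _ (growth_gapX i 3)).
  move=> y; have : 0 <= gap i y by exact: normr_ge0.
  move: (gap i y) => t t0; case: (leP t 1) => ht.
    by rewrite (@le_trans _ _ 1) ?exprn_ile1 // lerDl exprn_ge0.
  by rewrite (@le_trans _ _ (t ^+ 4)) ?ler_weXn2l ?(ltW ht) // lerDr.
rewrite meanD //; last exact: rintegrable_cst.
by rewrite mean_cst lerD2l mean_gap4.
Qed.

(** Only the pairs with overlapping supports contribute to the second moment. *)
Lemma var_sum (P : pred I) (g : I -> Y -> R) (dep : I -> {set (I + I)%type}) (b : R) (c0 : nat) :
  0 <= b ->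
  (forall i, growth 0 (g i)) -> (forall i y, `|g i y| <= b) -> (forall i, depends (g i) (dep i)) ->
  (forall i, mean Q (g i) = 0) ->
  (forall i, P i -> (#|[set j | P j && ~~ [disjoint dep i & dep j]%B]%SET| <= c0)%N) ->
  mean Q (fun y => (\sum_(i | P i) g i y) ^+ 2) <= #|P|%:R * c0%:R * b ^+ 2.
Proof.
move=> b0 gg gb gd g0 hc.
have g2 i j : growth 0 (fun y => g i y * g j y) by exact: (growthM (gg i) (gg j)).
have i2 i j := growth_int (leq0n 4) (g2 i j).
rewrite (_ : (fun _ => _) = fun y => \sum_(i | P i) \sum_(j | P j) g i y * g j y); last first.
  apply/funext => y; rewrite expr2 big_distrl /=; apply: eq_bigr => i _.
  by rewrite big_distrr.
rewrite mean_sum; last by move=> i; apply: rintegrable_sum.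
rewrite -mulrA -sum1_card natr_sum mulr_suml.
apply: ler_sum => i Pi; rewrite mean_sum // mul1r.
rewrite (bigID (fun j => ~~ [disjoint dep i & dep j]%B)) /= [X in _ + X]big1 ?addr0; last first.
  move=> j /andP[_]; rewrite negbK => dis.
  rewrite (mean_indep Qmu (S := dep i)) ?g0 ?mul0r //; try exact: (growth_int (leq0n 4) (gg _)).
  move=> y z h; apply: gd => k kT; apply: h; rewrite inE.
  by apply/negP => ki; move: dis; rewrite disjoint_sym finset.disjoints_subset => /fintype.subsetP/(_ k kT); rewrite inE ki.
apply: (@le_trans _ _ (\sum_(j | P j && ~~ [disjoint dep i & dep j]%B) b ^+ 2)).
  apply: ler_sum => j _; rewrite -[leRHS](mean_cst Q); apply: mean_le => //; first exact: rintegrable_cst.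
  by move=> y; rewrite (le_trans (ler_norm _)) // normrM expr2 ler_pM.
rewrite sumr_const -[leLHS]mulr_natl ler_wpM2r ?exprn_ge0 // ler_nat.
apply: leq_trans (hc i Pi); rewrite leq_eqVlt; apply/orP; left; apply/eqP.
by apply: eq_card => j; rewrite [RHS]finset.in_set.
Qed.

Variable F : weights (R:=R) I -> R.
Hypothesis mF : measurable_fun setT F.
Hypothesis F_lip : forall (y z : weights (R:=R) I), `|F y - F z| <= \sum_i `|y i - z i|.

Definition F_at S y := F (hybrid S y).

Lemma growth_F_at S : growth 1 (F_at S).
Proof.
have [_ [C hC]] := growth_lip mF F_lip.
split; first by apply: (measurableT_comp mF); exact: measurable_hybrid.
exists `|C| => y; apply: (le_trans (hC _)).
apply: (@le_trans _ _ (`|C| * envelope (hybrid S y) ^+ 1)).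
  by rewrite ler_wpM2r ?ler_norm // exprn_ge0 // envelope_ge0.
rewrite ler_wpM2l // !expr1.
case: (envelope_case (hybrid S y)) => [->|[i ->]]; first exact: envelope_ge1.
by rewrite /hybrid; case: ifP => _; exact: coord_le_envelope.
Qed.

Lemma lip_F_at S i y : `|F_at S y - F_at (i |: S)%SET y| <= gap i y.
Proof.
apply: (le_trans (F_lip _ _)); rewrite (bigD1 i) //= big1 ?addr0 /hybrid.
  rewrite !inE eqxx /= /gap; case: ifP => // _.
  by rewrite subrr normr0.
by move=> j ji; rewrite !inE (negbTE ji) /= subrr normr0.
Qed.

(** The items preceding i in a fixed enumeration: resampling them one after the
other leads from the configuration to its independent copy. *)
Definition before i : {set I} := [set j | (enum_rank j < enum_rank i)%N]%SET.
Definition incrF S i y := F_at S y - F_at (i |: S)%SET y.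

Lemma notin_before i : i \notin before i.
Proof. by rewrite inE ltnn. Qed.

Lemma telescope y : \sum_i incrF (before i) i y = F_at finset.set0 y - F_at [set: I]%SET y.
Proof.
pose Sn n : {set I} := [set j | (enum_rank j < n)%N]%SET.
rewrite (reindex (fun k : 'I_#|I| => enum_val k)) /=; last first.
  by exists enum_rank => k _; [exact: enum_valK|exact: enum_rankK].
under eq_bigr => k _.
  have E1 : before (enum_val k) = Sn k by apply/setP => j; rewrite !inE enum_valK.
  have E2 : (enum_val k |: before (enum_val k))%SET = Sn k.+1.
    apply/setP => j; rewrite !inE enum_valK [RHS]ltnS [RHS]leq_eqVlt; congr (_ || _).
    by rewrite -(inj_eq enum_rank_inj) enum_valK.
  rewrite /incrF E2 E1; over.
rewrite /= -(big_mkord xpredT (fun k => F_at (Sn k) y - F_at (Sn k.+1) y)).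
under eq_bigr do rewrite -opprB.
rewrite sumrN telescope_sumr // opprB; congr (F_at _ _ - F_at _ _).
by apply/setP => j; rewrite !inE ltn_ord.
Qed.

Definition F_mean := mean Q (F_at finset.set0).

Lemma F_at_dep S : depends (F_at S) [set j | match j with inl i => i \notin S | inr i => i \in S end]%SET.
Proof.
move=> y z h; rewrite /F_at; congr F; apply/funext => i; rewrite /hybrid.
by case: ifP => iS; apply: h; rewrite inE iS.
Qed.

Lemma mean_F_at_setT : mean Q (F_at [set: I]%SET) = F_mean.
Proof.
pose s (j : I + I) : I + I := match j with inl k => inr k | inr k => inl k end.
have sK : involutive s by case.
have [] := @mean_perm _ _ Q (doubled lam) Qmu s (F_at [set: I]%SET) sK _ (growth_int _ (growth_F_at _)) => //; first by case.
move=> _ <-; rewrite /F_mean; congr mean; apply/funext => y; rewrite /F_at; congr F; apply/funext => i.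
by rewrite /hybrid !inE.
Qed.

(** The centring F_mean may be replaced by the value of F at the fully resampled
configuration, which is independent of F. The difference telescopes along the
resampling path. Exchanging item i with its copy reverses the sign of the i-th
increment and turns F into F with i resampled; averaging the two expressions
yields the factor 1/2. *)
Lemma stein_id (h : R -> R) : (forall S, growth 1 (fun y => h (F_at S y))) ->
  mean Q (fun y => (F_at finset.set0 y - F_mean) * h (F_at finset.set0 y)) =
  2^-1 * \sum_i mean Q (fun y => (h (F_at finset.set0 y) - h (F_at [set i]%SET y)) * incrF (before i) i y).
Proof.
move=> gh.
have gdif S i : growth 1 (incrF S i) by apply: growthB; exact: growth_F_at.
have g2 a b := growth_int (isT : (1 + 1 <= 4)%N) (growthM a b).
have I0 S S' := g2 _ _ (growth_F_at S) (gh S').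
have Id S S' i := g2 _ _ (gh S') (gdif S i).
have IF S := growth_int (isT : (1 <= 4)%N) (growth_F_at S).
have Ih S := growth_int (isT : (1 <= 4)%N) (gh S).
have E1 : mean Q (fun y => F_at [set: I]%SET y * h (F_at finset.set0 y)) = F_mean * mean Q (fun y => h (F_at finset.set0 y)).
  rewrite -mean_F_at_setT; apply: (mean_indep Qmu (S := [set j | match j with inl i => i \notin [set: I]%SET | inr i => i \in [set: I]%SET end]%SET)) => //.
    exact: F_at_dep.
    move=> y z hyz; congr h; apply: F_at_dep => j jI; apply: hyz; move: jI; rewrite !inE.
    by case: j => j; rewrite !inE.
  exact: Ih.
transitivity (mean Q (fun y => \sum_i h (F_at finset.set0 y) * incrF (before i) i y)).
  transitivity (mean Q (fun y => F_at finset.set0 y * h (F_at finset.set0 y) - F_at [set: I]%SET y * h (F_at finset.set0 y))).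
    rewrite meanB // E1 -meanZ // -meanB //; last exact: rintegrableZ.
    by congr mean; apply/funext => y; rewrite mulrBl.
  by congr mean; apply/funext => y; rewrite -mulrBl -telescope mulrC big_distrr.
rewrite mean_sum //; rewrite big_distrr /=; apply: eq_bigr => i _.
have [I1 E2] := mean_exch i (Id (before i) finset.set0 i).
have E3 : (fun y => h (F_at finset.set0 (fun j => y (exch i j))) * incrF (before i) i (fun j => y (exch i j))) =
          (fun y => - 1 * (h (F_at [set i]%SET y) * incrF (before i) i y)).
  apply/funext => y; rewrite /incrF /F_at hybrid_exch_in ?inE // finset.setU0.
  by rewrite hybrid_exch_in ?notin_before // hybrid_exch_out ?notin_before //; ring.
rewrite E3 in E2; rewrite meanZ // in E2.
under [X in _ = 2^-1 * mean _ X]eq_fun do rewrite mulrBl.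
rewrite meanB //; lra.
Qed.

Definition F_var := mean Q (fun y => (F_at finset.set0 y - F_mean) ^+ 2).
(** The quantity whose mean is the variance and whose fluctuations control the
distance to the Gaussian law (Chatterjee's form of Stein's method). *)
Definition stein_T y := 2^-1 * \sum_i incrF finset.set0 i y * incrF (before i) i y.

Lemma growth_incrF S i : growth 1 (incrF S i).
Proof. by apply: growthB; exact: growth_F_at. Qed.

Lemma growth_incrF2 i : growth 2 (fun y => incrF finset.set0 i y * incrF (before i) i y).
Proof. exact: (growthM (growth_incrF _ _) (growth_incrF _ _)). Qed.

Lemma growth_stein_T : growth 2 stein_T.
Proof. by apply: growthZ; apply: growth_sum => i; exact: growth_incrF2. Qed.

(** The identity above, applied to a linear function. *)
Lemma mean_stein_T : mean Q stein_T = F_var.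
Proof.
have gh S : growth 1 (fun y => F_at S y - F_mean).
  by apply: growthB; [exact: growth_F_at|apply: (@growth_le _ _ 0 1) => //; exact: growth_cst].
have := @stein_id (fun x => x - F_mean) gh.
rewrite /F_var (_ : (fun y => _ ^+ 2) = fun y => (F_at finset.set0 y - F_mean) * (F_at finset.set0 y - F_mean)); last first.
  by apply/funext => y; rewrite expr2.
move=> ->.
have Id i := growth_int (isT : (2 <= 4)%N) (growth_incrF2 i).
rewrite /stein_T meanZ; last exact: rintegrable_sum.
rewrite mean_sum //; congr (_ * _); apply: eq_bigr => i _; congr mean; apply/funext => y.
by rewrite /incrF finset.setU0; congr (_ * _); ring.
Qed.

Section stein_bound.
Variables (f k : R -> R) (C : R).
Hypothesis C0 : 0 <= C.
Hypothesis mf : measurable_fun setT f.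
Hypothesis mk : measurable_fun setT k.
Hypothesis fkC : forall x, `|f x| <= C /\ `|k x| <= C.
Hypothesis taylor : forall (x y : R), `|f y - f x - k x * (y - x)| <= C * (y - x) ^+ 2.
Variable s : R.
Hypothesis s0 : 0 < s.
Hypothesis sV : s ^+ 2 = F_var.

Definition F_std S y := (F_at S y - F_mean) / s.

Lemma growth_F_std S : growth 1 (F_std S).
Proof.
rewrite (_ : F_std S = fun y => s^-1 * (F_at S y - F_mean)); last by apply/funext => y; rewrite /F_std mulrC.
by apply: growthZ; apply: growthB; [exact: growth_F_at|apply: (@growth_le _ _ 0 1) => //; exact: growth_cst].
Qed.

Lemma growth_f_std S : growth 0 (fun y => f (F_std S y)).
Proof.
apply: (@growth_bd _ _ _ C); last by move=> y; have [] := fkC (F_std S y).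
by apply: (measurableT_comp mf); have [] := growth_F_std S.
Qed.

Lemma growth_k_std S : growth 0 (fun y => k (F_std S y)).
Proof.
apply: (@growth_bd _ _ _ C); last by move=> y; have [] := fkC (F_std S y).
by apply: (measurableT_comp mk); have [] := growth_F_std S.
Qed.

(** A first order expansion of f in the resampling identity replaces the increment
of f by k times the increment of F, producing k T / Var. The first error term
comes from replacing T by its mean, the second from the quadratic remainder. *)
Lemma stein_bound :
  `|mean Q (fun y => k (F_std finset.set0 y) - F_std finset.set0 y * f (F_std finset.set0 y))| <=
  C * (mean Q (fun y => `|stein_T y - F_var|) / F_var + (\sum_i mean Q (fun y => gap i y ^+ 3)) / (2 * s ^+ 3)).
Proof.
have sn0 : s != 0 by rewrite gt_eqF.
have V0 : 0 < F_var by rewrite -sV exprn_gt0.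
pose h x := f ((x - F_mean) / s).
have gh S : growth 1 (fun y => h (F_at S y)) by apply: (@growth_le _ _ 0 1) => //; exact: growth_f_std.
have SI := stein_id gh.
pose W0 := F_std finset.set0; pose Wi i := F_std [set i]%SET.
have gWf : growth 1 (fun y => W0 y * f (W0 y)) by exact: (growthM (growth_F_std _) (growth_f_std _)).
have gkT : growth 2 (fun y => k (W0 y) * stein_T y) by exact: (growthM (growth_k_std _) growth_stein_T).
have gfi i : growth 1 (fun y => (f (W0 y) - f (Wi i y)) * incrF (before i) i y).
  by apply: (growthM (growthB (growth_f_std _) (growth_f_std _)) (growth_incrF _ _)).
have gki i : growth 2 (fun y => k (W0 y) * (W0 y - Wi i y) * incrF (before i) i y).
  by apply: (growthM (growthM (growth_k_std _) (growthB (growth_F_std _) (growth_F_std _))) (growth_incrF _ _)).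
have gF0 : growth 1 (fun y => F_at finset.set0 y - F_mean).
  by apply: growthB; [exact: growth_F_at|apply: (@growth_le _ _ 0 1) => //; exact: growth_cst].
have gFh : growth 1 (fun y => (F_at finset.set0 y - F_mean) * h (F_at finset.set0 y)).
  exact: (growthM gF0 (growth_f_std finset.set0)).
have S1 : mean Q (fun y => W0 y * f (W0 y)) = s^-1 * 2^-1 * \sum_i mean Q (fun y => (f (W0 y) - f (Wi i y)) * incrF (before i) i y).
  rewrite -mulrA -SI -meanZ; last exact: (growth_int _ gFh).
  by congr mean; apply/funext => y; rewrite /W0 /F_std /h; ring.
have S2 : mean Q (fun y => k (W0 y) * stein_T y) / F_var = s^-1 * 2^-1 * \sum_i mean Q (fun y => k (W0 y) * (W0 y - Wi i y) * incrF (before i) i y).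
  rewrite -(mean_sum (Q:=Q) (index_enum I) xpredT); last by move=> i; exact: (growth_int _ (gki i)).
  rewrite -meanZ; last by apply: rintegrable_sum => i; exact: (growth_int _ (gki i)).
  rewrite mulrC -meanZ; last exact: (growth_int _ gkT).
  congr mean; apply/funext => y; rewrite /stein_T -sV mulrA [X in _ = X]mulrC big_distrl /=.
  rewrite -[LHS]mulrA ?big_distrr /= ?big_distrr /=; apply: eq_bigr => i _.
  rewrite /W0 /Wi /F_std /incrF finset.setU0; field.
  exact: sn0.
have B2 : `|mean Q (fun y => W0 y * f (W0 y)) - mean Q (fun y => k (W0 y) * stein_T y) / F_var| <=
    C * ((\sum_i mean Q (fun y => gap i y ^+ 3)) / (2 * s ^+ 3)).
  rewrite S1 S2 -mulrBr -sumrB normrM ger0_norm; last by rewrite mulr_ge0 // invr_ge0 // ltW.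
  have -> : C * ((\sum_i mean Q (fun y => gap i y ^+ 3)) / (2 * s ^+ 3)) =
     s^-1 * 2^-1 * \sum_i C / s ^+ 2 * mean Q (fun y => gap i y ^+ 3).
    by rewrite -big_distrr /=; field.
  rewrite ler_wpM2l ?mulr_ge0 ?invr_ge0 ?(ltW s0) //.
  apply: (le_trans (ler_norm_sum _ _ _)); apply: ler_sum => i _.
  rewrite -meanB; [|exact: (growth_int _ (gfi i))|exact: (growth_int _ (gki i))].
  have gB := growthB (@growth_le _ _ 1 2 _ isT (gfi i)) (gki i).
  rewrite -meanZ; last exact: (growth_int _ (growth_gapX i 3)).
  apply: (le_trans (mean_abs (growth_int _ gB))) => //; apply: mean_le.
  - exact: (growth_int _ (growth_abs gB)).
  - exact: (growth_int _ (growthZ _ (growth_gapX i 3))).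
  move=> y; rewrite -mulrBl normrM [gap i y ^+ 3]exprSr mulrA; apply: ler_pM => //; last exact: lip_F_at.
  have -> : f (W0 y) - f (Wi i y) - k (W0 y) * (W0 y - Wi i y) = - (f (Wi i y) - f (W0 y) - k (W0 y) * (Wi i y - W0 y)) by ring.
  rewrite normrN (le_trans (taylor _ _)) // -mulrA ler_wpM2l //.
  have -> : Wi i y - W0 y = (F_at [set i]%SET y - F_at finset.set0 y) / s by rewrite /W0 /Wi /F_std; field.
  rewrite exprMn exprVn mulrC ler_wpM2l ?invr_ge0 ?exprn_ge0 ?(ltW s0) //.
  have := lip_F_at finset.set0 i y; rewrite finset.setU0 => hl.
  rewrite -[leLHS]ger0_norm ?sqr_ge0 // normrX lerXn2r ?nnegrE // ?normr_ge0 //.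
  by rewrite distrC.
have B1 : `|mean Q (fun y => k (W0 y)) - mean Q (fun y => k (W0 y) * stein_T y) / F_var| <=
    C * (mean Q (fun y => `|stein_T y - F_var|) / F_var).
  have gTV : growth 2 (fun y => stein_T y - F_var) by apply: growthB; [exact: growth_stein_T|apply: (@growth_le _ _ 0 2) => //; exact: growth_cst].
  have -> : mean Q (fun y => k (W0 y)) - mean Q (fun y => k (W0 y) * stein_T y) / F_var =
     (- F_var^-1) * mean Q (fun y => k (W0 y) * (stein_T y - F_var)).
    under [X in _ = _ * mean _ X]eq_fun do rewrite mulrBr.
    under [X in _ = _ * mean _ X]eq_fun do rewrite [_ * F_var]mulrC.
    rewrite meanB; [|exact: (growth_int _ gkT)|exact: (growth_int _ (growthZ F_var (growth_k_std _)))].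
    rewrite meanZ; last exact: (growth_int _ (growth_k_std _)).
    by field; rewrite gt_eqF.
  have -> : C * (mean Q (fun y => `|stein_T y - F_var|) / F_var) = F_var^-1 * (C * mean Q (fun y => `|stein_T y - F_var|)).
    by rewrite mulrA mulrC.
  have Vi : 0 <= F_var^-1 by rewrite invr_ge0 ltW.
  rewrite normrM normrN (ger0_norm Vi); apply: ler_wpM2l => //.
  have gp := growthM (growth_k_std finset.set0) gTV.
  rewrite -meanZ; last exact: (growth_int _ (growth_abs gTV)).
  apply: (le_trans (mean_abs (growth_int _ gp))) => //; apply: mean_le.
  - exact: (growth_int _ (growth_abs gp)).
  - exact: (growth_int _ (growthZ _ (growth_abs gTV))).
  by move=> y; rewrite normrM ler_wpM2r //; have [] := fkC (F_std finset.set0 y).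
rewrite meanB; [|exact: (growth_int _ (growth_k_std _))|exact: (growth_int _ gWf)].
rewrite mulrDr -/W0; move: B1 B2; rewrite !ler_norml => /andP[? ?] /andP[? ?].
by apply/andP; split; lra.
Qed.

End stein_bound.

(** The terms of T are replaced by bounded local variables tau, at the price eta
per term. The sum of the centred tau has a variance of the order of the number
of items, because only boundedly many supports meet a given one; the last two
terms are the inequality |z| <= z^2 / (2 a) + a, in which a is free. *)
Lemma stein_T_concentration (tau : I -> Y -> R) (Td : I -> {set (I + I)%type}) (B eta a : R) (c0 : nat) :
  0 <= B -> 0 < a ->
  (forall i, growth 0 (tau i)) -> (forall i y, `|tau i y| <= B) -> (forall i, depends (tau i) (Td i)) ->
  (forall i, (#|[set j | ~~ [disjoint Td i & Td j]%B]%SET| <= c0)%N) ->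
  (forall i, mean Q (fun y => `|incrF finset.set0 i y * incrF (before i) i y - tau i y|) <= eta) ->
  mean Q (fun y => `|stein_T y - F_var|) <= #|I|%:R * eta + #|I|%:R * c0%:R * B ^+ 2 / a + a.
Proof.
move=> B0 a0 gt bt dt ct et.
pose t i := mean Q (tau i).
have It i := growth_int (leq0n 4) (gt i).
have tB i : `|t i| <= B.
  apply: (le_trans (mean_abs (It i))); rewrite -[leRHS](mean_cst Q); apply: mean_le.
  - exact: (growth_int _ (growth_abs (gt i))).
  - exact: rintegrable_cst.
  - exact: bt.
pose g i y := tau i y - t i.
have gg i : growth 0 (g i) by apply: growthB => //; exact: growth_cst.
have gb i y : `|g i y| <= 2 * B.
  by rewrite /g (le_trans (ler_normB _ _)) //; have := bt i y; have := tB i; lra.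
have vs : mean Q (fun y => (\sum_i g i y) ^+ 2) <= #|I|%:R * c0%:R * (2 * B) ^+ 2.
  apply: (var_sum (dep := Td)) => //.
  - exact: mulr_ge0.
  - by move=> i y z h; rewrite /g (dt i y z h).
  - by move=> i; rewrite /g meanB ?mean_cst ?subrr //; exact: rintegrable_cst.
  - by move=> i _; exact: ct.
have Id i := growth_int (isT : (2 <= 4)%N) (growth_incrF2 i).
have gdt i : growth 2 (fun y => incrF finset.set0 i y * incrF (before i) i y - tau i y).
  by apply: growthB; [exact: growth_incrF2|exact: (@growth_le _ _ 0 2)].
have gE i : growth 2 (fun y => `|incrF finset.set0 i y * incrF (before i) i y - tau i y|) by exact: growth_abs.
pose r i := mean Q (fun y => incrF finset.set0 i y * incrF (before i) i y - tau i y).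
have rE i : `|r i| <= eta by apply: le_trans (et i); apply: mean_abs; exact: (growth_int _ (gdt i)).
have EV : F_var = 2^-1 * \sum_i (r i + t i).
  rewrite -mean_stein_T /stein_T meanZ; last exact: rintegrable_sum.
  rewrite mean_sum //; congr (_ * _); apply: eq_bigr => i _.
  by rewrite /r meanB // subrK.
have ptw y : `|stein_T y - F_var| <= 2^-1 * (\sum_i (`|incrF finset.set0 i y * incrF (before i) i y - tau i y| + eta)) +
    ((4 * a)^-1 * (\sum_i g i y) ^+ 2 + 2^-1 * a).
  have -> : stein_T y - F_var = 2^-1 * (\sum_i (incrF finset.set0 i y * incrF (before i) i y - tau i y - r i)) + 2^-1 * \sum_i g i y.
    rewrite EV /stein_T -mulrBr -mulrDr -sumrB -big_split /=; congr (_ * _); apply: eq_bigr => i _.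
    by rewrite /g; ring.
  rewrite (le_trans (ler_normD _ _)) // !normrM !(@ger0_norm _ 2^-1) ?invr_ge0 //; apply: lerD.
    rewrite ler_wpM2l ?invr_ge0 //; apply: (le_trans (ler_norm_sum _ _ _)); apply: ler_sum => i _.
    by rewrite (le_trans (ler_normB _ _)) // lerD2l.
  move: (\sum_i g i y) => z.
  have h : `|z| <= z ^+ 2 / (2 * a) + a.
    rewrite -[z ^+ 2]ger0_norm ?sqr_ge0 // normrX.
    move: `|z| (normr_ge0 z) => w w0.
    rewrite -lerBlDr ler_pdivlMr ?mulr_gt0 //; have := sqr_ge0 (w - a); nra.
  have -> : (4 * a)^-1 * z ^+ 2 + 2^-1 * a = 2^-1 * (z ^+ 2 / (2 * a) + a) by field; rewrite gt_eqF.
  by rewrite ler_wpM2l ?invr_ge0.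
have gs : growth 2 (fun y => \sum_i (`|incrF finset.set0 i y * incrF (before i) i y - tau i y| + eta)).
  apply: growth_sum => i; apply: growthD; first exact: gE.
  by apply: (@growth_le _ _ 0 2) => //; exact: growth_cst.
have gq : growth 0 (fun y => (\sum_i g i y) ^+ 2).
  rewrite (_ : (fun _ => _) = fun y => (\sum_i g i y) * (\sum_i g i y)); last by apply/funext => y; rewrite expr2.
  by apply: (@growthM _ _ 0 0); apply: growth_sum.
have gq2 : growth 0 (fun y => (4 * a)^-1 * (\sum_i g i y) ^+ 2 + 2^-1 * a).
  by apply: growthD; [exact: growthZ|exact: growth_cst].
have gTV : growth 2 (fun y => `|stein_T y - F_var|).
  by apply: growth_abs; apply: growthB; [exact: growth_stein_T|apply: (@growth_le _ _ 0 2) => //; exact: growth_cst].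
have gR := growthD (growthZ 2^-1 gs) (@growth_le _ _ 0 2 _ isT gq2).
have ITV := growth_int (isT : (2 <= 4)%N) gTV; have IR := growth_int (isT : (2 <= 4)%N) gR.
apply: (le_trans (mean_le ITV IR ptw)).
rewrite meanD; [|exact: (growth_int _ (growthZ 2^-1 gs))|exact: (growth_int _ gq2)].
rewrite meanD; [|exact: (growth_int _ (growthZ _ gq))|exact: rintegrable_cst].
rewrite meanZ ?mean_cst; last exact: (growth_int _ gs).
rewrite meanZ; last exact: (growth_int _ gq).
have IE i : rintegrable Q (fun y => `|incrF finset.set0 i y * incrF (before i) i y - tau i y| + eta).
  by apply: rintegrableD; [exact: (growth_int _ (gE i))|exact: rintegrable_cst].
rewrite (mean_sum _ _ IE).
rewrite -addrA; apply: lerD.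
  have -> : #|I|%:R * eta = 2^-1 * \sum_(i : I) (eta + eta).
    by rewrite sumr_const -[X in _ = _ * X]mulr_natl; field.
  rewrite ler_wpM2l ?invr_ge0 //; apply: ler_sum => i _.
  rewrite meanD ?mean_cst; [|exact: (growth_int _ (gE i))|exact: rintegrable_cst].
  by rewrite lerD2r.
apply: lerD; last by have := a0; lra.
have -> : #|I|%:R * c0%:R * B ^+ 2 / a = (4 * a)^-1 * (#|I|%:R * c0%:R * (2 * B) ^+ 2).
  by field; rewrite gt_eqF.
by rewrite ler_wpM2l // invr_ge0 mulr_ge0 // ltW.
Qed.

(** A Bessel inequality. The hypothesis says that the covariance of F with the
bounded variable psi of weight i is at least c, for every i in Es. These
variables are independent with variance at most 1, and the bound follows from
the nonnegativity of the second moment of F - F_mean - c times their centred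
sum. *)
Lemma variance_ge_covariance (Es : {set I}) (psi : R -> R) (c : R) :
  0 <= c -> measurable_fun setT psi -> (forall t, 0 <= psi t <= 1) ->
  (forall i, i \in Es -> 2 * c <= mean Q (fun y => incrF finset.set0 i y * (psi (y (inl i)) - psi (y (inr i))))) ->
  #|Es|%:R * c ^+ 2 <= F_var.
Proof.
move=> c0 mpsi psi01 hc.
have gpsi j : growth 0 (fun y : Y => psi (y j)).
  apply: (@growth_bd _ _ _ 1); first by apply: (measurableT_comp mpsi); exact: measurable_coord.
  by move=> y; have /andP[p0 p1] := psi01 (y j); rewrite ger0_norm.
have Ip j := growth_int (leq0n 4) (gpsi j).
have gFp S j : growth 1 (fun y => F_at S y * psi (y j)) by exact: (growthM (growth_F_at S) (gpsi j)).
have IFp S j := growth_int (isT : (1 <= 4)%N) (gFp S j).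
have IF S := growth_int (isT : (1 <= 4)%N) (growth_F_at S).
pose e i := mean Q (fun y => psi (y (inl i))).
have e01 i : 0 <= e i <= 1.
  apply/andP; split; first by apply: mean_ge0 => y; have /andP[] := psi01 (y (inl i)).
  rewrite -[leRHS](mean_cst Q); apply: mean_le => //; first exact: rintegrable_cst.
  by move=> y; have /andP[] := psi01 (y (inl i)).
have eR i : mean Q (fun y => psi (y (inr i))) = e i.
  have [_ <-] := mean_exch i (Ip (inr i)).
  by rewrite /e; congr mean; apply/funext => y; rewrite /= eqxx.
have mS i : mean Q (F_at [set i]%SET) = F_mean.
  have [_ <-] := mean_exch i (IF [set i]%SET); rewrite /F_mean; congr mean; apply/funext => y.
  by rewrite /F_at -[X in hybrid X _]finset.setU0 hybrid_exch_out // inE.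
pose g i y := psi (y (inl i)) - e i.
have gg i : growth 0 (g i) by apply: growthB => //; exact: growth_cst.
have cov i : i \in Es -> c <= mean Q (fun y => (F_at finset.set0 y - F_mean) * g i y).
  move=> iE; have := hc i iE.
  have -> : (fun y => incrF finset.set0 i y * (psi (y (inl i)) - psi (y (inr i)))) =
     (fun y => (F_at finset.set0 y * psi (y (inl i)) - F_at finset.set0 y * psi (y (inr i))) -
               (F_at [set i]%SET y * psi (y (inl i)) - F_at [set i]%SET y * psi (y (inr i)))).
    by apply/funext => y; rewrite /incrF finset.setU0; ring.
  have gD S : growth 1 (fun y => F_at S y * psi (y (inl i)) - F_at S y * psi (y (inr i))) by apply: growthB.
  rewrite meanB; [|exact: (growth_int _ (gD _))|exact: (growth_int _ (gD _))].
  rewrite meanB // meanB //.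
  have -> : mean Q (fun y => F_at finset.set0 y * psi (y (inr i))) = F_mean * e i.
    rewrite -eR; apply: (mean_indep Qmu (S := (~: [set inr i])%SET)) => //.
      move=> y z h; apply: F_at_dep => -[j|j]; rewrite !inE // => _; by apply: h; rewrite !inE.
    by move=> y z h; rewrite h // !inE eqxx.
  have -> : mean Q (fun y => F_at [set i]%SET y * psi (y (inl i))) = F_mean * e i.
    rewrite -(mS i); apply: (mean_indep Qmu (S := (~: [set inl i])%SET)) => //.
      move=> y z h; apply: F_at_dep => -[j|j]; rewrite !inE // => ji; apply: h; rewrite !inE //.
    by move=> y z h; rewrite h // !inE eqxx.
  have -> : mean Q (fun y => F_at [set i]%SET y * psi (y (inr i))) = mean Q (fun y => F_at finset.set0 y * psi (y (inl i))).
    have [_ <-] := mean_exch i (IFp [set i]%SET (inr i)); congr mean; apply/funext => y.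
    by rewrite /F_at -[X in hybrid X _]finset.setU0 hybrid_exch_out ?inE //= eqxx.
  have -> : mean Q (fun y => (F_at finset.set0 y - F_mean) * g i y) =
     mean Q (fun y => F_at finset.set0 y * psi (y (inl i))) - F_mean * e i.
    have -> : (fun y => (F_at finset.set0 y - F_mean) * g i y) = (fun y => (F_at finset.set0 y * psi (y (inl i)) -
        e i * F_at finset.set0 y) - F_mean * g i y).
      by apply/funext => y; rewrite /g; ring.
    have gZ : growth 1 (fun y => e i * F_at finset.set0 y) by apply: growthZ; exact: growth_F_at.
    rewrite meanB; [|exact: (growth_int _ (growthB (gFp _ _) gZ))|exact: (growth_int _ (growthZ _ (gg i)))].
    rewrite meanB //; last exact: (growth_int _ gZ).
    rewrite meanZ // meanZ; last exact: (growth_int _ (gg i)).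
    rewrite /g meanB ?mean_cst //; last exact: rintegrable_cst.
    by rewrite -/(e i) -/F_mean; ring.
  by lra.
pose Sg y := \sum_(i in Es) g i y.
have gS : growth 0 Sg by apply: growth_sum.
have vS : mean Q (fun y => Sg y ^+ 2) <= #|Es|%:R.
  have := @var_sum (mem Es) g (fun i => [set inl i]%SET) 1 1 ler01 gg _ _ _ _.
  rewrite expr1n !mulr1; apply.
  - move=> i y; rewrite /g; have /andP[? ?] := psi01 (y (inl i)); have /andP[? ?] := e01 i.
    by rewrite ler_norml; apply/andP; split; lra.
  - by move=> i y z h; rewrite /g h // inE.
  - by move=> i; rewrite /g meanB ?mean_cst ?subrr //; exact: rintegrable_cst.
  - move=> i _; rewrite (leq_trans (fintype.subset_leq_card (_ : _ \subset [set i]%SET))) ?cards1 //.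
    apply/fintype.subsetP => j; rewrite !inE => /andP[_].
    by apply: contraR => ji; rewrite disjoints1 inE; apply: contraNneq ji => -[->].
have gF0 : growth 1 (fun y => F_at finset.set0 y - F_mean).
  by apply: growthB; [exact: growth_F_at|apply: (@growth_le _ _ 0 1) => //; exact: growth_cst].
have gFS : growth 1 (fun y => (F_at finset.set0 y - F_mean) * Sg y) by exact: (growthM gF0 gS).
have gSS : growth 0 (fun y => Sg y ^+ 2).
  rewrite (_ : (fun _ => _) = fun y => Sg y * Sg y); last by apply/funext => y; rewrite expr2.
  exact: (growthM gS gS).
have gFF : growth 2 (fun y => (F_at finset.set0 y - F_mean) ^+ 2).
  rewrite (_ : (fun _ => _) = fun y => (F_at finset.set0 y - F_mean) * (F_at finset.set0 y - F_mean)); last by apply/funext => y; rewrite expr2.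
  exact: (growthM gF0 gF0).
have cS : #|Es|%:R * c <= mean Q (fun y => (F_at finset.set0 y - F_mean) * Sg y).
  have -> : (fun y => (F_at finset.set0 y - F_mean) * Sg y) = (fun y => \sum_(i in Es) (F_at finset.set0 y - F_mean) * g i y).
    by apply/funext => y; rewrite /Sg big_distrr.
  rewrite mean_sum; last by move=> i; exact: (growth_int _ (growthM gF0 (gg i))).
  rewrite mulr_natl -sumr_const; exact: ler_sum.
have : 0 <= mean Q (fun y => ((F_at finset.set0 y - F_mean) ^+ 2 - (2 * c) * ((F_at finset.set0 y - F_mean) * Sg y)) + c ^+ 2 * Sg y ^+ 2).
  apply: mean_ge0 => y; have := sqr_ge0 ((F_at finset.set0 y - F_mean) - c * Sg y).
  by rewrite (_ : (_ - c * Sg y) ^+ 2 = (F_at finset.set0 y - F_mean) ^+ 2 - (2 * c) * ((F_at finset.set0 y - F_mean) * Sg y) + c ^+ 2 * Sg y ^+ 2) //; ring.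
have gFS2 := growthZ (2 * c) gFS.
rewrite meanD; [|exact: (growth_int _ (growthB gFF (@growth_le _ _ 1 2 _ isT gFS2)))|exact: (growth_int _ (growthZ _ gSS))].
rewrite meanB; [|exact: (growth_int _ gFF)|exact: (growth_int _ gFS2)].
rewrite meanZ; last exact: (growth_int _ gFS).
rewrite meanZ; last exact: (growth_int _ gSS).
rewrite -/F_var => h.
have h1 := ler_wpM2l (sqr_ge0 c) vS.
have h2 := ler_wpM2l (mulr_ge0 (ler0n _ 2) c0) cS.
nra.
Qed.

End exchange.

(** * The effect of one edge weight *)
Section clip.
Context {R : realType}.
Implicit Types (A t u : R).

Definition clip A t : R := Num.max (- A) (Num.min A t).

Lemma clip_bd A t : 0 <= A -> `|clip A t| <= A.
Proof.
move=> A0; rewrite /clip ler_norml; apply/andP; split; first by rewrite le_max lexx.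
by rewrite ge_max ge_min lexx andbT; lra.
Qed.

Lemma clip_id A t : `|t| <= A -> clip A t = t.
Proof.
rewrite ler_norml => /andP[h1 h2]; rewrite /clip.
by rewrite (min_idPr h2) (max_idPr h1).
Qed.

Lemma clip_lip A t u : 0 <= A -> `|clip A t - clip A u| <= `|t - u|.
Proof.
move=> A0; rewrite /clip /Num.max /Num.min.
case: (ltP A t) => h1; case: (ltP A u) => h2; repeat (case: ifP => ?);
 rewrite ?subrr ?normr0 //; do ![case: ger0P => ?]; lra.
Qed.

Lemma measurable_clip A : measurable_fun setT (clip A).
Proof. by apply: measurable_maxr => //; exact: measurable_minr. Qed.

End clip.

Section edge_lower.
Context {R : realType} (G : sgraph).
Notation I := (edge G + G)%type.
Implicit Types (y : I -> R) (e : edge G) (x z : G).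

(** The partition function is affine in the exponential of each edge weight, and
its slope is the partition function of the graph without the two ends. *)
Lemma Zsub_edge e : exists (a : (I -> R) -> R),
  (forall y y', (forall j, j != inl e -> y j = y' j) -> a y = a y') /\
  (forall y, 0 <= a y /\ Zsub [set: G]%SET y = a y + expR (y (inl e)) * Zsub (~: val e)%SET y).
Proof.
have [x xe] := edge_nonempty e.
exists (fun y => expR (y (inr x)) * Zsub ([set: G] :\ x)%SET y +
  \sum_(f | ((x \in (val f : {set G})) && ((val f : {set G}) \subset [set: G]%SET)) && (f != e))
     expR (y (inl f)) * Zsub ([set: G] :\: val f)%SET y); split.
  move=> y y' h; congr (_ + _).
    rewrite (h (inr x)) //; congr (_ * _); apply: Zsub_dep => j aj; apply: h.
    apply: contraTneq aj => -> /=; by rewrite finset.subsetD1 xe andbF.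
  apply: eq_bigr => f /andP[/andP[xf _] fe].
  rewrite h; last by apply: contraNneq fe => -[->].
  congr (_ * _); apply: Zsub_dep => j aj; apply: h.
  apply: contraTneq aj => -> /=; apply/negP => /fintype.subsetP/(_ x xe).
  by rewrite !inE xf.
move=> y; split.
  rewrite addr_ge0 ?mulr_ge0 ?expR_ge0 ?(ltW (Zsub_gt0 _ _)) // sumr_ge0 // => f _.
  by rewrite mulr_ge0 ?expR_ge0 ?(ltW (Zsub_gt0 _ _)).
rewrite (Zsub_rec y (finset.in_setT x)) (bigD1 e) /=; last by rewrite xe finset.subsetT.
by rewrite -(finset.setTD (val e)) addrA addrAC.
Qed.

Lemma lnZ_edge_mono e y y' : (forall j, j != inl e -> y j = y' j) -> y' (inl e) <= y (inl e) ->
  ln (Zsub [set: G]%SET y') <= ln (Zsub [set: G]%SET y).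
Proof.
move=> h le; rewrite ler_ln ?posrE ?Zsub_gt0 //.
have [a [ha aE]] := Zsub_edge e.
have [_ ->] := aE y; have [_ ->] := aE y'; rewrite (ha _ _ h) lerD2l.
rewrite (Zsub_dep (y' := y') (A := (~: val e)%SET)); last first.
  move=> j aj; apply: h; apply: contraTneq aj => -> /=.
  have [x xe] := edge_nonempty e.
  by apply/negP => /fintype.subsetP/(_ x xe); rewrite !inE xe.
by rewrite ler_wpM2r ?ler_expR // ltW // Zsub_gt0.
Qed.

Variables (D : nat) (hD : (max_degree G <= D)%N).

(** When the weights around the ends of e are bounded, the edge e carries a
non-negligible part of the partition function; raising its weight from below q
to above q' then increases the free energy by a positive constant that does not
depend on the graph. *)
Lemma lnZ_edge_gap (K q q' : R) e x y y' : (forall j, j != inl e -> y j = y' j) ->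
  x \in (val e : {set G}) -> good K x y -> good K (other e x) y ->
  q < q' -> q' <= y (inl e) -> y' (inl e) <= q ->
  ln (1 + (expR q' - expR q) / ((expR K * (1 + D%:R * expR (3 * K))) ^+ 2 + expR q)) <=
  ln (Zsub [set: G]%SET y) - ln (Zsub [set: G]%SET y').
Proof.
move=> h xe g1 g2 qq h1 h2.
set M := expR K * (1 + D%:R * expR (3 * K)).
have M0 : 0 <= M by rewrite mulr_ge0 ?expR_ge0 // addr_ge0 // mulr_ge0 ?expR_ge0.
have den : 0 < M ^+ 2 + expR q by rewrite ltr_wpDl ?expR_gt0 // exprn_ge0.
set rho := _ / _.
have r0 : 0 <= rho by rewrite divr_ge0 ?(ltW den) // subr_ge0 ler_expR ltW.
rewrite -ln_div ?posrE ?Zsub_gt0 // ler_ln ?posrE ?divr_gt0 ?Zsub_gt0 ?ltr_wpDr //.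
rewrite ler_pdivlMr ?Zsub_gt0 //.
have [a [ha aE]] := Zsub_edge e.
have eA : (val e : {set G}) = [set x; other e x]%SET by have [] := otherP xe.
have ZE : Zsub (~: val e)%SET y = Zsub (~: val e)%SET y'.
  apply: Zsub_dep => j aj; apply: h; apply: contraTneq aj => -> /=.
  by apply/negP => /fintype.subsetP/(_ x xe); rewrite !inE xe.
(* Removing the two ends of e one after the other costs a factor at most M
   each, so everything in the partition function, hence a, is at most M^2 times
   the partition function of the complement of e. *)
have ub (A : {set G}) v : v \in A -> good K v y -> expR (logratio A v y) <= M.
  move=> vA gv; apply: (@le_trans _ _ (expR (y (inr v) + ln (1 + activity v y)))).
    by rewrite ler_expR logratio_le.
  rewrite expRD lnK ?posrE ?ltr_wpDr ?activity_ge0 // ler_pM ?expR_ge0 ?addr_ge0 ?activity_ge0 //.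
    rewrite ler_expR; apply: (le_trans (ler_norm _)).
    by move/forall_inP : gv; apply; rewrite inE eqxx.
  by rewrite lerD2l (activity_good hD).
have u1 := ub [set: G]%SET x (finset.in_setT x) g1.
have oA : other e x \in ([set: G] :\ x)%SET.
  by have [_ n _] := otherP xe; rewrite !inE eq_sym n.
have u2 := ub _ _ oA g2.
rewrite !expR_logratio in u1 u2.
have t0 := Zsub_gt0 (~: val e)%SET y.
have E2 : ([set: G] :\ x :\ other e x)%SET = (~: val e)%SET.
  by rewrite finset.setDDl -eA finset.setTD.
rewrite E2 ler_pdivrMr // in u2.
rewrite ler_pdivrMr ?Zsub_gt0 // in u1.
have u3 : Zsub [set: G]%SET y <= M ^+ 2 * Zsub (~: val e)%SET y.
  by rewrite (le_trans u1) // expr2 -mulrA ler_wpM2l.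
have [a0 EZ] := aE y; have [_ EZ'] := aE y'.
have ale : a y <= M ^+ 2 * Zsub (~: val e)%SET y.
  by apply: le_trans u3; rewrite EZ lerDl mulr_ge0 ?expR_ge0 // ltW.
rewrite EZ EZ' -(ha _ _ h) -ZE.
have e1 : expR q' <= expR (y (inl e)) by rewrite ler_expR.
have e2 : expR (y' (inl e)) <= expR q by rewrite ler_expR.
have rE : rho * (M ^+ 2 + expR q) = expR q' - expR q by rewrite /rho divfK ?gt_eqF.
move: (Zsub (~: val e)%SET y) t0 ale => t t0 ale.
have k1 : expR q' * t <= expR (y (inl e)) * t by rewrite ler_wpM2r // ltW.
have k2 : (1 + rho) * (expR (y' (inl e)) * t) <= (1 + rho) * (expR q * t).
  by rewrite ler_wpM2l ?addr_ge0 // ler_wpM2r // ltW.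
have k3 : rho * a y <= rho * (M ^+ 2 * t) by rewrite ler_wpM2l.
have k4 : rho * (M ^+ 2 * t) + rho * (expR q * t) = expR q' * t - expR q * t.
  by rewrite -mulrBl -rE; ring.
rewrite mulrDr; lra.
Qed.

End edge_lower.

Section nondeg.
Context {R : realType} (law : probability R R).

Let null_cup (A : (set R)^nat) : (forall n, measurable (A n)) -> (forall n, law (A n) = 0%E) ->
  law (\bigcup_n A n) = 0%E.
Proof.
move=> mA A0; apply/eqP; rewrite eq_le measure_ge0 andbT.
apply: (le_trans (@measure_sigma_subadditive _ _ _ law (\bigcup_n A n) A mA (bigcup_measurable (fun n _ => mA n)) (@subset_refl _ _))).
by rewrite eseries0 // => n _ _; exact: A0.
Qed.

(** Otherwise each pair q < q' has a null half-line on one of its sides. The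
supremum of the points with a null left half-line then carries all the mass,
and the law is a point mass. *)
Lemma nondeg_gap : non_degenerate law ->
  exists q q' : R, [/\ q < q', law `]-oo, q]%classic != 0%E & law `[q', +oo[%classic != 0%E].
Proof.
move=> nd; apply: contrapT => H.
have {}H q q' : q < q' -> law `]-oo, q]%classic = 0%E \/ law `[q', +oo[%classic = 0%E.
  move=> qq; have [->|n1] := eqVneq (law `]-oo, q]%classic) 0%E; first by left.
  have [->|n2] := eqVneq (law `[q', +oo[%classic) 0%E; first by right.
  by exfalso; apply: H; exists q, q'.
have bnd (x : R) : exists n : nat, `|x| <= n%:R.
  by exists (Num.bound `|x|); apply/ltW/archi_boundP.
have nT : law setT <> 0%E by rewrite probability_setT => -[] /eqP; rewrite oner_eq0.
pose A := [set x : R | law `]-oo, x]%classic = 0%E].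
have An0 : A !=set0.
  apply: contrapT => nA; apply: nT.
  have all0 x : law `[x, +oo[%classic = 0%E.
    have lx : x - 1 < x by rewrite ltrBlDr ltrDl.
    have [h|//] := H _ _ lx.
    by exfalso; apply: nA; exists (x - 1).
  rewrite (_ : setT = \bigcup_n `[- n%:R, +oo[%classic); first exact: null_cup.
  apply/seteqP; split => // x _; have [n hn] := bnd x.
  by exists n => //=; rewrite in_itv /= andbT; move: hn; rewrite ler_norml => /andP[].
have mono x y : x <= y -> law `]-oo, y]%classic = 0%E -> law `]-oo, x]%classic = 0%E.
  move=> xy h; apply/eqP; rewrite eq_le measure_ge0 andbT -h.
  apply: le_measure; rewrite ?inE //; apply: subset_itvl.
  by rewrite bnd_simp.
have Aub : has_ubound A.
  apply: contrapT => nub; apply: nT.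
  have all0 x : law `]-oo, x]%classic = 0%E.
    apply: contrapT => nx; apply: nub; exists x => y Ay; rewrite leNgt; apply/negP => xy.
    by apply: nx; apply: (mono _ y) => //; exact: ltW.
  rewrite (_ : setT = \bigcup_n `]-oo, n%:R]%classic); first exact: null_cup.
  apply/seteqP; split => // x _; have [n hn] := bnd x.
  by exists n => //=; rewrite in_itv /=; move: hn; rewrite ler_norml => /andP[].
pose c := sup A.
have left0 : law `]-oo, c[%classic = 0%E.
  have lx0 x : x < c -> law `]-oo, x]%classic = 0%E.
    move=> xc; have [y Ay xy] := sup_gt An0 xc.
    by apply: (mono _ y) => //; exact: ltW.
  rewrite (_ : `]-oo, c[%classic = \bigcup_n `]-oo, c - n.+1%:R^-1]%classic).
    by apply: null_cup => // n; apply: lx0; rewrite ltrBlDr ltrDl invr_gt0 ltr0n.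
  apply/seteqP; split => x /=.
    rewrite in_itv /= => /ltr_add_invr[k hk]; exists k => //=.
    by rewrite in_itv /= lerBrDr ltW.
  move=> [k _] /=; rewrite !in_itv /= => h; apply: (le_lt_trans h).
  by rewrite ltrBlDr ltrDl invr_gt0 ltr0n.
have right0 : law `]c, +oo[%classic = 0%E.
  rewrite itvoyEbigcup; apply: null_cup => // n.
  have cn : c < c + n.+1%:R^-1 by rewrite ltrDl invr_gt0 ltr0n.
  have := midf_lt cn; move: (_ / 2) => z; case=> cz zn.
  have [h|//] := H _ _ zn.
  exfalso; have : z <= c by apply: ub_le_sup.
  by rewrite leNgt cz.
have nc : law (~` [set c]) = 0%E.
  have -> : ~` [set c] = (`]-oo, c[ `|` `]c, +oo[)%classic.
    apply/seteqP; split => x /=; rewrite !in_itv /= andbT.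
      by move=> /eqP; rewrite neq_lt => /orP.
    by move=> h; apply/eqP; rewrite neq_lt; apply/orP.
  apply/eqP; rewrite eq_le measure_ge0 andbT.
  have s0 : (law `]-oo, c[%classic + law `]c, +oo[%classic = 0)%E by rewrite left0 right0 adde0.
  by rewrite -s0; exact: measureU2.
apply: (nd c) => B mB; rewrite diracE; case: (boolP (c \in B)) => cB /=.
  have nB : law (~` B) = 0%E.
    apply/eqP; rewrite eq_le measure_ge0 andbT -nc.
    apply: le_measure; rewrite ?inE //; [exact: measurableC|exact: measurableC|].
    by apply: subsetC => x ->; move: cB; rewrite inE.
  have := probability_setC law mB; rewrite nB => /esym/eqP.
  by rewrite sube_eq ?add0e // ?fin_num_measure // => /eqP.
change (law B = 0%E); apply/eqP; rewrite eq_le measure_ge0 andbT -nc.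
apply: le_measure; rewrite ?inE //; first exact: measurableC.
by move=> x Bx /= xc; move: cB; rewrite -xc notin_setE.
Qed.

End nondeg.

(** * Linear growth of the variance *)
Section moments.
Context {R : realType}.

Lemma rintegrable_pow4 (law : probability R R) : finite_fourth_moment law -> rintegrable law (fun x => x ^+ 4).
Proof.
move=> h; apply/integrableP; split.
  by apply/measurable_EFinP; apply: measurable_funX; exact: measurable_id.
rewrite (eq_integral (fun x : R => (x ^+ 4)%:E)) // => x _ /=.
by rewrite ger0_norm // (exprM _ 2 2) sqr_ge0.
Qed.

Definition moment4 (law : probability R R) : R := mean law (fun x => x ^+ 4).

Lemma moment4_ge0 law : 0 <= moment4 law.
Proof. by apply: Rintegral_ge0 => x _; rewrite (exprM _ 2 2) sqr_ge0. Qed.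

Lemma mean_indic (law : probability R R) (A : set R) (p : R -> R) : measurable A ->
  (forall x, p x = \1_A x) -> mean law p = fine (law A).
Proof.
move=> mA h; rewrite /mean /Rintegral (eq_integral (fun x => (\1_A x)%:E)); last by move=> x _; rewrite h.
by rewrite integral_indic // setIT.
Qed.

End moments.

Section lawEV.
Context {R : realType} (lawE lawV : probability R R).
Hypothesis E4 : finite_fourth_moment lawE.
Hypothesis V4 : finite_fourth_moment lawV.
Hypothesis ndE : non_degenerate lawE.
Variable D : nat.

Definition item_law (G : sgraph) (i : edge G + G) : probability R R :=
  match i with inl _ => lawE | inr _ => lawV end.

Definition moment4_bound : R := moment4 lawE + moment4 lawV.

Lemma moment4_bound_ge0 : 0 <= moment4_bound. Proof. by rewrite addr_ge0 ?moment4_ge0. Qed.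

Lemma moment4_product (J : finType) (Q : probability (weights (R:=R) J) R) (mu : J -> probability R R) :
  product_law Q mu -> (forall j, mu j = lawE \/ mu j = lawV) ->
  (forall j, rintegrable Q (fun y => y j ^+ 4)) /\ (forall j, mean Q (fun y => y j ^+ 4) <= moment4_bound).
Proof.
move=> Qmu muEV.
have I4 j : rintegrable (mu j) (fun x => x ^+ 4) by case: (muEV j) => ->; exact: rintegrable_pow4.
split=> j; have [h1 h2] := marginal_int Qmu (I4 j); first exact: h1.
rewrite h2 /moment4_bound; have := moment4_ge0 lawE; have := moment4_ge0 lawV.
by case: (muEV j) => ->; rewrite -/(moment4 _); lra.
Qed.

Definition logZ (G : sgraph) : weights (R:=R) (edge G + G)%type -> R := fun y => ln (Zsub [set: G]%SET y).

Lemma measurable_logZ G : measurable_fun setT (@logZ G).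
Proof. exact: measurable_lnZ. Qed.

Lemma logZ_lip G y z : `|@logZ G y - logZ z| <= \sum_i `|y i - z i|.
Proof. exact: lnZ_lip. Qed.

Lemma doubled_EV (G : sgraph) j : doubled (@item_law G) j = lawE \/ doubled (@item_law G) j = lawV.
Proof. by case: j => -[e|x] /=; [left|right|left|right]. Qed.

Lemma item_law_EV (G : sgraph) j : @item_law G j = lawE \/ @item_law G j = lawV.
Proof. by case: j => [e|x] /=; [left|right]. Qed.

(** With psi the indicator of the weights that reach the upper level q', the product of the
increment of F and the increment of psi is nonnegative, by monotonicity of the
free energy in the edge weight. It is at least the constant c1 when the weight
reaches q', its copy is at most q and the surrounding weights are bounded by M.
The first two conditions have probability p1 p2; the level M is such that the
last one fails with probability at most half of it. *)
Lemma edge_effect_lower : exists (c : R) (psi : R -> R),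
  [/\ 0 < c, measurable_fun setT psi, (forall t, 0 <= psi t <= 1) &
   forall (G : sgraph) (Q : probability (weights (R:=R) ((edge G + G) + (edge G + G))%type) R),
    (max_degree G <= D)%N -> product_law Q (doubled (@item_law G)) -> forall e : edge G,
    2 * c <= mean Q (fun y => incrF (@logZ G) finset.set0 (inl e) y *
       (psi (y (inl (inl e))) - psi (y (inr (inl e)))))].
Proof.
have [q [q' [qq lq lq']]] := nondeg_gap ndE.
pose psi (t : R) : R := if q' <= t then 1 else 0.
pose chi (t : R) : R := if t <= q then 1 else 0.
have mpsi : measurable_fun setT psi by apply: measurable_fun_ifT => //; exact: measurable_fun_ler.
have mchi : measurable_fun setT chi by apply: measurable_fun_ifT => //; exact: measurable_fun_ler.
have psi01 t : 0 <= psi t <= 1 by rewrite /psi; case: ifP; rewrite ?lexx ?ler01.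
have chi01 t : 0 <= chi t <= 1 by rewrite /chi; case: ifP; rewrite ?lexx ?ler01.
pose p1 := mean lawE psi; pose p2 := mean lawE chi.
have p1E : p1 = fine (lawE `[q', +oo[%classic).
  apply: mean_indic => // x; rewrite indicE /psi; case: ifP => h.
    by rewrite mem_set //= in_itv /= h.
  by rewrite memNset //= in_itv /= h.
have p2E : p2 = fine (lawE `]-oo, q]%classic).
  apply: mean_indic => // x; rewrite indicE /chi; case: ifP => h.
    by rewrite mem_set //= in_itv /= h.
  by rewrite memNset //= in_itv /= h.
have pos_prob A : measurable A -> lawE A != 0%E -> 0 < fine (lawE A).
  by move=> mA h; rewrite fine_gt0 // lt0e h measure_ge0 /= ltey_eq fin_num_measure.
have p10 : 0 < p1 by rewrite p1E pos_prob.
have p20 : 0 < p2 by rewrite p2E pos_prob.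
have p12 : 0 < p1 * p2 by exact: mulr_gt0.
pose M : R := 1 + (2 * (2 * D + 1)%:R * moment4_bound) / (p1 * p2 / 2).
have M1 : 1 <= M by rewrite lerDl divr_ge0 ?mulr_ge0 ?moment4_bound_ge0 // ltW.
have M0 : 0 < M by exact: lt_le_trans M1.
have M4 : M <= M ^+ 4 by rewrite -[leLHS]expr1 ler_weXn2l.
have M40 : 0 < M ^+ 4 by exact: exprn_gt0.
have hM : 2 * (2 * D + 1)%:R * moment4_bound / M ^+ 4 <= p1 * p2 / 2.
  have h0 : 0 < p1 * p2 / 2 by exact: divr_gt0.
  have E : p1 * p2 / 2 * M = p1 * p2 / 2 + 2 * (2 * D + 1)%:R * moment4_bound.
    by rewrite /M mulrDr mulr1 [X in _ + X]mulrC divfK ?gt_eqF.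
  rewrite ler_pdivrMr // (le_trans _ (ler_wpM2l (ltW h0) M4)) //.
  by rewrite E lerDr ltW.
pose c1 : R := ln (1 + (expR q' - expR q) / ((expR M * (1 + D%:R * expR (3 * M))) ^+ 2 + expR q)).
have c10 : 0 < c1.
  rewrite ln_gt0 // ltrDl divr_gt0 // ?subr_gt0 ?ltr_expR //.
  by rewrite ltr_wpDl ?expR_gt0 // sqr_ge0.
exists (c1 * (p1 * p2) / 4), psi; split => //.
  by rewrite divr_gt0 // mulr_gt0.
move=> G Q hD Qmu e.
have [Q4 Em4] := moment4_product Qmu (@doubled_EV G).
have [x xe] := edge_nonempty e.
pose NN : {set edge G + G} := (nbhd_items x :|: nbhd_items (other e x))%SET.
have cN : (#|NN| <= 2 * (2 * D + 1))%N.
  by rewrite (leq_trans (leq_card_setU _ _)) // mul2n -addnn leq_add // card_nbhd_items.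
have gpsi j : growth 0 (fun y : weights (R:=R) ((edge G + G) + (edge G + G))%type => psi (y j)).
  apply: (@growth_bd _ _ _ 1); first by apply: (measurableT_comp mpsi); exact: measurable_coord.
  by move=> y; have /andP[a b] := psi01 (y j); rewrite ger0_norm.
have gchi j : growth 0 (fun y : weights (R:=R) ((edge G + G) + (edge G + G))%type => chi (y j)).
  apply: (@growth_bd _ _ _ 1); first by apply: (measurableT_comp mchi); exact: measurable_coord.
  by move=> y; have /andP[a b] := chi01 (y j); rewrite ger0_norm.
have gdif := growth_incrF (@measurable_logZ G) (@logZ_lip G) finset.set0 (inl e).
have gL := growthM gdif (growthB (gpsi (inl (inl e))) (gpsi (inr (inl e)))).
(* A bound on the indicator that some surrounding weight exceeds M; being a
   polynomial, it needs no independence from psi and chi. *)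
pose bad (y : weights (R:=R) ((edge G + G) + (edge G + G))%type) : R := (M ^+ 4)^-1 * \sum_(i in NN) y (inl i) ^+ 4.
have Ibad : rintegrable Q bad by apply: rintegrableZ; exact: rintegrable_sum.
have gpc := growthM (gpsi (inl (inl e))) (gchi (inr (inl e))).
have Ipc := growth_rintegrable Q4 (leq0n 4) gpc.
have IR : rintegrable Q (fun y => c1 * (psi (y (inl (inl e))) * chi (y (inr (inl e))) - 1 * bad y)).
  apply: rintegrableZ; rewrite (_ : (fun _ => _) = fun y => psi (y (inl (inl e))) * chi (y (inr (inl e))) + (-1) * bad y).
    by apply: rintegrableD => //; exact: rintegrableZ.
  by apply/funext => y; ring.
have lower : mean Q (fun y => c1 * (psi (y (inl (inl e))) * chi (y (inr (inl e))) - 1 * bad y)) <=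
   mean Q (fun y => incrF (@logZ G) finset.set0 (inl e) y * (psi (y (inl (inl e))) - psi (y (inr (inl e))))).
  apply: mean_le => //; first exact: (growth_rintegrable Q4 (isT : (1 <= 4)%N) gL).
  move=> y.
  have same j : j != inl e -> hybrid finset.set0 y j = hybrid (inl e |: finset.set0)%SET y j.
    by move=> je; rewrite /hybrid !inE (negbTE je).
  have v1 : hybrid finset.set0 y (inl e) = y (inl (inl e)) by rewrite /hybrid inE.
  have v2 : hybrid (inl e |: finset.set0)%SET y (inl e) = y (inr (inl e)) by rewrite /hybrid !inE eqxx.
  have bad0 : 0 <= bad y.
    by rewrite mulr_ge0 ?invr_ge0 ?(ltW M40) // sumr_ge0 // => i _; rewrite (exprM _ 2 2) sqr_ge0.
  have LHS0 : 0 <= incrF (@logZ G) finset.set0 (inl e) y * (psi (y (inl (inl e))) - psi (y (inr (inl e)))).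
    rewrite /incrF /F_at /logZ; case: (leP (y (inr (inl e))) (y (inl (inl e)))) => hw.
      rewrite mulr_ge0 // subr_ge0.
        by apply: (lnZ_edge_mono (e := e)) => //; rewrite v1 v2.
      rewrite /psi; case: (leP q' (y (inr (inl e)))) => h1; case: (leP q' (y (inl (inl e)))) => h2 //.
      by have := le_lt_trans (le_trans h1 hw) h2; rewrite ltxx.
    rewrite mulr_le0 // subr_le0.
      apply: (lnZ_edge_mono (e := e)); last by rewrite v1 v2 ltW.
      by move=> j je; rewrite same.
    rewrite /psi; case: (leP q' (y (inr (inl e)))) => h1; case: (leP q' (y (inl (inl e)))) => h2 //.
    by have := lt_trans h1 (le_lt_trans h2 hw); rewrite ltxx.
  rewrite mul1r.
  case: (boolP [forall i in NN, `|y (inl i)| <= M]) => hg; last first.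
    apply: le_trans LHS0; rewrite mulr_ge0_le0 ?(ltW c10) // subr_le0.
    move: hg; rewrite negb_forall_in => /exists_inP[i iN]; rewrite -ltNge => hi.
    apply: (@le_trans _ _ 1).
      have /andP[a0 a1] := psi01 (y (inl (inl e))); have /andP[b0 b1] := chi01 (y (inr (inl e))).
      by rewrite -[leRHS]mulr1 ler_pM.
    rewrite /bad mulrC ler_pdivlMr // mul1r (bigD1 i) //= -[leLHS]addr0; apply: lerD.
      have -> : y (inl i) ^+ 4 = `|y (inl i)| ^+ 4.
        by rewrite -normrX ger0_norm // (exprM _ 2 2) sqr_ge0.
      by rewrite lerXn2r ?nnegrE ?(ltW M0) // ltW.
    by rewrite sumr_ge0 // => k _; rewrite (exprM _ 2 2) sqr_ge0.
  rewrite /chi {1}/psi; case: (leP q' (y (inl (inl e)))) => h1; last first.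
    by rewrite mul0r sub0r (le_trans _ LHS0) // mulr_ge0_le0 ?oppr_le0 // ltW.
  case: (leP (y (inr (inl e))) q) => h2; last first.
    by rewrite mulr0 sub0r (le_trans _ LHS0) // mulr_ge0_le0 ?oppr_le0 // ltW.
  have -> : psi (y (inl (inl e))) - psi (y (inr (inl e))) = 1.
    by rewrite /psi h1 leNgt (le_lt_trans h2 qq) subr0.
  rewrite !mulr1; apply: (@le_trans _ _ c1).
    by rewrite -[leRHS]mulr1 ler_wpM2l ?(ltW c10) // lerBlDr lerDl.
  have gd z : z \in [set x; other e x]%SET -> good M z (hybrid finset.set0 y).
    move=> zz; apply/forall_inP => i iN; rewrite /hybrid inE; move/forall_inP : hg; apply.
    by move: zz; rewrite finset.in_set2 => /orP[]/eqP zE; rewrite finset.in_setU -zE iN ?orbT.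
  apply: (lnZ_edge_gap hD (e := e) (x := x)) => //.
  - by apply: gd; rewrite !inE eqxx.
  - by apply: gd; rewrite !inE eqxx orbT.
  - by rewrite v1.
  - by rewrite v2.
apply: le_trans lower.
rewrite meanZ; last first.
  rewrite (_ : (fun _ => _) = fun y => psi (y (inl (inl e))) * chi (y (inr (inl e))) + (-1) * bad y).
    by apply: rintegrableD => //; exact: rintegrableZ.
  by apply/funext => y; ring.
rewrite meanB //; last exact: rintegrableZ.
rewrite meanZ // mul1r.
have bd01 (p : R -> R) : measurable_fun setT p -> (forall t, 0 <= p t <= 1) -> rintegrable lawE p.
  move=> mp p01.
  have I1 : rintegrable lawE (fun=> 1) by exact: finite_measure_integrable_cst.
  apply: (le_integrable measurableT _ _ I1).
    exact/measurable_EFinP.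
  by move=> t _ /=; rewrite lee_fin normr1; have /andP[a b] := p01 t; rewrite ger0_norm.
have Ipsi := bd01 _ mpsi psi01; have Ichi := bd01 _ mchi chi01.
have Epc : mean Q (fun y => psi (y (inl (inl e))) * chi (y (inr (inl e)))) = p1 * p2.
  rewrite (mean_indep Qmu (S := [set inl (inl e)]%SET)).
  - congr (_ * _).
      exact: (proj2 (@marginal_int _ _ Q _ Qmu (inl (inl e)) psi Ipsi)).
    exact: (proj2 (@marginal_int _ _ Q _ Qmu (inr (inl e)) chi Ichi)).
  - by move=> y z h; rewrite h // inE.
  - by move=> y z h; rewrite h // !inE.
  - exact: (growth_rintegrable Q4 (leq0n 4) (gpsi _)).
  - exact: (growth_rintegrable Q4 (leq0n 4) (gchi _)).
  - exact: Ipc.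
have Ebad : mean Q bad <= p1 * p2 / 2.
  rewrite /bad meanZ; last exact: rintegrable_sum.
  apply: le_trans hM; rewrite mulrC ler_wpM2r ?invr_ge0 ?(ltW M40) //.
  rewrite mean_sum //; apply: (@le_trans _ _ (\sum_(i in NN) moment4_bound)); first by apply: ler_sum => i _.
  by rewrite sumr_const -[leLHS]mulr_natl ler_wpM2r ?moment4_bound_ge0 // -natrM ler_nat.
rewrite Epc.
have -> : 2 * (c1 * (p1 * p2) / 4) = c1 * (p1 * p2 - p1 * p2 / 2) by field.
by rewrite ler_wpM2l ?(ltW c10) // lerD2l lerN2.
Qed.

(** Connectedness provides an edge at each vertex. *)
Lemma card_edges (G : sgraph) : graph_connected G -> (1 < #|G|)%N ->
  (#|{: edge G + G}| <= 3 * #|edge G|)%N.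
Proof.
move=> /andP[_ /forallP conn] G1.
have inc_ex x : exists e : edge G, x \in (val e : {set G}).
  have [z zx] : exists z, z != x.
    apply/existsP; apply: contraLR G1; rewrite negb_exists -leqNgt => /forallP h.
    rewrite -(cards1 x) -cardsT; apply: fintype.subset_leq_card; apply/fintype.subsetP => z _.
    by rewrite inE; have := h z; rewrite negbK.
  have /forallP/(_ z)/connectP[[|u p] /= pth E] := conn x; first by rewrite E eqxx in zx.
  have /andP[xu _] := pth.
  have ie : is_edge [set x; u]%SET.
    by apply/existsP; exists x; apply/existsP; exists u; rewrite xu eqxx.
  by exists (Sub [set x; u]%SET ie); rewrite /= !inE eqxx.
have : ([set: G] \subset \bigcup_(e in [set: edge G]) (val e : {set G}))%SET.
  by apply/fintype.subsetP => x _; have [e xe] := inc_ex x; apply/bigcupP; exists e.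
move/fintype.subset_leq_card; rewrite cardsT => h.
have h2 : (#|G| <= 2 * #|edge G|)%N.
  apply: (leq_trans h); apply: (leq_trans (card_bigcup_le _ _)).
  apply: (@leq_trans (\sum_(e in [set: edge G]%SET) 2)%N); last by rewrite sum_nat_const cardsT mulnC.
  apply: leq_sum => e _; have [x xe] := edge_nonempty e; have [_ _ ->] := otherP xe.
  by rewrite cards2; case: (_ == _).
by rewrite card_sum; lia.
Qed.

Lemma variance_lower_bound : exists2 kap : R, 0 < kap &
  forall (G : sgraph) (Q : probability (weights (R:=R) ((edge G + G) + (edge G + G))%type) R),
    graph_connected G -> (1 < #|G|)%N ->
    (max_degree G <= D)%N -> product_law Q (doubled (@item_law G)) ->
    kap * #|{: edge G + G}|%:R <= F_var Q (@logZ G).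
Proof.
have [c [psi [c0 mpsi psi01 h]]] := edge_effect_lower.
exists (c ^+ 2 / 3); first by rewrite divr_gt0 // exprn_gt0.
move=> G Q conn G1 hD Qmu.
have [Q4 Em4] := moment4_product Qmu (@doubled_EV G).
have vl := @variance_ge_covariance _ _ Q _ Qmu Q4 (@logZ G) (@measurable_logZ G) (@logZ_lip G)
  [set inl e | e : edge G]%SET psi c (ltW c0) mpsi psi01.
apply: le_trans (vl _); last first.
  by move=> i /imsetP[e _ ->]; exact: h.
rewrite card_imset; last by move=> ? ? [].
have cc := card_edges conn G1.
have : #|{: edge G + G}|%:R <= 3 * #|edge G|%:R :> R by rewrite -natrM ler_nat.
move=> hh.
have c3 : 0 <= c ^+ 2 / 3 by rewrite divr_ge0 // sqr_ge0.
apply: (le_trans (ler_wpM2l c3 hh)).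
by rewrite le_eqVlt; apply/orP; left; apply/eqP; field.
Qed.

End lawEV.

(** * Normal approximation, uniformly over graphs *)
Section tau.
Context {R : realType} (G : sgraph).
Notation I := (edge G + G)%type.
Variable Q0 : probability (weights (R:=R) I) R.
Variable Q : probability (weights (R:=R) (I + I)%type) R.
Variable lam : I -> probability R R.
Hypothesis Q0l : product_law Q0 lam.
Hypothesis Qmu : product_law Q (doubled lam).
Hypothesis Q04 : forall j, rintegrable Q0 (fun y => y j ^+ 4).
Hypothesis Q4 : forall j, rintegrable Q (fun y => y j ^+ 4).
Variable m4 : R.
Hypothesis Em4 : forall j, mean Q (fun y => y j ^+ 4) <= m4.
Variable D : nat.
Hypothesis hD : (max_degree G <= D)%N.
Variables (A ek : R) (k : nat).
Hypothesis A1 : 1 <= A.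
Hypothesis ekP : forall x, mean Q0 (fun y => Num.min 1 (err k [set: G]%SET x y)) <= ek.
Notation Y := (weights (R:=R) (I + I)%type).

Definition trunc_incr (S : {set I}) (i : I) (y : Y) : R :=
  truncated k [set: G]%SET (root i) (hybrid S y) - truncated k [set: G]%SET (root i) (hybrid (i |: S)%SET y).

(** The increments of F are replaced by increments of the truncated ratio, which
are local, and clipped, so as to be bounded. *)
Definition tau (i : I) (y : Y) : R := clip A (trunc_incr finset.set0 i y) * clip A (trunc_incr (before i) i y).

Definition tau_support (i : I) : {set I + I} :=
  [set j | match j with inl l => l \in ball_items k (root i) | inr l => l \in ball_items k (root i) end]%SET.

Definition capped1_err (S : {set I}) (i : I) (y : Y) : R := Num.min 1 (err k [set: G]%SET (root i) (hybrid S y)).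

Let A0 : 0 <= A. Proof. exact: le_trans A1. Qed.

Lemma growth_clip S i : growth 0 (fun y => clip A (trunc_incr S i y)).
Proof.
apply: (@growth_bd _ _ _ A); last by move=> y; exact: clip_bd.
apply: measurableT_comp; first exact: measurable_clip.
by apply: measurable_funB; apply: (measurableT_comp (measurable_truncated _ _ _)); exact: measurable_hybrid.
Qed.

Lemma growth_tau i : growth 0 (tau i).
Proof. exact: (growthM (growth_clip _ _) (growth_clip _ _)). Qed.

Lemma tau_bd i y : `|tau i y| <= A ^+ 2.
Proof. by rewrite /tau normrM expr2 ler_pM // clip_bd. Qed.

Lemma trunc_incr_dep S i : depends (trunc_incr S i) (tau_support i).
Proof.
move=> y z h; rewrite /trunc_incr; congr (_ - _); apply: truncated_dep => l ld; rewrite /hybrid.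
  by case: ifP => _; apply: h; rewrite inE.
by case: ifP => _; apply: h; rewrite inE.
Qed.

Lemma tau_dep i : depends (tau i) (tau_support i).
Proof. by move=> y z h; rewrite /tau !(trunc_incr_dep _ h). Qed.

Lemma tau_support_meet i : (#|[set j | ~~ [disjoint tau_support i & tau_support j]%B]%SET| <= D.+1 ^ (2 * k).+2)%N.
Proof.
apply: leq_trans (card_meet hD k i); apply: fintype.subset_leq_card.
apply/fintype.subsetP => j; rewrite !inE; apply: contra => dis.
rewrite -finset.setI_eq0; apply/eqP/setP => l; rewrite finset.in_setI finset.in_set0.
have dd l' : l' \in ball_items k (root i) -> l' \in ball_items k (root j) -> False.
  move: dis; rewrite finset.disjoints_subset => /fintype.subsetP h /h.
  by rewrite finset.in_setC => /negP.
apply/negP => /andP[]; rewrite /tau_support !finset.in_set.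
by case: l => l; exact: dd.
Qed.

Lemma growth_capped1_err S i : growth 0 (capped1_err S i).
Proof.
apply: (@growth_bd _ _ _ 1).
  apply: measurable_minr => //; apply: (measurableT_comp (measurable_err _ _ _)); exact: measurable_hybrid.
by move=> y; rewrite ger0_norm ?ge_min ?lexx // le_min ler01 normr_ge0.
Qed.

Lemma mean_capped1_err S i : mean Q (capped1_err S i) <= ek.
Proof.
have g : growth 0 (fun y : weights (R:=R) I => Num.min 1 (err k [set: G]%SET (root i) y)).
  apply: (@growth_bd _ _ _ 1); first by apply: measurable_minr => //; exact: measurable_err.
  by move=> y; rewrite ger0_norm ?ge_min ?lexx // le_min ler01 normr_ge0.
have [_ E] := mean_hybrid Qmu S Q0l (growth_rintegrable Q04 (leq0n 4) g).
by apply: le_trans (ekP (root i)); rewrite -E.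
Qed.

Lemma incrFE S i y : incrF (@logZ R G) S i y =
  logratio [set: G]%SET (root i) (hybrid S y) - logratio [set: G]%SET (root i) (hybrid (i |: S)%SET y).
Proof.
rewrite /incrF /F_at /logZ; apply: lnZ_diff_root => j ji.
by rewrite /hybrid !inE (negbTE ji).
Qed.

(** Capping the truncation errors at 1 is harmless here: the left-hand side is at
most 2 A in any case. *)
Lemma clip_close S i y : `|incrF (@logZ R G) S i y| <= A ->
  `|incrF (@logZ R G) S i y - clip A (trunc_incr S i y)| <= 2 * A * (capped1_err S i y + capped1_err (i |: S)%SET i y).
Proof.
move=> dA; set d := incrF _ _ _ _ in dA *.
have h1 : `|d - clip A (trunc_incr S i y)| <= 2 * A.
  by rewrite (le_trans (ler_normB _ _)) //; have := @clip_bd R A (trunc_incr S i y) A0; move: dA; lra.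
have h2 : `|d - clip A (trunc_incr S i y)| <= err k [set: G]%SET (root i) (hybrid S y) + err k [set: G]%SET (root i) (hybrid (i |: S)%SET y).
  rewrite -{1}(clip_id dA) (le_trans (clip_lip _ _ A0)) // /d incrFE /trunc_incr /err.
  set a := logratio _ _ _; set b := logratio _ _ _; set c := truncated _ _ _ _; set c' := truncated _ _ _ _.
  have -> : a - b - (c - c') = (a - c) - (b - c') by ring.
  exact: ler_normB.
rewrite /capped1_err; move: h2; set e1 := err _ _ _ _; set e2 := err _ _ _ _ => h2.
have e10 : 0 <= e1 by exact: normr_ge0.
have e20 : 0 <= e2 by exact: normr_ge0.
have e1' : Num.min 1 e1 = 1 \/ Num.min 1 e1 = e1 by case: (leP 1 e1) => _; [left|right].
have e2' : Num.min 1 e2 = 1 \/ Num.min 1 e2 = e2 by case: (leP 1 e2) => _; [left|right].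
have A2 : 1 <= 2 * A by have := A1; lra.
case: e1' => ->; case: e2' => ->.
- by apply: (le_trans h1); rewrite -[leLHS]mulr1 ler_wpM2l //; lra.
- by apply: (le_trans h1); rewrite -[leLHS]mulr1 ler_wpM2l //; lra.
- by apply: (le_trans h1); rewrite -[leLHS]mulr1 ler_wpM2l //; lra.
- by apply: (le_trans h2); rewrite -[leLHS]mul1r ler_wpM2r // addr_ge0.
Qed.

(** If the weight changes by at most A under resampling, the increments are not
clipped and the difference is due to truncation. Otherwise both products are
at most gap^2 <= gap^4 / A^2, which has a small mean when A is large. *)
Lemma tau_close i y :
  `|incrF (@logZ R G) finset.set0 i y * incrF (@logZ R G) (before i) i y - tau i y| <=
  2 / A ^+ 2 * gap i y ^+ 4 + 2 * A ^+ 2 * ((capped1_err finset.set0 i y + capped1_err (i |: finset.set0)%SET i y) +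
     (capped1_err (before i) i y + capped1_err (i |: before i)%SET i y)).
Proof.
set d := incrF _ finset.set0 i y; set d' := incrF _ (before i) i y.
have es0 S : 0 <= capped1_err S i y by rewrite /capped1_err le_min ler01 normr_ge0.
have dl0 : 0 <= gap i y by exact: normr_ge0.
have hd : `|d| <= gap i y by exact: (lip_F_at (@logZ_lip R G)).
have hd' : `|d'| <= gap i y by exact: (lip_F_at (@logZ_lip R G)).
have Ap : 0 < A ^+ 2 by rewrite exprn_gt0 // (lt_le_trans _ A1).
case: (leP (gap i y) A) => dA.
  have c1 := clip_close (le_trans hd dA); have c2 := clip_close (le_trans hd' dA).
  rewrite -/d in c1; rewrite -/d' in c2.
  have -> : d * d' - tau i y = (d - clip A (trunc_incr finset.set0 i y)) * d' +
      clip A (trunc_incr finset.set0 i y) * (d' - clip A (trunc_incr (before i) i y)) by rewrite /tau; ring.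
  rewrite (le_trans (ler_normD _ _)) // !normrM.
  have b1 : `|d - clip A (trunc_incr finset.set0 i y)| * `|d'| <=
     2 * A * (capped1_err finset.set0 i y + capped1_err (i |: finset.set0)%SET i y) * A.
    by rewrite ler_pM // (le_trans hd').
  have b2 : `|clip A (trunc_incr finset.set0 i y)| * `|d' - clip A (trunc_incr (before i) i y)| <=
     A * (2 * A * (capped1_err (before i) i y + capped1_err (i |: before i)%SET i y)).
    by rewrite ler_pM // clip_bd.
  have p0 : 0 <= 2 / A ^+ 2 * gap i y ^+ 4 by rewrite mulr_ge0 ?exprn_ge0 // divr_ge0 // ltW.
  apply: (le_trans (lerD b1 b2)); rewrite -[leLHS]add0r; apply: lerD => //.
  by rewrite le_eqVlt; apply/orP; left; apply/eqP; ring.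
apply: (@le_trans _ _ (2 * gap i y ^+ 2)).
  rewrite (le_trans (ler_normB _ _)) //.
  have t1 : `|tau i y| <= gap i y ^+ 2.
    by rewrite (le_trans (tau_bd _ _)) // lerXn2r ?nnegrE // ltW.
  have t2 : `|d * d'| <= gap i y ^+ 2 by rewrite normrM expr2 ler_pM.
  lra.
rewrite -[leLHS]addr0; apply: lerD; last first.
  by rewrite mulr_ge0 ?addr_ge0 // mulr_ge0 // ltW.
rewrite -mulrA ler_wpM2l // mulrC ler_pdivlMr // (exprM _ 2 2) [leRHS]expr2.
by rewrite ler_wpM2l ?exprn_ge0 // lerXn2r ?nnegrE // ltW.
Qed.

Lemma mean_tau_close i :
  mean Q (fun y => `|incrF (@logZ R G) finset.set0 i y * incrF (@logZ R G) (before i) i y - tau i y|) <=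
  32 * m4 / A ^+ 2 + 8 * A ^+ 2 * ek.
Proof.
have gdd := growth_incrF2 (@measurable_logZ R G) (@logZ_lip R G) i.
have gl : growth 2 (fun y => `|incrF (@logZ R G) finset.set0 i y * incrF (@logZ R G) (before i) i y - tau i y|).
  by apply: growth_abs; apply: growthB => //; apply: (@growth_le _ _ 0 2) => //; exact: growth_tau.
have Id4 := growth_rintegrable Q4 (leqnn 4) (growth_gapX i 4).
have Ie S := growth_rintegrable Q4 (leq0n 4) (growth_capped1_err S i).
have I1 := rintegrableD (rintegrableD (Ie finset.set0) (Ie (i |: finset.set0)%SET)) (rintegrableD (Ie (before i)) (Ie (i |: before i)%SET)).
apply: (le_trans (mean_le (growth_rintegrable Q4 (isT : (2 <= 4)%N) gl)
  (rintegrableD (rintegrableZ (2 / A ^+ 2) Id4) (rintegrableZ (2 * A ^+ 2) I1)) (tau_close i))).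
rewrite meanD; [|exact: rintegrableZ|exact: rintegrableZ].
rewrite meanZ // meanZ // meanD; [|exact: rintegrableD|exact: rintegrableD].
rewrite meanD // meanD //.
have Ap : 0 < A ^+ 2 by rewrite exprn_gt0 // (lt_le_trans _ A1).
apply: lerD.
  apply: (@le_trans _ _ (2 / A ^+ 2 * (16 * m4))).
    by rewrite ler_wpM2l ?divr_ge0 ?(ltW Ap) //; exact: (mean_gap4 Q4 Em4).
  by rewrite le_eqVlt; apply/orP; left; apply/eqP; field; rewrite gt_eqF // (lt_le_trans _ A1).
have -> : 8 * A ^+ 2 * ek = 2 * A ^+ 2 * ((ek + ek) + (ek + ek)) by ring.
rewrite ler_wpM2l ?mulr_ge0 ?(ltW Ap) //.
by apply: lerD; apply: lerD; exact: mean_capped1_err.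
Qed.

End tau.

Section uniform.
Context {R : realType} (lawE lawV : probability R R).
Hypothesis E4 : finite_fourth_moment lawE.
Hypothesis V4 : finite_fourth_moment lawV.
Hypothesis ndE : non_degenerate lawE.
Variable D : nat.
Notation item_law := (@item_law R lawE lawV).
Notation logZ := (@logZ R).

(** For a graph with n items, the variance is at least kap n, the fluctuations of
T are at most 3 eta n, and the sum of the third moments is O(n). After division
by the variance, and by its power 3/2, the bound is a multiple of eta plus
O(n^(-1/2)). First A is chosen to make the effect of clipping small, then the
truncation depth k through the decay of correlations, and n last. *)
Lemma uniform_bound (C eps : R) : 0 <= C -> 0 < eps ->
  exists N0 : R, forall (G : sgraph) (Q0 : probability (weights (R:=R) (edge G + G)%type) R)
    (Q : probability (weights (R:=R) ((edge G + G) + (edge G + G))%type) R),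
    graph_connected G -> (1 < #|G|)%N -> N0 <= #|G|%:R -> (max_degree G <= D)%N ->
    product_law Q0 (@item_law G) -> product_law Q (doubled (@item_law G)) ->
    0 < F_var Q (@logZ G) /\
    forall f k : R -> R, measurable_fun setT f -> measurable_fun setT k ->
    (forall x, `|f x| <= C /\ `|k x| <= C) ->
    (forall x y, `|f y - f x - k x * (y - x)| <= C * (y - x) ^+ 2) ->
    `|mean Q (fun y => k (F_std Q (@logZ G) (Num.sqrt (F_var Q (@logZ G))) finset.set0 y) -
         F_std Q (@logZ G) (Num.sqrt (F_var Q (@logZ G))) finset.set0 y *
         f (F_std Q (@logZ G) (Num.sqrt (F_var Q (@logZ G))) finset.set0 y))| <= eps.
Proof.
move=> C0 eps0.
have [kap kap0 hV] := variance_lower_bound E4 V4 ndE D.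
pose m4 := moment4_bound lawE lawV.
have m40 : 0 <= m4 by exact: moment4_bound_ge0.
have C1 : 0 < C + 1 by rewrite ltr_wpDl.
(* The two parts of the Stein bound are to be at most eps / 2: the first is
   C * (3 eta / kap). *)
pose eta := kap * eps / (6 * (C + 1)).
have eta0 : 0 < eta by rewrite divr_gt0 ?mulr_gt0.
(* 64 m4 / eta makes the clipping term 32 m4 / A^2 at most eta / 2; ek does the
   same for the truncation term. *)
pose A : R := 1 + 64 * m4 / eta.
have A1 : 1 <= A.
  by rewrite /A lerDl; apply: divr_ge0; [exact: mulr_ge0|exact: ltW].
have A0 : 0 < A by exact: lt_le_trans A1.
have A20 : 0 < A ^+ 2 by exact: exprn_gt0.
have AA : A <= A ^+ 2 by rewrite -[leLHS]expr1 ler_weXn2l.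
pose ek := eta / (16 * A ^+ 2).
have ek0 : 0 < ek by rewrite divr_gt0 // mulr_gt0.
have [k hk] := decay D m40 ek0.
pose c0 := (D.+1 ^ (2 * k).+2)%N.
pose B := A ^+ 2.
have etaE : 32 * m4 / A ^+ 2 + 8 * A ^+ 2 * ek <= eta.
  have h1 : 8 * A ^+ 2 * ek = eta / 2 by rewrite /ek; field; rewrite gt_eqF.
  have h2 : 32 * m4 / A ^+ 2 <= eta / 2.
    rewrite ler_pdivrMr // (@le_trans _ _ (eta / 2 * A)) //; last by rewrite ler_wpM2l // divr_ge0 // ltW.
    have -> : eta / 2 * A = eta / 2 + 32 * m4 by rewrite /A; field; rewrite gt_eqF.
    by rewrite lerDr divr_ge0 // ltW.
  by rewrite h1; lra.
(* The third-moment term is at most eps / 2 once the standard deviation exceeds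
   this number, since (2 s^3)^-1 n <= (2 s kap)^-1. *)
pose r := (1 + 16 * m4) * (C + 1) / (kap * eps).
have m16 : 0 <= 1 + 16 * m4 by apply: addr_ge0 => //; exact: mulr_ge0.
have r0 : 0 <= r.
  by apply: divr_ge0; apply: mulr_ge0 => //; exact: ltW.
exists (1 + c0%:R * B ^+ 2 / eta ^+ 2 + r ^+ 2 / kap).
move=> G Q0 Q conn G1 NG hD Q0l Qmu.
have [Q4 Em4] := moment4_product E4 V4 Qmu (@doubled_EV R lawE lawV G).
have [Q04 E0m4] := moment4_product E4 V4 Q0l (@item_law_EV R lawE lawV G).
have Vl := hV G Q conn G1 hD Qmu.
set n : R := #|{: edge G + G}|%:R in Vl.
have nG : 1 + c0%:R * B ^+ 2 / eta ^+ 2 + r ^+ 2 / kap <= n.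
  apply: (le_trans NG); rewrite /n ler_nat card_sum leq_addl //.
have q1 : 0 <= c0%:R * B ^+ 2 / eta ^+ 2 by rewrite divr_ge0 ?sqr_ge0 // mulr_ge0 ?sqr_ge0.
have q2 : 0 <= r ^+ 2 / kap by rewrite divr_ge0 ?sqr_ge0 // ltW.
have n1 : 1 <= n by apply: le_trans nG; rewrite -addrA lerDl addr_ge0 //.
have n0 : 0 < n by exact: lt_le_trans n1.
have kn0 : 0 < kap * n by exact: mulr_gt0.
have V0 : 0 < F_var Q (@logZ G) by exact: lt_le_trans Vl.
split => // f kf mf mk fkC tay.
set s := Num.sqrt (F_var Q (@logZ G)).
have s0 : 0 < s by rewrite sqrtr_gt0.
have sV : s ^+ 2 = F_var Q (@logZ G) by rewrite sqr_sqrtr // ltW.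
have sb := stein_bound Qmu Q4 (@measurable_logZ R G) (@logZ_lip R G) C0 mf mk fkC tay s0 sV.
apply: (le_trans sb).
have ekP x : mean Q0 (fun y => Num.min 1 (err k [set: G]%SET x y)) <= ek.
  exact: (hk G Q0 (@item_law G) hD Q0l Q04 E0m4 x).
have a0 : 0 < eta * n by exact: mulr_gt0.
have ct := stein_T_concentration Qmu Q4 (@measurable_logZ R G) (@logZ_lip R G) (sqr_ge0 A) a0
  (fun i => growth_tau k A1 i) (fun i y => tau_bd k A1 i y) (fun i => @tau_dep R G A k i)
  (fun i => tau_support_meet hD k i) (fun i => le_trans (mean_tau_close Q0l Qmu Q04 Q4 Em4 A1 ekP i) etaE).
rewrite -/n -/c0 -/B in ct.
have t1 : n * c0%:R * B ^+ 2 / (eta * n) <= eta * n.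
  rewrite ler_pdivrMr //.
  have h : c0%:R * B ^+ 2 <= n * eta ^+ 2.
    rewrite -ler_pdivrMr ?exprn_gt0 //; apply: le_trans nG; rewrite -addrA addrCA lerDl addr_ge0 //.
  have -> : eta * n * (eta * n) = n * (n * eta ^+ 2) by ring.
  by rewrite -[n * _ * _]mulrA; exact: (ler_wpM2l (ltW n0) h).
have three (u v t : R) : t <= u * v -> v * u + t + u * v <= 3 * u * v.
  by move=> h; rewrite (_ : 3 * u * v = v * u + u * v + u * v); [rewrite lerD2r lerD2l|ring].
have T1 : mean Q (fun y => `|stein_T (@logZ G) y - F_var Q (@logZ G)|) / F_var Q (@logZ G) <= 3 * eta / kap.
  rewrite ler_pdivrMr // (le_trans ct) //.
  apply: (@le_trans _ _ (3 * eta * n)); first exact: (three eta n).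
  have -> : 3 * eta * n = 3 * eta / kap * (kap * n) by field; rewrite gt_eqF.
  apply: ler_wpM2l => //; apply: divr_ge0; last exact: ltW.
  by apply: mulr_ge0 => //; exact: ltW.
have T2 : (\sum_i mean Q (fun y => gap i y ^+ 3)) / (2 * s ^+ 3) <= eps / (2 * (C + 1)).
  have sr : r <= s.
    rewrite -(ler_pXn2r (n := 2)) ?nnegrE // ?(ltW s0) //.
    rewrite sV (le_trans _ Vl) // mulrC -ler_pdivrMr //; apply: le_trans nG; rewrite lerDr addr_ge0 //.
  have s30 : 0 < 2 * s ^+ 3 by rewrite mulr_gt0 // exprn_gt0.
  rewrite ler_pdivrMr //.
  apply: (@le_trans _ _ (n * (1 + 16 * m4))).
    rewrite /n mulr_natl -sumr_const; apply: ler_sum => i _; exact: (mean_gap3 Q4 Em4).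
  have -> : eps / (2 * (C + 1)) * (2 * s ^+ 3) = eps / (C + 1) * s * s ^+ 2.
    by field; rewrite gt_eqF.
  apply: (@le_trans _ _ (eps / (C + 1) * r * (kap * n))).
    rewrite le_eqVlt; apply/orP; left; apply/eqP; rewrite /r; field.
    by rewrite !gt_eqF.
  have eC : 0 <= eps / (C + 1) by apply: divr_ge0; exact: ltW.
  apply: ler_pM; rewrite ?(ltW kn0) ?sV //; first exact: mulr_ge0.
  exact: ler_wpM2l.
apply: (@le_trans _ _ (C * (3 * eta / kap + eps / (2 * (C + 1))))).
  by rewrite ler_wpM2l // lerD.
have -> : 3 * eta / kap + eps / (2 * (C + 1)) = eps / (C + 1).
  by rewrite /eta; field; rewrite !gt_eqF.
by rewrite mulrA ler_pdivrMr // mulrC ler_wpM2l ?(ltW eps0) // lerDl.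
Qed.

End uniform.

(** * Convergence in distribution *)
Section transfer.
Context {R : realType} d (Om : measurableType d) (P : probability Om R) (G : sgraph).
Variables (w : edge G -> {RV P >-> R}) (nu : G -> {RV P >-> R}).
Variables (lawE lawV : probability R R).
Hypothesis dis : disordered_weights P w nu lawE lawV.
Hypothesis E4 : finite_fourth_moment lawE.
Hypothesis V4 : finite_fourth_moment lawV.

Let X := all_weights w nu.
Let Q0 : probability (weights (R:=R) (edge G + G)%type) R := joint_law X.
Let Q : probability (weights (R:=R) ((edge G + G) + (edge G + G))%type) R := pair_law X.
Let lam := @item_law R lawE lawV G.

Let lawX i : same_law (distribution P (X i)) (lam i).
Proof. by case: dis => he hv _; case: i => i; [exact: he|exact: hv]. Qed.

Let indX : mutually_independent P X. Proof. by case: dis. Qed.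

Lemma single_product : product_law Q0 lam. Proof. exact: (joint_law_product indX lawX). Qed.
Lemma pair_product : product_law Q (doubled lam). Proof. exact: (pair_law_product indX lawX). Qed.

Let F := @logZ R G.
Let V' := F_var Q F.

Lemma free_energyE t : random_free_energy P w nu t = F (joint_map X t).
Proof. by rewrite /F /logZ Zsub_setT. Qed.

Let Q04 : forall j, rintegrable Q0 (fun y => y j ^+ 4).
Proof. by have [] := moment4_product E4 V4 single_product (@item_law_EV R lawE lawV G). Qed.

Lemma mean_transfer k (g : weights (R:=R) (edge G + G)%type -> R) : (k <= 4)%N -> growth k g ->
  rintegrable P (fun t => g (joint_map X t)) /\
  mean P (fun t => g (joint_map X t)) = mean Q (fun y => g (hybrid finset.set0 y)).
Proof.
move=> k4 gg; have Ig := growth_rintegrable Q04 k4 gg.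
have [I1 ->] := mean_joint_law Ig.
by have [_ ->] := mean_hybrid pair_product finset.set0 single_product Ig.
Qed.

Let growthF : growth 1 F. Proof. by apply: growth_lip; [exact: measurable_logZ|exact: logZ_lip]. Qed.

Lemma expectation_transfer : fine 'E_P[random_free_energy P w nu] = F_mean Q F.
Proof.
have [_ E] := mean_transfer (isT : (1 <= 4)%N) growthF.
transitivity (mean P (fun t => F (joint_map X t))); last exact: E.
have -> : ('E_P[random_free_energy P w nu] = \int[P]_t (F (joint_map X t))%:E)%E.
  rewrite expectation.unlock; apply: eq_integral => t _.
  by rewrite free_energyE.
by [].
Qed.

Lemma variance_transfer : fine 'V_P[random_free_energy P w nu] = V'.
Proof.
have g0 : growth 1 (fun y => F y - F_mean Q F).
  by apply: growthB => //; apply: (@growth_le _ _ 0 1) => //; exact: growth_cst.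
have g2 : growth 2 (fun y => (F y - F_mean Q F) ^+ 2).
  rewrite (_ : (fun _ => _) = fun y => (F y - F_mean Q F) * (F y - F_mean Q F)); first exact: (growthM g0 g0).
  by apply/funext => y; rewrite expr2.
have [_ E] := mean_transfer (isT : (2 <= 4)%N) g2.
transitivity (mean P (fun t => (F (joint_map X t) - F_mean Q F) ^+ 2)); last exact: E.
have -> : ('V_P[random_free_energy P w nu] = \int[P]_t ((F (joint_map X t) - F_mean Q F) ^+ 2)%:E)%E.
  rewrite /variance covariance.unlock expectation_transfer expectation.unlock; apply: eq_integral => t _.
  by rewrite -free_energyE expr2.
by [].
Qed.

Lemma cdf_transfer x :
  @cdf _ _ _ P (standardize P (random_free_energy P w nu)) x =
  (mean Q (fun y => if F_std Q F (Num.sqrt V') finset.set0 y <= x then 1 else 0))%:E.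
Proof.
pose h (y : weights (R:=R) (edge G + G)%type) : R := if (F y - F_mean Q F) / Num.sqrt V' <= x then 1 else 0.
have gh : growth 0 h.
  apply: (@growth_bd _ _ _ 1); last by move=> y; rewrite /h; case: ifP; rewrite ?normr1 ?normr0.
  apply: measurable_fun_ifT => //; apply: measurable_fun_ler => //.
  by apply: measurable_funM => //; apply: measurable_funB => //; exact: measurable_logZ.
have [_ E] := mean_transfer (leq0n 4) gh.
rewrite -[X in _ = X%:E]E /mean /Rintegral.
pose A := standardize P (random_free_energy P w nu) @^-1` `]-oo, x]%classic.
have mA : measurable A by rewrite -[A]setTI; exact: (measurable_standardize (random_free_energy P w nu)).
have -> : (\int[P]_t (h (joint_map X t))%:E = \int[P]_t (\1_A t)%:E)%E.
  apply: eq_integral => t _; rewrite indicE /h -free_energyE -expectation_transfer -variance_transfer.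
  case: ifP => hx; first by rewrite mem_set // /A /= in_itv.
  by rewrite memNset // /A /= in_itv /= /standardize hx.
rewrite integral_indic // setIT fineK ?fin_num_measure //.
Qed.

(** The Stein expectation of the test pair lies between the distribution function
at a minus c and the distribution function at b minus c. *)
Lemma cdf_sandwich (f k : R -> R) (C c a b eps : R) :
  measurable_fun setT f -> measurable_fun setT k ->
  (forall x, `|f x| <= C /\ `|k x| <= C) ->
  (forall x, (if x <= a then 1 else 0) - c <= k x - x * f x <= (if x <= b then 1 else 0) - c) ->
  `|mean Q (fun y => k (F_std Q F (Num.sqrt V') finset.set0 y) - F_std Q F (Num.sqrt V') finset.set0 y *
         f (F_std Q F (Num.sqrt V') finset.set0 y))| <= eps ->
  fine (@cdf _ _ _ P (standardize P (random_free_energy P w nu)) a) <= c + eps /\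
  c - eps <= fine (@cdf _ _ _ P (standardize P (random_free_energy P w nu)) b).
Proof.
move=> mf mk fkC sand; rewrite !cdf_transfer /=.
set W0 := F_std Q F (Num.sqrt V') finset.set0 => Ee.
have Q4 : forall j, rintegrable Q (fun y => y j ^+ 4).
  by have [] := moment4_product E4 V4 pair_product (@doubled_EV R lawE lawV G).
have gW : growth 1 W0 := growth_F_std Q (@measurable_logZ R G) (@logZ_lip R G) _ _.
have gk := growth_k_std Q (@measurable_logZ R G) (@logZ_lip R G) mk fkC (Num.sqrt V') finset.set0.
have gf := growth_f_std Q (@measurable_logZ R G) (@logZ_lip R G) mf fkC (Num.sqrt V') finset.set0.
have gkf : growth 1 (fun y => k (W0 y) - W0 y * f (W0 y)).
  by apply: growthB; [apply: (@growth_le _ _ 0 1)|exact: (growthM gW gf)].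
have Ikf := growth_rintegrable Q4 (isT : (1 <= 4)%N) gkf.
have Iind x : rintegrable Q (fun y => if W0 y <= x then 1 else 0).
  apply: (growth_rintegrable Q4 (leq0n 4)); apply: (@growth_bd _ _ _ 1); last by move=> y; case: ifP; rewrite ?normr1 ?normr0.
  by apply: measurable_fun_ifT => //; apply: measurable_fun_ler => //; have [] := gW.
have Ic x := rintegrableD (Iind x) (rintegrable_cst Q (- c)).
have Eind x : mean Q (fun y => (if W0 y <= x then 1 else 0) - c) = mean Q (fun y => if W0 y <= x then 1 else 0) - c.
  by rewrite meanB ?mean_cst //; exact: rintegrable_cst.
have lo : mean Q (fun y => if W0 y <= a then 1 else 0) - c <= mean Q (fun y => k (W0 y) - W0 y * f (W0 y)).
  by rewrite -Eind; apply: mean_le => // y; have /andP[] := sand (W0 y).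
have hi : mean Q (fun y => k (W0 y) - W0 y * f (W0 y)) <= mean Q (fun y => if W0 y <= b then 1 else 0) - c.
  by rewrite -Eind; apply: mean_le => // y; have /andP[] := sand (W0 y).
by move: Ee; rewrite ler_norml => /andP[e1 e2]; split; lra.
Qed.

End transfer.

Theorem corollary1p2 (R : realType)
  (d : nat -> measure_display) (Omega : forall n, measurableType (d n))
  (P : forall n, probability (Omega n) R)
  (G : nat -> sgraph) (D : nat)
  (w : forall n, edge (G n) -> {RV (P n) >-> R})
  (nu : forall n, G n -> {RV (P n) >-> R})
  (lawE lawV : probability R R) :
  (forall n, graph_connected (G n)) ->
  #|G n| @[n --> \oo] --> \oo ->
  (forall n, (max_degree (G n) <= D)%N) ->
  (forall n, disordered_weights (P n) (w n) (nu n) lawE lawV) ->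
  finite_fourth_moment lawE ->
  finite_fourth_moment lawV ->
  non_degenerate lawE ->
  cvg_in_distribution P
    (fun n => standardize (P n) (random_free_energy (P n) (w n) (nu n)))
    (normal_prob (0 : R) 1).
Proof.
move=> conn Goo hD dis E4 V4 nd x _.
rewrite -Phi_prob; apply: cvg_EFin.
  by near=> n; rewrite /= fin_num_measure.
apply/cvgrPdist_le => e e0.
have cPhi : {for x, continuous (@Phi R)}.
  by apply/differentiable_continuous/derivable1_diffP; have [] := is_derive_Phi x.
have e20 : 0 < e / 2 by rewrite divr_gt0.
have /cvgrPdist_le/(_ _ e20)/nbhs_ballP[r r0 hr] := cPhi.
rewrite /= in r0.
(* Phi varies by at most e / 2 on [x - h, x + h]; the test pairs of the windows
   [x, x + h] and [x - h, x] give the upper and the lower bound at x. *)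
pose h := r / 2.
have h0 : 0 < h by rewrite divr_gt0.
have hp : Phi (x + h) <= Phi x + e / 2.
  have : `|Phi x - Phi (x + h)| <= e / 2.
    apply: hr; rewrite /ball /= opprD addrA subrr sub0r normrN gtr0_norm // /h; lra.
  by rewrite ler_norml => /andP[]; lra.
have hm : Phi x - e / 2 <= Phi (x - h).
  have : `|Phi x - Phi (x - h)| <= e / 2.
    apply: hr; rewrite /ball /= opprB addrCA subrr addr0 gtr0_norm // /h; lra.
  by rewrite ler_norml => /andP[]; lra.
have xh : x < x + h by rewrite ltrDl.
have hx : x - h < x by rewrite ltrBlDr ltrDl.
have [f1 [k1 [C1 [c1 [C10 mf1 mk1 /andP[_ c1u] [fk1 [t1 s1]]]]]]] := stein_solution xh.
have [f2 [k2 [C2 [c2 [C20 mf2 mk2 /andP[c2l _] [fk2 [t2 s2]]]]]]] := stein_solution hx.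
have [N1 U1] := uniform_bound E4 V4 nd D C10 e20.
have [N2 U2] := uniform_bound E4 V4 nd D C20 e20.
have big M : \forall n \near \oo, (M <= #|G n|)%N by move: M; apply/cvgnyPge.
near=> n.
have G1 : (1 < #|G n|)%N by near: n; exact: big.
have bound (M0 : R) : M0 <= (Num.bound `|M0|)%:R.
  by rewrite (le_trans (ler_norm M0)) // ltW // archi_boundP.
have NG1 : N1 <= #|G n|%:R.
  apply: (le_trans (bound N1)).
  by rewrite ler_nat; near: n; exact: big.
have NG2 : N2 <= #|G n|%:R.
  apply: (le_trans (bound N2)).
  by rewrite ler_nat; near: n; exact: big.
have [_ B1] := U1 _ _ _ (conn n) G1 NG1 (hD n) (single_product (dis n)) (pair_product (dis n)).
have [_ B2] := U2 _ _ _ (conn n) G1 NG2 (hD n) (single_product (dis n)) (pair_product (dis n)).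
have [up _] := cdf_sandwich (dis n) E4 V4 mf1 mk1 fk1 s1 (B1 _ _ mf1 mk1 fk1 t1).
have [_ lo] := cdf_sandwich (dis n) E4 V4 mf2 mk2 fk2 s2 (B2 _ _ mf2 mk2 fk2 t2).
rewrite /= ler_norml; apply/andP; split.
  by rewrite lerBrDr; move: up hp c1u; clear; lra.
by move: lo hm c2l; clear; lra.
Unshelve. all: by end_near. Qed.
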